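(* Let $\varphi\in C^1(\Gamma)$ (complex-valued), and let $$w(x)=\int_\Gamma\frac{\partial\Phi(x,y)}{\partial\tilde\nu(y)}\,\varphi(y)\,ds_y,\qquad x\in\mathbb{R}^2\setminus\Gamma,$$ be the double layer potential with density $\varphi$. Then $$\frac{\partial w_\pm(x)}{\partial\tilde\nu}=\frac{1}{\varepsilon_1\varepsilon_2}\frac{d}{ds_x}\int_\Gamma\Phi(x,y)\,\frac{d\varphi(y)}{ds}\,ds_y+k_0^2\int_\Gamma\Phi(x,y)\,\varphi(y)\,(\nu(x)\cdot\tilde\nu(y))\,ds_y,\qquad x\in\Gamma,$$ where $\displaystyle\frac{\partial w_\pm(x)}{\partial\tilde\nu}=\lim_{h>0,\,h\to0}\nabla w(x\pm h\nu(x))\cdot\tilde\nu(x)$ and $\frac{d}{ds}$ denotes the derivative with respect to arc length along $\Gamma$.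
   Context: Let $k_0>0$ be the free-space wavenumber and let $\varepsilon_1,\varepsilon_2\in\mathbb{C}$ be constants with $\mathrm{Re}\,\varepsilon_1\cdot\mathrm{Re}\,\varepsilon_2<0$ and $\mathrm{Im}\,\varepsilon_j>0$ for $j=1,2$ (lossy hyperbolic medium). Put $A=\mathrm{diag}(1/\varepsilon_1,1/\varepsilon_2)$. The square root $\sqrt z=|z|^{1/2}e^{\frac12 i\arg z}$ is the analytic branch on $\mathbb{C}\setminus\{-it: t\ge0\}$, i.e. $\arg z\in(-\pi/2,3\pi/2)$. Set $$\tilde r(x,y)=\sqrt{(x-y)^TA^{-1}(x-y)}=\sqrt{\varepsilon_1(x_1-y_1)^2+\varepsilon_2(x_2-y_2)^2},$$ $$\Phi(x,y)=\frac{i}{4}\sqrt{\varepsilon_1\varepsilon_2}\,H_0^{(1)}(k_0\tilde r(x,y)),\qquad x\ne y,$$ where $H_0^{(1)}$ is the Hankel function of the first kind of order zero. $\Phi$ is the outgoing fundamental solution of $\nabla\cdot(A\nabla u)+k_0^2u=0$. $\Omega\subset\mathbb{R}^2$ is a bounded simply connected domain with boundary $\Gamma$ of class $C^2$; $\nu=[\nu_1,\nu_2]^T$ is the unit normal on $\Gamma$ pointing out of $\Omega$; $\tilde\nu=A\nu$; and $\frac{\partial f}{\partial\tilde\nu}=\nabla f\cdot\tilde\nu$, with the bilinear dot product (no complex conjugation). $\frac{\partial\Phi(x,y)}{\partial\tilde\nu(y)}=\nabla_y\Phi(x,y)\cdot\tilde\nu(y)$. Arc length $s$ on $\Gamma$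 is taken in the direction of the unit tangent $\tau=[-\nu_2,\nu_1]^T$.
   Formalization: For general φ in C^1 the limit and the d/ds_x derivative may fail to exist; the formal result states that one exists if and only if the other does, with the stated equality, and asserts existence at points where dφ/ds satisfies a Hölder condition. *)

(* Defs.v *)
From Stdlib Require Import Reals Factorial.
From Coquelicot Require Import Coquelicot.
Open Scope R_scope.

(* Principal argument, in (-PI, PI]. *)
Definition Carg (z : C) : R :=
  if Rle_dec 0 (Im z) then acos (Re z / Cmod z) else - acos (Re z / Cmod z).

Definition Clog (z : C) : C := (ln (Cmod z), Carg z).

(* The argument in (-PI/2, 3PI/2), i.e. with the cut along -i[0,oo). *)
Definition arg_cut (z : C) : R :=
  if Rlt_dec (Carg z) (- PI / 2) then Carg z + 2 * PI else Carg z.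

Definition Csqrt (z : C) : C :=
  (sqrt (Cmod z) * cos (arg_cut z / 2), sqrt (Cmod z) * sin (arg_cut z / 2)).

(* Sum of a convergent complex series, computed componentwise. *)
Definition CSeries (a : nat -> C) : C :=
  (Series (fun k => Re (a k)), Series (fun k => Im (a k))).

Definition harmonic (n : nat) : R := sum_n_m (fun k => / INR k) 1 n.

Definition euler_gamma : R :=
  real (Lim_seq (fun n => harmonic n - ln (INR n))).

Definition bessel_J0 (z : C) : C :=
  CSeries (fun k => RtoC ((-1) ^ k / (INR (fact k)) ^ 2) * (z / 2) ^ (2 * k))%C.

(* Power-series form of Y_0, principal branch on C \ (-oo, 0]. *)
Definition bessel_Y0 (z : C) : C :=
  (RtoC (2 / PI) * (Clog (z / 2) + RtoC euler_gamma) * bessel_J0 z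
   - RtoC (2 / PI) *
     CSeries (fun k => RtoC ((-1) ^ k * harmonic k / (INR (fact k)) ^ 2)
                       * (z / 2) ^ (2 * k)))%C.

Definition hankel_H0 (z : C) : C := (bessel_J0 z + Ci * bessel_Y0 z)%C.

Definition point : Type := (R * R)%type.
Definition cvec : Type := (C * C)%type.

(* Bilinear, not sesquilinear. *)
Definition dot (u v : cvec) : C := (fst u * fst v + snd u * snd v)%C.

Definition cplx (v : point) : cvec := (RtoC (fst v), RtoC (snd v)).

Definition shift (x : point) (h : R) (v : point) : point :=
  (fst x + h * fst v, snd x + h * snd v).

Definition CDerive (f : R -> C) (t : R) : C :=
  (Derive (fun u => Re (f u)) t, Derive (fun u => Im (f u)) t).

Definition ex_grad (f : point -> C) (x : point) : Prop :=
  ex_derive (V := C_R_NormedModule) (fun u => f (u, snd x)) (fst x) /\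
  ex_derive (V := C_R_NormedModule) (fun u => f (fst x, u)) (snd x).

Definition grad (f : point -> C) (x : point) : cvec :=
  (CDerive (fun u => f (u, snd x)) (fst x),
   CDerive (fun u => f (fst x, u)) (snd x)).

Definition mulA (eps1 eps2 : C) (v : cvec) : cvec :=
  (fst v / eps1, snd v / eps2)%C.

Definition rtilde (eps1 eps2 : C) (x y : point) : C :=
  Csqrt (eps1 * RtoC ((fst x - fst y) ^ 2) + eps2 * RtoC ((snd x - snd y) ^ 2))%C.

Definition Phi (k0 : R) (eps1 eps2 : C) (x y : point) : C :=
  (Ci / 4 * Csqrt (eps1 * eps2)
   * hankel_H0 (RtoC k0 * rtilde eps1 eps2 x y))%C.

Definition boundary (D : point -> Prop) (x : point) : Prop :=
  ~ locally x D /\ ~ locally x (fun y => ~ D y).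

Definition bounded_set (D : point -> Prop) : Prop :=
  exists M : R, forall x, D x -> Rabs (fst x) <= M /\ Rabs (snd x) <= M.

Definition domain (D : point -> Prop) : Prop :=
  open D /\ (exists x, D x) /\
  forall U V : point -> Prop, open U -> open V ->
    (forall x, D x -> U x \/ V x) -> (forall x, ~ (D x /\ U x /\ V x)) ->
    (forall x, D x -> U x) \/ (forall x, D x -> V x).

(* Every loop [0,1] -> D is contractible in D.  Loops and homotopies are total
   functions; a continuous map on [0,1] or [0,1]^2 extends by clamping. *)
Definition loops_contractible (D : point -> Prop) : Prop :=
  forall c : R -> point,
    (forall t, continuous c t) -> (forall t, 0 <= t <= 1 -> D (c t)) ->
    c 0 = c 1 ->
    exists (H : R * R -> point) (p : point),
      (forall q, continuous H q) /\
      (forall a t, 0 <= a <= 1 -> 0 <= t <= 1 -> D (H (a, t))) /\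
      (forall t, 0 <= t <= 1 -> H (0, t) = c t) /\
      (forall t, 0 <= t <= 1 -> H (1, t) = p) /\
      (forall a, 0 <= a <= 1 -> H (a, 0) = H (a, 1)).

Definition bounded_simply_connected_domain (D : point -> Prop) : Prop :=
  domain D /\ bounded_set D /\ loops_contractible D.

Definition C2 (f : R -> R) : Prop :=
  forall s, ex_derive_n f 2 s /\ continuous (Derive_n f 2) s.

(* The boundary of D is a simple closed curve of class C^2: gamma is its
   arc-length parametrization (L-periodic, L the total length) in the direction
   of the tangent [-nu_2, nu_1], and nu is the unit normal pointing out of D. *)
Record C2_boundary (D : point -> Prop) (nu : point -> point)
    (L : R) (gamma : R -> point) : Prop := {
  length_pos : 0 < L;
  gamma_periodic : forall s, gamma (s + L) = gamma s;
  gamma_simple : forall s t, 0 <= s < L -> 0 <= t < L ->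
    gamma s = gamma t -> s = t;
  gamma_onto : forall x, boundary D x <-> exists s, gamma s = x;
  gamma_C2 : C2 (fun s => fst (gamma s)) /\ C2 (fun s => snd (gamma s));
  nu_unit : forall x, boundary D x -> fst (nu x) ^ 2 + snd (nu x) ^ 2 = 1;
  nu_outward : forall x, boundary D x ->
    at_right 0 (fun h => D (shift x (- h) (nu x)) /\ ~ D (shift x h (nu x)));
  gamma_tangent : forall s,
    is_derive (fun t => fst (gamma t)) s (- snd (nu (gamma s))) /\
    is_derive (fun t => snd (gamma t)) s (fst (nu (gamma s)))
}.

(* Functions on the boundary curve are given on the plane, but only their
   values on the curve matter. *)
Definition arc_derive (gamma : R -> point) (f : point -> C) (s : R) : C :=
  CDerive (fun t => f (gamma t)) s.

Definition C1_on_curve (gamma : R -> point) (f : point -> C) : Prop :=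
  forall s,
    ex_derive (V := C_R_NormedModule) (fun t => f (gamma t)) s /\
    continuous (U := C_UniformSpace) (arc_derive gamma f) s.

Definition holder_at (g : R -> C) (s : R) : Prop :=
  exists M alpha : R, 0 < alpha /\
    forall t, Cmod (g t - g s)%C <= M * Rpower (Rabs (t - s)) alpha.

(* Integrals over the closed curve of functions singular only at gamma s:
   by periodicity one integrates over (s, s + L), improper at both ends. *)
Definition ex_sing_int (L s : R) (f : R -> C) : Prop :=
  ex_RInt_gen (V := C_R_NormedModule) f (at_right s) (at_left (s + L)).

Definition sing_int (L s : R) (f : R -> C) : C :=
  RInt_gen (V := C_R_CompleteNormedModule) f (at_right s) (at_left (s + L)).

Definition double_layer_integrand (k0 : R) (eps1 eps2 : C) (nu : point -> point)
    (gamma : R -> point) (phi : point -> C) (x : point) (t : R) : C :=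
  (dot (grad (Phi k0 eps1 eps2 x) (gamma t))
       (mulA eps1 eps2 (cplx (nu (gamma t))))
   * phi (gamma t))%C.

Definition double_layer (k0 : R) (eps1 eps2 : C) (nu : point -> point)
    (L : R) (gamma : R -> point) (phi : point -> C) (x : point) : C :=
  RInt (V := C_R_CompleteNormedModule)
    (double_layer_integrand k0 eps1 eps2 nu gamma phi x) 0 L.

(* l is the limit of grad w (x + sg h nu(x)) . A nu(x) as h -> 0, h > 0. *)
Definition is_conormal_lim (eps1 eps2 : C) (nu : point -> point)
    (w : point -> C) (sg : R) (x : point) (l : C) : Prop :=
  filterlim
    (fun h => dot (grad w (shift x (sg * h) (nu x)))
                  (mulA eps1 eps2 (cplx (nu x))))
    (at_right 0) (locally (T := C_UniformSpace) l).

(* Main.v *)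
Require Import Defs.
From Stdlib Require Import Reals Lra Lia Psatz Factorial ZArith.
From Coquelicot Require Import Coquelicot.
Open Scope R_scope.

(* On the upper half-plane H_0^(1)(k0 sqrt q) = P(q) Log q + R(q) with P, R entire, so that
   Phi(x, y) = kappa K0(Q(x - y)), where Q is the quadratic form of A^-1, whose values off 0 have positive
   imaginary part.  Off the curve, the Bessel equation and an integration by parts turn the conormal derivative of
   w into (eps1 eps2)^-1 times the tangential derivative of the single layer with density phi' plus the k0^2 term,
   which is continuous across the curve.  For a merely continuous density psi, both the tangential derivative
   at distance h of the curve and the difference quotient with step delta of the single layer along the curve differ
   by o(1) from one and the same truncated principal value, at 2h and at 2|delta|.  Indeed, both kernels are
   dominated at scale h by h / u^2 away from the singularity, and the constant part psi(s) of the density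
   contributes nothing singular, because the kernel differentiated along the curve integrates to 0 over a period.
   Hence one limit exists if and only if the other does, and a Hoelder condition makes the principal
   value converge.  The logarithmic singularity is handled by replacing Q with Q + i rho^2, which keeps all
   integrals proper, and letting rho tend to 0 at fixed delta. *)

(** * Functions of a real variable with complex values *)

(** In a hyperbolic medium Re Q vanishes along two lines, so a lower bound |Q(z)| >= c |z|^2 has to
    come from Im Q. The main obstacle is that the gradient of the kernel has size 1/|z|, which is
    not integrable on the curve, so dominated convergence cannot reach the derivative of a single
    layer; for a density that is only continuous this derivative may fail to exist, which is why
    existence is stated as an equivalence. The cutoff 2 |delta| leaves room: if |t - s| >= 2 |delta|
    and |r| <= |delta|, then s + r and t are at least |t - s| / 2 apart, so second-order Taylor
    bounds are available. Below the cutoff everything is scale invariant: a kernel of size 1/h on an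
    interval of length 4h, or a difference of two logarithms at scale |delta|, costs a fixed
    constant times the oscillation of the density. Logarithms are weakened to inverse square roots,
    whose primitives are elementary and whose integrals over short intervals are small. *)

Local Notation isd := (is_derive (K := R_AbsRing) (V := C_R_NormedModule)).
Local Notation ccont := (continuous (T := R_UniformSpace) (U := C_UniformSpace)).
Local Notation isI := (is_RInt (V := C_R_NormedModule)).
Definition CI (f : R -> C) (a b : R) : C := RInt (V := C_R_CompleteNormedModule) f a b.

Lemma norm_Cmod (z : C) : norm (V := C_R_NormedModule) z = Cmod z.
Proof.
  unfold Cmod, norm; simpl; unfold prod_norm, norm; simpl; unfold abs; simpl.
  f_equal. rewrite !Rmult_1_r. now rewrite <- !Rabs_mult, !Rabs_pos_eq by nra.
Qed.

Lemma isd_eps (f : R -> C) (t : R) (l : C) :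
  isd f t l <->
  forall eps, 0 < eps -> exists d, 0 < d /\
    forall u, Rabs (u - t) < d ->
      Cmod (f u - f t - RtoC (u - t) * l) <= eps * Rabs (u - t).
Proof.
  assert (E : forall u : R, norm (V := C_R_NormedModule)
     (minus (minus (f u) (f t)) (scal (minus u t) l))
     = Cmod (f u - f t - RtoC (u - t) * l)).
  { intros u. rewrite norm_Cmod. f_equal.
    destruct l as [l1 l2], (f u) as [a b], (f t) as [c e].
    unfold minus, scal, opp, plus; simpl. unfold prod_scal, prod_plus, prod_opp, scal, plus, opp; simpl.
    unfold mult; simpl. unfold Cminus, Cplus, Copp, Cmult; simpl.
    apply injective_projections; simpl; ring. }
  split.
  - intros [_ H] eps He.
    specialize (H t (fun P HP => HP) (mkposreal eps He)).
    destruct H as [d Hd]. exists d; split; [apply cond_pos|].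
    intros u Hu. rewrite <- E. exact (Hd u Hu).
  - intros H. split; [apply is_linear_scal_l|].
    intros x Hx eps.
    assert (x = t) as ->. { symmetry. apply (is_filter_lim_locally_unique t x Hx). }
    destruct (H eps (cond_pos eps)) as [d [Hd Hd']].
    exists (mkposreal d Hd). intros u Hu. eapply Rle_trans; [apply Req_le, E|]. apply (Hd' u Hu).
Qed.

Lemma ccont_eps (f : R -> C) (t : R) :
  ccont f t <->
  forall eps, 0 < eps -> exists d, 0 < d /\
    forall u, Rabs (u - t) < d -> Cmod (f u - f t) < eps.
Proof.
  assert (E : forall u, Cmod (f u - f t) = norm (V := C_R_NormedModule) (minus (f u) (f t))).
  { intros; now rewrite norm_Cmod. }
  unfold continuous. split.
  - intros H eps He.
    pose proof (proj1 (filterlim_locally_ball_norm (U := C_R_NormedModule) f (f t)) H (mkposreal eps He)) as [d Hd].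
    exists d; split; [apply cond_pos|]. intros u Hu. rewrite E. apply (Hd u Hu).
  - intros H. apply (filterlim_locally_ball_norm (U := C_R_NormedModule)). intros eps.
    destruct (H eps (cond_pos eps)) as [d [Hd Hd']].
    exists (mkposreal d Hd). intros u Hu. eapply Rle_lt_trans; [apply Req_le; symmetry; apply E|]. apply (Hd' u Hu).
Qed.

Lemma isd_ccont (f : R -> C) t l : isd f t l -> ccont f t.
Proof. intros H. apply (ex_derive_continuous (V := C_R_NormedModule)). now exists l. Qed.

Lemma fst_le_Cmod (z : C) : Rabs (fst z) <= Cmod z.
Proof. eapply Rle_trans; [|apply Rmax_Cmod]. apply Rmax_l. Qed.

Lemma snd_le_Cmod (z : C) : Rabs (snd z) <= Cmod z.
Proof. eapply Rle_trans; [|apply Rmax_Cmod]. apply Rmax_r. Qed.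

Lemma Cmod_le_abs (z : C) : Cmod z <= Rabs (fst z) + Rabs (snd z).
Proof.
  replace z with (RtoC (fst z) + Ci * RtoC (snd z))%C at 1
    by (destruct z; apply injective_projections; simpl; ring).
  eapply Rle_trans; [apply Cmod_triangle|].
  rewrite Cmod_mult, Cmod_Ci, !Cmod_R. lra.
Qed.

Lemma isd_pair (f : R -> C) (t : R) (l : C) :
  isd f t l <->
  is_derive (fun u => fst (f u)) t (fst l) /\ is_derive (fun u => snd (f u)) t (snd l).
Proof.
  split.
  - intros H; split.
    + apply (filterdiff_comp f fst (fun y => scal y l) fst); [exact H|].
      apply filterdiff_linear, is_linear_fst.
    + apply (filterdiff_comp f snd (fun y => scal y l) snd); [exact H|].
      apply filterdiff_linear, is_linear_snd.
  - intros [H1 H2]. apply isd_eps. intros eps He.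
    assert (E : forall (g : R -> R) m, is_derive g t m -> exists d, 0 < d /\ forall u, Rabs (u - t) < d ->
       Rabs (g u - g t - (u - t) * m) <= eps / 2 * Rabs (u - t)).
    { intros g m [_ H]. destruct (H t (fun P HP => HP) (mkposreal (eps / 2) ltac:(lra))) as [d Hd].
      exists d; split; [apply cond_pos|]. intros u Hu. apply (Hd u Hu). }
    destruct (E _ _ H1) as [d1 [D1 K1]]. destruct (E _ _ H2) as [d2 [D2 K2]].
    exists (Rmin d1 d2). split; [now apply Rmin_pos|]. intros u Hu.
    assert (A1 := Rmin_l d1 d2). assert (A2 := Rmin_r d1 d2).
    eapply Rle_trans; [apply Cmod_le_abs|].
    specialize (K1 u ltac:(lra)). specialize (K2 u ltac:(lra)).
    destruct l as [l1 l2]; simpl in *.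
    replace (fst (f u) + - fst (f t) + - ((u - t) * l1 - 0 * l2))
      with (fst (f u) - fst (f t) - (u - t) * l1) by ring.
    replace (snd (f u) + - snd (f t) + - ((u - t) * l2 + 0 * l1))
      with (snd (f u) - snd (f t) - (u - t) * l2) by ring.
    lra.
Qed.

Lemma isd_const (c : C) t : isd (fun _ => c) t (RtoC 0).
Proof. apply (is_derive_const (V := C_R_NormedModule)). Qed.

Lemma isd_id t : isd (fun u => RtoC u) t (RtoC 1).
Proof. apply isd_pair; simpl. split; [apply (is_derive_id (K := R_AbsRing))|apply (is_derive_const (K := R_AbsRing) (V := R_NormedModule))]. Qed.

Lemma isd_plus (f g : R -> C) (t : R) (a b : C) : isd f t a -> isd g t b -> isd (fun u => f u + g u)%C t (a + b)%C.
Proof. intros; now apply (is_derive_plus (V := C_R_NormedModule)). Qed.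

Lemma isd_minus (f g : R -> C) (t : R) (a b : C) : isd f t a -> isd g t b -> isd (fun u => f u - g u)%C t (a - b)%C.
Proof. intros; now apply (is_derive_minus (V := C_R_NormedModule)). Qed.

Lemma isd_mult (f g : R -> C) (t : R) (a b : C) : isd f t a -> isd g t b ->
  isd (fun u => f u * g u)%C t (a * g t + f t * b)%C.
Proof.
  intros Hf Hg. apply isd_pair in Hf. apply isd_pair in Hg. destruct Hf as [f1 f2], Hg as [g1 g2].
  apply isd_pair; simpl. split.
  - evar_last.
    apply (is_derive_minus (V := R_NormedModule) (fun u => fst (f u) * fst (g u)) (fun u => snd (f u) * snd (g u))).
    apply (is_derive_mult (K := R_AbsRing)); [exact f1|exact g1|intros; apply Rmult_comm].
    apply (is_derive_mult (K := R_AbsRing)); [exact f2|exact g2|intros; apply Rmult_comm].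
    unfold minus, plus, opp, mult; simpl; ring.
  - evar_last.
    apply (is_derive_plus (V := R_NormedModule) (fun u => fst (f u) * snd (g u)) (fun u => snd (f u) * fst (g u))).
    apply (is_derive_mult (K := R_AbsRing)); [exact f1|exact g2|intros; apply Rmult_comm].
    apply (is_derive_mult (K := R_AbsRing)); [exact f2|exact g1|intros; apply Rmult_comm].
    unfold minus, plus, opp, mult; simpl; ring.
Qed.

Lemma isd_scal (c : C) (f : R -> C) (t : R) (a : C) : isd f t a -> isd (fun u => c * f u)%C t (c * a)%C.
Proof.
  intros H. evar_last. apply (isd_mult (fun _ => c) f); [apply isd_const|exact H]. simpl; ring.
Qed.

Lemma isd_fst (f : R -> C) t a : isd f t a -> isd (fun u => RtoC (fst (f u))) t (RtoC (fst a)).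
Proof. intros H. apply isd_pair in H. apply isd_pair; simpl. split; [apply H|apply (is_derive_const (K := R_AbsRing) (V := R_NormedModule))]. Qed.

Lemma isd_snd (f : R -> C) t a : isd f t a -> isd (fun u => RtoC (snd (f u))) t (RtoC (snd a)).
Proof. intros H. apply isd_pair in H. apply isd_pair; simpl. split; [apply H|apply (is_derive_const (K := R_AbsRing) (V := R_NormedModule))]. Qed.

Lemma isd_eq (f : R -> C) (t : R) (a b : C) : isd f t a -> a = b -> isd f t b.
Proof. now intros H <-. Qed.

Lemma isd_id_minus (a t : R) : isd (fun u => RtoC (u - a)) t (RtoC 1).
Proof.
  apply (isd_eq _ _ (RtoC 1 - 0)%C); [|ring].
  apply is_derive_ext with (fun t => RtoC t - RtoC a)%C.
  { intros; now rewrite RtoC_minus. }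
  apply isd_minus; [apply isd_id|apply isd_const].
Qed.

Lemma isd_unique (f : R -> C) (t : R) (a b : C) : isd f t a -> isd f t b -> a = b.
Proof.
  intros H1 H2. apply isd_pair in H1. apply isd_pair in H2.
  apply injective_projections.
  - rewrite <- (is_derive_unique _ _ _ (proj1 H1)). apply is_derive_unique, H2.
  - rewrite <- (is_derive_unique _ _ _ (proj2 H1)). apply is_derive_unique, H2.
Qed.

Lemma CDerive_unique (f : R -> C) (t : R) (a : C) : isd f t a -> CDerive f t = a.
Proof.
  intros H. apply isd_pair in H. unfold CDerive, Re, Im.
  apply injective_projections; apply is_derive_unique, H.
Qed.

Lemma isd_shift (f : R -> C) (t b : R) (a : C) : isd f (t + b) a -> isd (fun u => f (u + b)) t a.
Proof.
  intros H. apply isd_eps. intros eps He. destruct (proj1 (isd_eps _ _ _) H eps He) as [d [Hd K]].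
  exists d; split; auto. intros u Hu.
  specialize (K (u + b)). replace (u + b - (t + b)) with (u - t) in K by ring. auto.
Qed.

Lemma ccont_plus (f g : R -> C) (t : R) : ccont f t -> ccont g t -> ccont (fun u => f u + g u)%C t.
Proof. intros; now apply (continuous_plus (V := C_R_NormedModule)). Qed.

Lemma ccont_minus (f g : R -> C) (t : R) : ccont f t -> ccont g t -> ccont (fun u => f u - g u)%C t.
Proof. intros; now apply (continuous_minus (V := C_R_NormedModule)). Qed.

Lemma ccont_const (c : C) (t : R) : ccont (fun _ => c) t.
Proof. apply continuous_const. Qed.

Lemma ccont_bounded_near (f : R -> C) (t : R) : ccont f t -> exists d, 0 < d /\
  forall u, Rabs (u - t) < d -> Cmod (f u) <= Cmod (f t) + 1.
Proof.
  intros H. destruct (proj1 (ccont_eps _ _) H 1 ltac:(lra)) as [d [Hd K]].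
  exists d; split; auto. intros u Hu. specialize (K u Hu).
  replace (f u) with (f t + (f u - f t))%C by ring. eapply Rle_trans; [apply Cmod_triangle|]. lra.
Qed.

Lemma ccont_mult (f g : R -> C) (t : R) : ccont f t -> ccont g t -> ccont (fun u => f u * g u)%C t.
Proof.
  intros Hf Hg. apply ccont_eps. intros eps He.
  destruct (ccont_bounded_near g t Hg) as [d0 [D0 K0]].
  assert (M1 := Cmod_ge_0 (f t)). assert (M2 := Cmod_ge_0 (g t)).
  set (M := Cmod (f t) + Cmod (g t) + 1). assert (HM : 0 < M) by (unfold M; lra).
  assert (He' : 0 < eps / (2 * M)) by (apply Rdiv_lt_0_compat; lra).
  destruct (proj1 (ccont_eps _ _) Hf _ He') as [d1 [D1 K1]].
  destruct (proj1 (ccont_eps _ _) Hg _ He') as [d2 [D2 K2]].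
  exists (Rmin d0 (Rmin d1 d2)). split; [repeat apply Rmin_pos; auto|].
  intros u Hu.
  assert (A1 := Rmin_l d0 (Rmin d1 d2)). assert (A2 := Rmin_r d0 (Rmin d1 d2)).
  assert (A3 := Rmin_l d1 d2). assert (A4 := Rmin_r d1 d2).
  specialize (K0 u ltac:(lra)). specialize (K1 u ltac:(lra)). specialize (K2 u ltac:(lra)).
  replace (f u * g u - f t * g t)%C with ((f u - f t) * g u + f t * (g u - g t))%C by ring.
  eapply Rle_lt_trans; [apply Cmod_triangle|]. rewrite !Cmod_mult.
  assert (B1 := Cmod_ge_0 (f u - f t)). assert (B2 := Cmod_ge_0 (g u - g t)).
  assert (B3 := Cmod_ge_0 (g u)).
  assert (eps = eps / (2 * M) * M + eps / (2 * M) * M) by (field; lra).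
  assert (Cmod (f u - f t) * Cmod (g u) <= Cmod (f u - f t) * M).
  { apply Rmult_le_compat_l; unfold M; lra. }
  assert (Cmod (f t) * Cmod (g u - g t) <= M * Cmod (g u - g t)).
  { apply Rmult_le_compat_r; unfold M; lra. }
  nra.
Qed.

Lemma ccont_shift (f : R -> C) (t b : R) : ccont f (t + b) -> ccont (fun u => f (u + b)) t.
Proof.
  intros H. apply ccont_eps. intros eps He. destruct (proj1 (ccont_eps _ _) H eps He) as [d [Hd K]].
  exists d; split; auto. intros u Hu. apply K. now replace (u + b - (t + b)) with (u - t) by ring.
Qed.

Lemma ccont_refl (f : R -> C) (t c : R) : ccont f (c - t) -> ccont (fun u => f (c - u)) t.
Proof.
  intros H. apply ccont_eps. intros eps He. destruct (proj1 (ccont_eps _ _) H eps He) as [d [Hd K]].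
  exists d; split; auto. intros u Hu. apply K. replace (c - u - (c - t)) with (- (u - t)) by ring.
  now rewrite Rabs_Ropp.
Qed.

Lemma ccont_ext_loc (f g : R -> C) (t d : R) : 0 < d -> (forall u, Rabs (u - t) < d -> f u = g u) -> ccont f t -> ccont g t.
Proof.
  intros Hd E H. apply ccont_eps. intros eps He.
  destruct (proj1 (ccont_eps _ _) H eps He) as [d' [Hd' K]].
  exists (Rmin d d'). split; [now apply Rmin_pos|]. intros u Hu.
  assert (A1 := Rmin_l d d'). assert (A2 := Rmin_r d d').
  rewrite <- !E. apply K; lra. rewrite Rminus_diag, Rabs_R0; auto. lra.
Qed.

Lemma cont_Cmod (f : R -> C) (t : R) : ccont f t -> continuous (fun u => Cmod (f u)) t.
Proof.
  intros H. apply (continuous_ext (fun u => norm (V := C_R_NormedModule) (f u))).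
  - intros; apply norm_Cmod.
  - apply (continuous_comp (V := C_UniformSpace) f (norm (V := C_R_NormedModule))); [exact H|].
    apply (filterlim_norm (V := C_R_NormedModule)).
Qed.

Lemma ccont_bounded (f : R -> C) (a b : R) : a <= b -> (forall t, a <= t <= b -> ccont f t) ->
  exists K, 0 < K /\ forall t, a <= t <= b -> Cmod (f t) <= K.
Proof.
  intros Hab H.
  destruct (continuity_ab_maj (fun t => Cmod (f t)) a b Hab) as [x [Hx _]].
  - intros c Hc. apply continuity_pt_filterlim. apply (cont_Cmod f c), H, Hc.
  - exists (Cmod (f x) + 1). assert (A := Cmod_ge_0 (f x)). split; [lra|].
    intros t Ht. specialize (Hx t Ht). lra.
Qed.

(** There is no intermediate point for complex-valued functions, so the real mean value theorem is
    applied to the real scalar product of [f] with the fixed vector [w = f b - f a]: its increment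
    is |w|^2 and its derivative is at most K |w|. *)
Lemma mvt_C (f df : R -> C) (a b K : R) : a <= b ->
  (forall t, a <= t <= b -> isd f t (df t) /\ Cmod (df t) <= K) ->
  Cmod (f b - f a) <= K * (b - a).
Proof.
  intros Hab H. set (w := (f b - f a)%C).
  destruct (Req_dec (Cmod w) 0) as [E|E].
  { rewrite E. specialize (H a ltac:(lra)). assert (A := Cmod_ge_0 (df a)). apply Rmult_le_pos; lra. }
  assert (Hw : 0 < Cmod w) by (assert (A := Cmod_ge_0 w); lra).
  set (h := fun t => fst (f t) * fst w + snd (f t) * snd w).
  set (dh := fun t => fst (df t) * fst w + snd (df t) * snd w).
  assert (D : forall t, a <= t <= b -> is_derive h t (dh t)).
  { intros t Ht. destruct (proj1 (isd_pair _ _ _) (proj1 (H t Ht))) as [H1 H2].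
    evar_last. apply (is_derive_plus (V := R_NormedModule) (fun u => fst (f u) * fst w) (fun u => snd (f u) * snd w)).
    apply (is_derive_mult (K := R_AbsRing) _ (fun _ => fst w)); [exact H1|apply (is_derive_const (K := R_AbsRing) (V := R_NormedModule))|intros; apply Rmult_comm].
    apply (is_derive_mult (K := R_AbsRing) _ (fun _ => snd w)); [exact H2|apply (is_derive_const (K := R_AbsRing) (V := R_NormedModule))|intros; apply Rmult_comm].
    unfold dh, plus, mult, zero; simpl. ring. }
  destruct (MVT_gen h a b dh) as [c [Hc Ec]].
  - intros x Hx. rewrite Rmin_left, Rmax_right in Hx by lra. apply D; lra.
  - intros x Hx. rewrite Rmin_left, Rmax_right in Hx by lra.
    apply continuity_pt_filterlim. apply (ex_derive_continuous (V := R_NormedModule)).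
    exists (dh x). apply D; lra.
  - rewrite Rmin_left, Rmax_right in Hc by lra.
    assert (E1 : h b - h a = Cmod w * Cmod w).
    { replace (Cmod w * Cmod w) with (Cmod w ^ 2) by ring. rewrite Cmod2_alt. unfold h, w, Re, Im; simpl. ring. }
    assert (E2 : dh c <= Cmod (df c) * Cmod w).
    { rewrite <- (Cmod_conj w), <- Cmod_mult.
      replace (dh c) with (Re (df c * Cconj w)) by (unfold dh, Re; destruct w, (df c); simpl; ring).
      eapply Rle_trans; [apply Rle_abs|apply re_le_Cmod]. }
    assert (E3 := proj2 (H c Hc)).
    apply Rmult_le_reg_r with (Cmod w); auto. rewrite <- E1, Ec.
    assert (dh c <= K * Cmod w) by nra. nra.
Qed.

Lemma mvt_C_abs (f df : R -> C) (a b K : R) :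
  (forall t, Rmin a b <= t <= Rmax a b -> isd f t (df t) /\ Cmod (df t) <= K) ->
  Cmod (f b - f a) <= K * Rabs (b - a).
Proof.
  intros H. destruct (Rle_dec a b) as [h|h].
  - rewrite Rabs_pos_eq by lra. rewrite Rmin_left, Rmax_right in H by lra. now apply mvt_C with df.
  - rewrite Rabs_left by lra. rewrite Rmin_right, Rmax_left in H by lra.
    replace (f b - f a)%C with (- (f a - f b))%C by ring. rewrite Cmod_opp.
    replace (- (b - a)) with (a - b) by ring. apply mvt_C with df; [lra|exact H].
Qed.

(** Two mean value bounds: [t -> f t - (t - a) df a] has derivative [df t - df a], which is itself
    at most K |b - a|. The sharp constant K/2 would bring nothing later. *)
Lemma taylor_C (f df d2f : R -> C) (a b K : R) :
  (forall t, Rmin a b <= t <= Rmax a b ->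
     isd f t (df t) /\ isd df t (d2f t) /\ Cmod (d2f t) <= K) ->
  Cmod (f b - f a - RtoC (b - a) * df a) <= K * (b - a) ^ 2.
Proof.
  intros H.
  assert (HK : 0 <= K).
  { destruct (H a) as [_ [_ A]]; [split; [apply Rmin_l|apply Rmax_l]|]. assert (B := Cmod_ge_0 (d2f a)). lra. }
  assert (A := mvt_C_abs (fun t => f t - RtoC (t - a) * df a)%C (fun t => df t - df a)%C a b (K * Rabs (b - a))).
  simpl in A. replace ((b - a) ^ 2) with (Rabs (b - a) * Rabs (b - a))
    by (rewrite <- Rabs_mult, Rabs_pos_eq by apply Rle_0_sqr; ring).
  rewrite <- Rmult_assoc.
  replace (f b - f a - RtoC (b - a) * df a)%C with
    (f b - RtoC (b - a) * df a - (f a - RtoC (a - a) * df a))%C.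
  2:{ rewrite Rminus_diag. ring. }
  apply A. intros t Ht. destruct (H t Ht) as [H1 [H2 H3]]. split.
  - apply isd_minus; [exact H1|]. eapply isd_eq.
    + apply (isd_mult (fun t => RtoC (t - a)) (fun _ => df a)); [apply isd_id_minus|apply isd_const].
    + ring.
  - eapply Rle_trans.
    + apply (mvt_C_abs df d2f). intros u Hu.
      assert (Rmin a b <= u <= Rmax a b).
      { revert Ht Hu. unfold Rmin, Rmax. repeat destruct Rle_dec; lra. }
      split; apply H; auto.
    + apply Rmult_le_compat_l; auto. revert Ht. unfold Rmin, Rmax, Rabs.
      repeat destruct Rle_dec; repeat destruct Rcase_abs; lra.
Qed.

(** * Integrals over compact intervals *)

Definition cont_on (f : R -> C) (a b : R) : Prop := forall t, a <= t <= b -> ccont f t.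

Lemma CI_correct (f : R -> C) (a b : R) : a <= b -> cont_on f a b -> isI f a b (CI f a b).
Proof.
  intros Hab H. apply (RInt_correct (V := C_R_CompleteNormedModule)).
  apply (ex_RInt_continuous (V := C_R_CompleteNormedModule)).
  intros z Hz. rewrite Rmin_left, Rmax_right in Hz by lra. apply H; lra.
Qed.

Lemma CI_unique (f : R -> C) (a b : R) (l : C) : isI f a b l -> CI f a b = l.
Proof. apply (is_RInt_unique (V := C_R_CompleteNormedModule)). Qed.

Lemma isI_plus (f g : R -> C) (a b : R) (l m : C) :
  isI f a b l -> isI g a b m -> isI (fun t => f t + g t)%C a b (l + m)%C.
Proof. apply (is_RInt_plus (V := C_R_NormedModule)). Qed.

Lemma isI_minus (f g : R -> C) (a b : R) (l m : C) :
  isI f a b l -> isI g a b m -> isI (fun t => f t - g t)%C a b (l - m)%C.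
Proof. apply (is_RInt_minus (V := C_R_NormedModule)). Qed.

Lemma isI_fst (f : R -> C) (a b : R) (l : C) : isI f a b l -> is_RInt (fun t => fst (f t)) a b (fst l).
Proof. apply (is_RInt_fct_extend_fst (U := R_NormedModule) (V := R_NormedModule)). Qed.

Lemma isI_snd (f : R -> C) (a b : R) (l : C) : isI f a b l -> is_RInt (fun t => snd (f t)) a b (snd l).
Proof. apply (is_RInt_fct_extend_snd (U := R_NormedModule) (V := R_NormedModule)). Qed.

Lemma isI_scal (c : C) (f : R -> C) (a b : R) (l : C) :
  isI f a b l -> isI (fun t => c * f t)%C a b (c * l)%C.
Proof.
  intros H. assert (H1 := isI_fst _ _ _ _ H). assert (H2 := isI_snd _ _ _ _ H).
  apply (is_RInt_fct_extend_pair (U := R_NormedModule) (V := R_NormedModule)); simpl.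
  - apply (is_RInt_minus (V := R_NormedModule) (fun t => fst c * fst (f t)) (fun t => snd c * snd (f t)));
    apply (is_RInt_scal (V := R_NormedModule)); assumption.
  - apply (is_RInt_plus (V := R_NormedModule) (fun t => fst c * snd (f t)) (fun t => snd c * fst (f t)));
    apply (is_RInt_scal (V := R_NormedModule)); assumption.
Qed.

Lemma CI_plus (f g : R -> C) (a b : R) (Hab : a <= b) (Hf : cont_on f a b) (Hg : cont_on g a b) : CI (fun t => f t + g t)%C a b = (CI f a b + CI g a b)%C.
Proof. apply CI_unique, isI_plus; now apply CI_correct. Qed.

Lemma CI_minus (f g : R -> C) (a b : R) (Hab : a <= b) (Hf : cont_on f a b) (Hg : cont_on g a b) : CI (fun t => f t - g t)%C a b = (CI f a b - CI g a b)%C.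
Proof. apply CI_unique, isI_minus; now apply CI_correct. Qed.

Lemma CI_scal (f : R -> C) (a b : R) (Hab : a <= b) (Hf : cont_on f a b) (c : C) : CI (fun t => c * f t)%C a b = (c * CI f a b)%C.
Proof. apply CI_unique, isI_scal; now apply CI_correct. Qed.

Lemma CI_chasles (f : R -> C) (a b : R) (Hf : cont_on f a b) (c : R) : a <= c <= b -> CI f a b = (CI f a c + CI f c b)%C.
Proof.
  intros Hc. apply CI_unique.
  apply (is_RInt_Chasles (V := C_R_NormedModule)) with c; apply CI_correct;
    try lra; intros t Ht; apply Hf; lra.
Qed.

Lemma CI_bound_prim (f : R -> C) (a b : R) (Hab : a <= b) (Hf : cont_on f a b) (G k : R -> R) :
  (forall t, a <= t <= b -> is_derive G t (k t) /\ continuous k t /\ Cmod (f t) <= k t) ->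
  Cmod (CI f a b) <= G b - G a.
Proof.
  intros H. rewrite <- norm_Cmod.
  apply (norm_RInt_le (V := C_R_NormedModule) f k a b); auto.
  - intros x Hx. rewrite norm_Cmod. now apply H.
  - now apply CI_correct.
  - apply (is_RInt_derive (V := R_CompleteNormedModule) G k); rewrite Rmin_left, Rmax_right by lra; intros; now apply H.
Qed.

Lemma CI_bound (f : R -> C) (a b : R) (Hab : a <= b) (Hf : cont_on f a b) (K : R) : (forall t, a <= t <= b -> Cmod (f t) <= K) -> Cmod (CI f a b) <= K * (b - a).
Proof.
  intros H. rewrite <- norm_Cmod, Rmult_comm.
  apply (norm_RInt_le_const (V := C_R_NormedModule) f a b); auto.
  - intros x Hx. rewrite norm_Cmod. now apply H.
  - now apply CI_correct.
Qed.

Lemma CI_shift (f : R -> C) (a b : R) (Hab : a <= b) (Hf : cont_on f a b) (c : R) : CI (fun t => f (t - c)) (a + c) (b + c) = CI f a b.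
Proof.
  apply CI_unique.
  apply (is_RInt_ext (V := C_R_NormedModule) (fun t => scal 1 (f (1 * t + - c)))).
  { intros x _. etransitivity; [apply (scal_one (V := C_R_NormedModule))|]. f_equal. ring. }
  apply (is_RInt_comp_lin (V := C_R_NormedModule) f 1 (- c)).
  replace (1 * (a + c) + - c) with a by ring. replace (1 * (b + c) + - c) with b by ring.
  now apply CI_correct.
Qed.

Lemma CI_refl (f : R -> C) (a b : R) (Hab : a <= b) (Hf : cont_on f a b) (c : R) : CI (fun t => f (c - t)) (c - b) (c - a) = CI f a b.
Proof.
  apply CI_unique.
  assert (H : isI (fun t => scal (-1) (f (-1 * t + c))) (c - a) (c - b) (CI f a b)).
  { apply (is_RInt_comp_lin (V := C_R_NormedModule) f (-1) c).
    replace (-1 * (c - a) + c) with a by ring. replace (-1 * (c - b) + c) with b by ring.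
    now apply CI_correct. }
  apply (is_RInt_swap (V := C_R_NormedModule)) in H.
  apply (is_RInt_opp (V := C_R_NormedModule)) in H.
  replace (CI f a b) with (opp (opp (CI f a b)) : C) by apply (opp_opp (G := C_R_NormedModule)).
  eapply (is_RInt_ext (V := C_R_NormedModule)); [|exact H].
  intros x _. simpl. replace (-1 * x + c) with (c - x) by ring.
  destruct (f (c - x)) as [u v]. apply injective_projections; unfold opp, scal; simpl;
  unfold opp, scal; simpl; unfold mult; simpl; ring.
Qed.
Lemma CI_ext (f g : R -> C) (a b : R) : a <= b -> (forall t, a < t < b -> f t = g t) -> CI f a b = CI g a b.
Proof.
  intros Hab H. apply (RInt_ext (V := C_R_CompleteNormedModule)).
  intros x Hx. rewrite Rmin_left, Rmax_right in Hx by lra. now apply H.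
Qed.

Lemma CI_derive (f df : R -> C) (a b : R) : a <= b ->
  (forall t, a <= t <= b -> isd f t (df t)) -> cont_on df a b -> CI df a b = (f b - f a)%C.
Proof.
  intros Hab H Hc. apply CI_unique.
  apply (is_RInt_derive (V := C_R_CompleteNormedModule) f df); rewrite Rmin_left, Rmax_right by lra; auto.
Qed.

(** For u <= v, the interval [u, v + L] is split once at v and once at u + L; the leftover pieces
    over [u, v] and [u + L, v + L] agree by periodicity. *)
Lemma CI_periodic (f : R -> C) (L a b : R) : 0 < L -> (forall t, ccont f t) -> (forall t, f (t + L) = f t) ->
  CI f a (a + L) = CI f b (b + L).
Proof.
  intros HL Hc Hp.
  assert (Hon : forall u v, cont_on f u v) by (intros u v t _; apply Hc).
  assert (Hex : forall u v, isI f u v (CI f u v)).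
  { intros u v. apply (RInt_correct (V := C_R_CompleteNormedModule)).
    apply (ex_RInt_continuous (V := C_R_CompleteNormedModule)). intros; apply Hc. }
  assert (W : forall u v, u <= v -> CI f u (u + L) = CI f v (v + L)).
  { intros u v Huv.
    assert (E1 := CI_shift f u v Huv (Hon u v) L).
    rewrite (CI_ext _ f) in E1; [|lra|intros t _; rewrite <- (Hp (t - L)); f_equal; ring].
    assert (E2 := CI_chasles f u (v + L) (Hon _ _) v ltac:(lra)).
    assert (E3 := CI_chasles f u (v + L) (Hon _ _) (u + L) ltac:(lra)).
    rewrite E1 in E3. rewrite E2 in E3.
    replace (CI f u (u + L)) with (CI f u (u + L) + CI f u v - CI f u v)%C by ring.
    rewrite <- E3. ring. }
  destruct (Rle_dec a b) as [h|h]; [now apply W|symmetry; apply W; lra].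
Qed.

(* A quadratic remainder bound uniform in [t] replaces joint continuity of the derivative. *)
Lemma isd_CI_param (F : R -> R -> C) (dF : R -> C) (a b r d K : R) : a <= b -> 0 < d ->
  (forall u, Rabs (u - r) < d -> cont_on (F u) a b) -> cont_on dF a b ->
  (forall u t, Rabs (u - r) < d -> a <= t <= b ->
     Cmod (F u t - F r t - RtoC (u - r) * dF t) <= K * (u - r) ^ 2) ->
  isd (fun u => CI (F u) a b) r (CI dF a b).
Proof.
  intros Hab Hd HF HdF H. apply isd_eps. intros eps He.
  (* [K] may be negative and the interval may be a point; [Rabs] and [+ 1] keep the divisor
     positive. *)
  set (M := Rabs K * (b - a) + 1). assert (HM : 0 < M).
  { unfold M. assert (A := Rabs_pos K). nra. }
  exists (Rmin d (eps / M)). split; [apply Rmin_pos; auto; now apply Rdiv_lt_0_compat|].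
  intros u Hu. assert (A1 := Rmin_l d (eps / M)). assert (A2 := Rmin_r d (eps / M)).
  assert (Hr : cont_on (F r) a b) by (apply HF; rewrite Rminus_diag, Rabs_R0; auto).
  assert (Hu' : cont_on (F u) a b) by (apply HF; lra).
  rewrite <- CI_scal, <- !CI_minus; auto.
  2:{ intros t Ht. apply ccont_minus; auto. }
  2:{ intros t Ht. apply ccont_mult; auto. apply ccont_const. }
  eapply Rle_trans.
  - apply CI_bound with (K := Rabs K * (u - r) ^ 2); auto.
    + intros t Ht. apply ccont_minus; [apply ccont_minus; auto|]. apply ccont_mult; auto. apply ccont_const.
    + intros t Ht. eapply Rle_trans; [apply H; auto; lra|].
      apply Rmult_le_compat_r; [apply pow2_ge_0|apply Rle_abs].
  - replace ((u - r) ^ 2) with (Rabs (u - r) * Rabs (u - r))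
      by (rewrite <- Rabs_mult, Rabs_pos_eq by apply Rle_0_sqr; ring).
    assert (A3 := Rabs_pos (u - r)). assert (A4 := Rabs_pos K).
    assert (A5 : Rabs (u - r) * M <= eps).
    { apply Rle_trans with (eps / M * M); [apply Rmult_le_compat_r; lra|]. right; field; lra. }
    unfold M in A5. nra.
Qed.

(** The inverse square root stands in for the logarithmic singularity of the kernel. The offset [h]
    measures the distance from the curve or the regularization; the bounds derived from this one do
    not deteriorate as it tends to 0. *)
Lemma CI_bound_sqrt (f : R -> C) (a b s h K : R) : a <= b -> 0 < a - s + h -> cont_on f a b ->
  (forall t, a <= t <= b -> Cmod (f t) <= K / sqrt (t - s + h)) ->
  Cmod (CI f a b) <= 2 * K * (sqrt (b - s + h) - sqrt (a - s + h)).
Proof.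
  intros Hab Hs Hc H.
  replace (2 * K * (sqrt (b - s + h) - sqrt (a - s + h)))
    with (2 * K * sqrt (b - s + h) - 2 * K * sqrt (a - s + h)) by ring.
  apply (CI_bound_prim f a b Hab Hc (fun t => 2 * K * sqrt (t - s + h)) (fun t => K / sqrt (t - s + h))).
  intros t Ht. assert (P : 0 < sqrt (t - s + h)) by (apply sqrt_lt_R0; lra).
  split; [|split; [|auto]].
  - auto_derive; [lra|]. change (t + - s) with (t - s). field. lra.
  - apply (ex_derive_continuous (V := R_NormedModule)). auto_derive. change (t + - s) with (t - s). repeat split; lra.
Qed.

Lemma sqrt_minus_le (x y : R) : 0 <= x <= y -> sqrt y - sqrt x <= sqrt (y - x).
Proof.
  intros H. assert (A := sqrt_sqrt x ltac:(lra)). assert (B := sqrt_sqrt y ltac:(lra)).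
  assert (D := sqrt_sqrt (y - x) ltac:(lra)).
  assert (P1 := sqrt_pos x). assert (P2 := sqrt_pos y). assert (P3 := sqrt_pos (y - x)).
  apply Rnot_lt_le; intro. nra.
Qed.

Lemma CI_bound_sqrt' (f : R -> C) (a b s h K : R) : a <= b -> 0 <= K -> 0 < a - s + h -> cont_on f a b ->
  (forall t, a <= t <= b -> Cmod (f t) <= K / sqrt (t - s + h)) ->
  Cmod (CI f a b) <= 2 * K * sqrt (b - a).
Proof.
  intros Hab HK Hs Hc H. eapply Rle_trans; [apply CI_bound_sqrt with (s := s) (h := h) (K := K); auto|].
  apply Rmult_le_compat_l; [lra|].
  replace (b - a) with (b - s + h - (a - s + h)) by ring. apply sqrt_minus_le; lra.
Qed.

Lemma CI_bound_sqrt_refl (f : R -> C) (a b s h K : R) : a <= b -> 0 <= K -> 0 < s - b + h -> cont_on f a b ->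
  (forall t, a <= t <= b -> Cmod (f t) <= K / sqrt (s - t + h)) ->
  Cmod (CI f a b) <= 2 * K * sqrt (b - a).
Proof.
  intros Hab HK Hs Hc H. rewrite <- (CI_refl f a b Hab Hc s).
  replace (b - a) with ((s - a) - (s - b)) by ring.
  apply CI_bound_sqrt' with (s := 0) (h := h); auto; try lra.
  - intros t Ht. apply ccont_refl, Hc; lra.
  - intros t Ht. replace (t - 0 + h) with (s - (s - t) + h) by ring. apply H; lra.
Qed.

Lemma CI_bound_sqrt_abs (f : R -> C) (a b p h K : R) : a <= p <= b -> 0 <= K -> 0 < h -> cont_on f a b ->
  (forall t, a <= t <= b -> Cmod (f t) <= K / sqrt (Rabs (t - p) + h)) ->
  Cmod (CI f a b) <= 4 * K * sqrt (b - a).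
Proof.
  intros Hp HK Hh Hc H. rewrite (CI_chasles f a b Hc p Hp).
  eapply Rle_trans; [apply Cmod_triangle|].
  assert (A1 : Cmod (CI f a p) <= 2 * K * sqrt (p - a)).
  { apply CI_bound_sqrt_refl with (s := p) (h := h); auto; try lra.
    - intros t Ht; apply Hc; lra.
    - intros t Ht. replace (p - t) with (Rabs (t - p)) by (rewrite Rabs_left1; lra). apply H; lra. }
  assert (A2 : Cmod (CI f p b) <= 2 * K * sqrt (b - p)).
  { apply CI_bound_sqrt' with (s := p) (h := h); auto; try lra.
    - intros t Ht; apply Hc; lra.
    - intros t Ht. replace (t - p) with (Rabs (t - p)) by (rewrite Rabs_pos_eq; lra). apply H; lra. }
  assert (sqrt (p - a) <= sqrt (b - a)) by (apply sqrt_le_1_alt; lra).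
  assert (sqrt (b - p) <= sqrt (b - a)) by (apply sqrt_le_1_alt; lra).
  nra.
Qed.

Definition vanishing (w : R -> R) : Prop :=
  forall eps, 0 < eps -> exists d, 0 < d /\ forall u, 0 < u <= d -> w u <= eps.

(** The weight h / u^2 has mass at most 1 on u >= h, whatever h is, and this mass leaves every
    interval [d, l] as h tends to 0. So only the size of [w] near 0 counts: the part up to d costs
    at most K times the supremum of [w] there, and the rest carries a factor h. *)
Lemma outer_small (w : R -> R) (l K W : R) : 0 < l -> 0 <= K -> vanishing w ->
  (forall u, 0 < u <= l -> w u <= W) ->
  forall eps, 0 < eps -> exists h0, 0 < h0 /\
    forall h (s : R) (f : R -> C), 0 < h < h0 -> cont_on f (s + h) (s + l) ->
      (forall t, s + h <= t <= s + l -> Cmod (f t) <= K * h / (t - s) ^ 2 * w (t - s)) ->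
      Cmod (CI f (s + h) (s + l)) <= eps.
Proof.
  intros Hl HK Hw HW eps He.
  destruct (Hw (eps / (2 * (K + 1)))) as [d0 [Hd0 Hd]]; [apply Rdiv_lt_0_compat; lra|].
  set (d := Rmin d0 l). assert (D1 : d <= d0) by apply Rmin_l. assert (D2 : d <= l) by apply Rmin_r.
  assert (D3 : 0 < d) by now apply Rmin_pos.
  set (M := K * Rabs W * l / d ^ 2 + 1).
  assert (HKW : 0 <= K * Rabs W) by (apply Rmult_le_pos; [lra|apply Rabs_pos]).
  assert (Hd2 : 0 < d ^ 2) by (apply pow_lt; lra).
  assert (HM : 0 < M).
  { unfold M. assert (0 <= K * Rabs W * l / d ^ 2); [|lra].
    apply Rdiv_le_0_compat; nra. }
  exists (Rmin d (eps / (2 * M))). split; [apply Rmin_pos; auto; apply Rdiv_lt_0_compat; lra|].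
  intros h s f Hh Hc Hf.
  assert (A1 := Rmin_l d (eps / (2 * M))). assert (A2 := Rmin_r d (eps / (2 * M))).
  rewrite (CI_chasles f (s + h) (s + l) Hc (s + d) ltac:(lra)).
  eapply Rle_trans; [apply Cmod_triangle|].
  assert (B1 : Cmod (CI f (s + h) (s + d)) <= eps / 2).
  { set (e := eps / (2 * (K + 1))) in *. assert (0 < e) by (unfold e; apply Rdiv_lt_0_compat; lra).
    assert (Ee : eps / 2 = (K + 1) * e) by (unfold e; field; lra).
    clearbody e.
    eapply Rle_trans.
    - apply (CI_bound_prim f (s + h) (s + d) ltac:(lra)) with (G := fun t => - (K * h * e) / (t - s)) (k := fun t => K * h / (t - s) ^ 2 * e).
      + intros t Ht; apply Hc; lra.
      + intros t Ht. split; [|split].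
        * auto_derive; [lra|]. field. lra.
        * apply (ex_derive_continuous (V := R_NormedModule)). auto_derive. simpl; nra.
        * eapply Rle_trans; [apply Hf; lra|]. apply Rmult_le_compat_l.
          -- apply Rdiv_le_0_compat; [nra|apply pow_lt; lra].
          -- apply Hd; lra.
    - replace (s + d - s) with d by ring. replace (s + h - s) with h by ring.
      rewrite Ee. replace (- (K * h * e) / d - - (K * h * e) / h) with (K * e - K * h * e / d) by (field; lra).
      assert (0 <= K * h * e / d); [|nra].
      apply Rdiv_le_0_compat; [|lra]. repeat apply Rmult_le_pos; lra. }
  assert (B2 : Cmod (CI f (s + d) (s + l)) <= eps / 2).
  { eapply Rle_trans.
    - apply CI_bound with (K := K * Rabs W * h / d ^ 2); try lra.
      + intros t Ht; apply Hc; lra.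
      + intros t Ht. eapply Rle_trans; [apply Hf; lra|].
        assert (w (t - s) <= Rabs W) by (eapply Rle_trans; [apply HW; lra|apply Rle_abs]).
        replace (K * Rabs W * h / d ^ 2) with (K * h / d ^ 2 * Rabs W) by (field; lra).
        apply Rle_trans with (K * h / (t - s) ^ 2 * Rabs W).
        * apply Rmult_le_compat_l; auto. apply Rdiv_le_0_compat; [nra|apply pow_lt; lra].
        * apply Rmult_le_compat_r; [apply Rabs_pos|]. apply Rmult_le_compat_l; [nra|].
          apply Rinv_le_contravar; auto. apply pow_incr; lra.
    - assert (h * M <= eps / 2).
      { apply Rle_trans with (eps / (2 * M) * M); [apply Rmult_le_compat_r; lra|]. right; field; lra. }
      unfold M in H.
      replace (K * Rabs W * h / d ^ 2 * (s + l - (s + d))) with (h * (K * Rabs W * l / d ^ 2) - h * (K * Rabs W * d / d ^ 2)) by (field; lra).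
      assert (0 <= h * (K * Rabs W * d / d ^ 2)).
      { apply Rmult_le_pos; [lra|]. apply Rdiv_le_0_compat; nra. }
      nra. }
  lra.
Qed.

Lemma outer_small2 (w : R -> R) (l K W : R) : 0 < l -> 0 <= K -> vanishing w ->
  (forall u, 0 < u <= l -> w u <= W) ->
  forall eps, 0 < eps -> exists h0, 0 < h0 /\
    forall h (s : R) (f : R -> C), 0 < h < h0 ->
      cont_on f (s - l) (s - h) -> cont_on f (s + h) (s + l) ->
      (forall t, h <= Rabs (t - s) <= l -> Cmod (f t) <= K * h / (t - s) ^ 2 * w (Rabs (t - s))) ->
      Cmod (CI f (s - l) (s - h) + CI f (s + h) (s + l)) <= eps.
Proof.
  intros Hl HK Hw HW eps He.
  destruct (outer_small w l K W Hl HK Hw HW (eps / 2) ltac:(lra)) as [h0 [H0 H]].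
  exists (Rmin h0 l). split; [now apply Rmin_pos|]. intros h s f Hh C1 C2 Hf.
  assert (A1 := Rmin_l h0 l). assert (A2 := Rmin_r h0 l).
  eapply Rle_trans; [apply Cmod_triangle|].
  assert (B2 : Cmod (CI f (s + h) (s + l)) <= eps / 2).
  { apply H; auto; [lra|]. intros t Ht. assert (E : Rabs (t - s) = t - s) by (apply Rabs_pos_eq; lra).
    rewrite <- E at 2. apply Hf. lra. }
  assert (B1 : Cmod (CI f (s - l) (s - h)) <= eps / 2).
  { rewrite <- (CI_refl f (s - l) (s - h) ltac:(lra) C1 (2 * s)).
    replace (2 * s - (s - h)) with (s + h) by ring. replace (2 * s - (s - l)) with (s + l) by ring.
    apply H; [lra| |].
    - intros t Ht. apply ccont_refl, C1; lra.
    - intros t Ht. replace (t - s) with (Rabs (2 * s - t - s)) at 2 by (rewrite Rabs_left1; lra).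
      replace ((t - s) ^ 2) with ((2 * s - t - s) ^ 2) by ring.
      apply Hf. rewrite Rabs_left1; lra. }
  lra.
Qed.

(** * Improper integrals with inverse square-root singularities *)

Lemma locally_Cmod_iff (z : C) (P : C -> Prop) : locally (T := C_UniformSpace) z P <->
  exists eps, 0 < eps /\ forall y, Cmod (y - z) < eps -> P y.
Proof.
  assert (E : forall y, norm (V := C_R_NormedModule) (minus y z) = Cmod (y - z)) by (intros; apply norm_Cmod).
  split.
  - intros H. destruct (locally_norm_le_locally (V := C_R_NormedModule) z P H) as [e He].
    exists e; split; [apply cond_pos|]. intros y Hy. apply He. unfold ball_norm. eapply Rle_lt_trans; [apply Req_le, E|exact Hy].
  - intros [e [He H]]. apply (locally_le_locally_norm (V := C_R_NormedModule)).
    exists (mkposreal e He). intros y Hy. apply H. rewrite <- E. exact Hy.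
Qed.

Lemma Cmod_sub_sym (a b : C) : Cmod (a - b) = Cmod (b - a).
Proof. rewrite <- Cmod_opp. f_equal. ring. Qed.

Lemma Cmod_sub_triangle (a b c : C) : Cmod (a - c) <= Cmod (a - b) + Cmod (b - c).
Proof. replace (a - c)%C with ((a - b) + (b - c))%C by ring. apply Cmod_triangle. Qed.

Lemma small_sqrt (K eps : R) : 0 <= K -> 0 < eps -> exists d, 0 < d /\ forall u, 0 <= u <= d -> K * sqrt u <= eps.
Proof.
  intros HK He. set (q := eps / (K + 1)). assert (Hq : 0 < q) by (apply Rdiv_lt_0_compat; lra).
  exists (q ^ 2). split; [now apply pow_lt|]. intros u Hu.
  apply Rle_trans with (K * q).
  - apply Rmult_le_compat_l; auto. rewrite <- (sqrt_pow2 q) by lra. apply sqrt_le_1_alt; lra.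
  - assert (eps = (K + 1) * q) by (unfold q; field; lra). lra.
Qed.

Lemma at_right0_ex (P : R -> Prop) : at_right 0 P -> forall d, 0 < d -> exists x, 0 < x < d /\ P x.
Proof.
  intros [e He] d Hd. exists (Rmin (e / 2) (d / 2)).
  assert (A := cond_pos e). assert (A1 := Rmin_l (e / 2) (d / 2)). assert (A2 := Rmin_r (e / 2) (d / 2)).
  assert (A3 : 0 < Rmin (e / 2) (d / 2)) by (apply Rmin_pos; lra).
  split; [lra|]. apply He; [|lra].
  unfold ball; simpl; unfold AbsRing_ball, abs, minus, plus, opp; simpl. rewrite Rabs_pos_eq; lra.
Qed.

Lemma at_right0_intro (P : R -> Prop) (d : R) : 0 < d -> (forall x, 0 < x < d -> P x) -> at_right 0 P.
Proof.
  intros Hd H. exists (mkposreal d Hd). intros y Hy Hy'. apply H. split; auto.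
  unfold ball in Hy; simpl in Hy; unfold AbsRing_ball, abs, minus, plus, opp in Hy; simpl in Hy.
  rewrite Rabs_pos_eq in Hy; lra.
Qed.

Lemma at_right0_elim (P : R -> Prop) : at_right 0 P -> exists d, 0 < d /\ forall x, 0 < x < d -> P x.
Proof.
  intros [e He]. exists e. split; [apply cond_pos|]. intros x Hx. apply He; [|lra].
  unfold ball; simpl; unfold AbsRing_ball, abs, minus, plus, opp; simpl. rewrite Rabs_pos_eq; lra.
Qed.

(* Cauchy criterion at [0+] with a modulus [m] that also bounds the distance to the limit. *)
Lemma cauchy_modulus (g : R -> C) (m : R -> R) (l : R) : 0 < l -> vanishing m ->
  (forall x y, 0 < x <= y -> y <= l -> Cmod (g y - g x) <= m y) ->
  exists J : C, forall x, 0 < x <= l -> Cmod (g x - J) <= m x.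
Proof.
  intros Hl Hm Hg.
  destruct (proj1 (filterlim_locally_cauchy (U := C_R_CompleteNormedModule) (F := at_right 0) g)) as [J HJ].
  - intros eps. destruct (Hm (eps / 2)) as [d [Hd K]]; [assert (A := cond_pos eps); lra|].
    exists (fun x => 0 < x <= Rmin d l). split.
    + apply at_right0_intro with (Rmin d l); [now apply Rmin_pos|]. intros; lra.
    + assert (B1 := Rmin_l d l). assert (B2 := Rmin_r d l).
      assert (W : forall x y, 0 < x <= y -> y <= Rmin d l -> Cmod (g y - g x) < eps).
      { intros x y H1 H2. eapply Rle_lt_trans; [apply Hg; lra|]. eapply Rle_lt_trans; [apply K; lra|].
        assert (A := cond_pos eps); lra. }
      intros u v Hu Hv. apply (C_NormedModule_mixin_compat1 (g u) (g v)).
      change (Cmod (g v - g u) < eps).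
      destruct (Rle_dec u v); [apply W; lra|]. rewrite Cmod_sub_sym. apply W; lra.
  - exists J. intros x Hx. apply le_epsilon. intros eps He.
    assert (HP : at_right 0 (fun y => Cmod (g y - J) < eps)).
    { apply (HJ (fun z => Cmod (z - J) < eps)). apply locally_Cmod_iff. now exists eps. }
    destruct (at_right0_ex _ HP x ltac:(lra)) as [y [Hy Hy']].
    eapply Rle_trans; [apply (Cmod_sub_triangle _ (g y))|].
    assert (A := Hg y x ltac:(lra) ltac:(lra)). lra.
Qed.

Lemma vanishing_sqrt (K : R) : 0 <= K -> vanishing (fun u => K * sqrt u).
Proof.
  intros HK eps He. destruct (small_sqrt K eps HK He) as [d [Hd H]].
  exists d; split; auto. intros; apply H; lra.
Qed.

Lemma improper_right (f : R -> C) (s l K : R) : 0 < l -> 0 <= K ->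
  (forall t, s < t <= s + l -> ccont f t /\ Cmod (f t) <= K / sqrt (t - s)) ->
  exists J, forall a, 0 < a <= l -> Cmod (CI f (s + a) (s + l) - J) <= 2 * K * sqrt a.
Proof.
  intros Hl HK Hf.
  apply (cauchy_modulus (fun a => CI f (s + a) (s + l)) (fun a => 2 * K * sqrt a) l Hl).
  - apply vanishing_sqrt; lra.
  - intros x y Hx Hy.
    rewrite (CI_chasles f (s + x) (s + l)) with (c := s + y); [|intros t Ht; apply Hf; lra|lra].
    replace (CI f (s + y) (s + l) - (CI f (s + x) (s + y) + CI f (s + y) (s + l)))%C
      with (- CI f (s + x) (s + y))%C by ring.
    rewrite Cmod_opp. eapply Rle_trans.
    + apply CI_bound_sqrt' with (s := s) (h := 0) (K := K); try lra.
      * intros t Ht; apply Hf; lra.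
      * intros t Ht. rewrite Rplus_0_r. apply Hf; lra.
    + apply Rmult_le_compat_l; [lra|]. apply sqrt_le_1_alt; lra.
Qed.

Lemma improper_left (f : R -> C) (s l K : R) : 0 < l -> 0 <= K ->
  (forall t, s - l <= t < s -> ccont f t /\ Cmod (f t) <= K / sqrt (s - t)) ->
  exists J, forall a, 0 < a <= l -> Cmod (CI f (s - l) (s - a) - J) <= 2 * K * sqrt a.
Proof.
  intros Hl HK Hf.
  destruct (improper_right (fun t => f (2 * s - t)) s l K Hl HK) as [J HJ].
  - intros t Ht. split; [apply ccont_refl, Hf; lra|].
    replace (t - s) with (s - (2 * s - t)) by ring. apply Hf; lra.
  - exists J. intros a Ha. specialize (HJ a Ha).
    rewrite <- (CI_refl f (s - l) (s - a)) with (c := 2 * s); [|lra|intros t Ht; apply Hf; lra].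
    replace (2 * s - (s - a)) with (s + a) by ring. now replace (2 * s - (s - l)) with (s + l) by ring.
Qed.

(** The two ends are independent limits, so each half, cut at the midpoint s + l, has its own Cauchy
    limit. The errors 2 K sqrt a at the two ends add up to 4 K sqrt a. *)
Lemma sing_int_value (f : R -> C) (s l K : R) : 0 < l -> 0 <= K ->
  (forall t, s < t < s + 2 * l -> ccont f t) ->
  (forall t, s < t <= s + l -> Cmod (f t) <= K / sqrt (t - s)) ->
  (forall t, s + l <= t < s + 2 * l -> Cmod (f t) <= K / sqrt (s + 2 * l - t)) ->
  ex_sing_int (2 * l) s f /\
  forall a, 0 < a <= l ->
    Cmod (CI f (s + a) (s + 2 * l - a) - sing_int (2 * l) s f) <= 4 * K * sqrt a.
Proof.
  intros Hl HK Hc Hr Hlft.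
  destruct (improper_right f s l K Hl HK) as [J1 H1].
  { intros t Ht; split; [apply Hc|apply Hr]; lra. }
  destruct (improper_left f (s + 2 * l) l K Hl HK) as [J2 H2].
  { intros t Ht; split; [apply Hc|apply Hlft]; lra. }
  replace (s + 2 * l - l) with (s + l) in H2 by ring.
  assert (B : forall a b, 0 < a <= l -> 0 < b <= l ->
    Cmod (CI f (s + a) (s + 2 * l - b) - (J1 + J2)) <= 2 * K * sqrt a + 2 * K * sqrt b).
  { intros a b Ha Hb. rewrite (CI_chasles f (s + a) (s + 2 * l - b)) with (c := s + l); [|intros t Ht; apply Hc; lra|lra].
    replace (CI f (s + a) (s + l) + CI f (s + l) (s + 2 * l - b) - (J1 + J2))%C
      with ((CI f (s + a) (s + l) - J1) + (CI f (s + l) (s + 2 * l - b) - J2))%C by ring.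
    eapply Rle_trans; [apply Cmod_triangle|]. specialize (H1 a Ha). specialize (H2 b Hb). lra. }
  assert (G : is_RInt_gen (V := C_R_NormedModule) f (at_right s) (at_left (s + 2 * l)) (J1 + J2)%C).
  { intros P HP. apply locally_Cmod_iff in HP. destruct HP as [eps [He HP]].
    destruct (small_sqrt (2 * K) (eps / 4) ltac:(lra) ltac:(lra)) as [d [Hd Hs]].
    set (e := Rmin d l). assert (He' : 0 < e) by now apply Rmin_pos.
    assert (A1 : e <= d) by apply Rmin_l. assert (A2 : e <= l) by apply Rmin_r.
    apply Filter_prod with (Q := fun x => s < x < s + e) (R := fun x => s + 2 * l - e < x < s + 2 * l).
    - exists (mkposreal e He'). intros y Hy Hy'. unfold ball in Hy; simpl in Hy;
      unfold AbsRing_ball, abs, minus, plus, opp in Hy; simpl in Hy. apply Rabs_def2 in Hy. lra.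
    - exists (mkposreal e He'). intros y Hy Hy'. unfold ball in Hy; simpl in Hy;
      unfold AbsRing_ball, abs, minus, plus, opp in Hy; simpl in Hy. apply Rabs_def2 in Hy. lra.
    - intros x y Hx Hy. exists (CI f x y). split.
      + simpl. apply CI_correct; [lra|]. intros t Ht; apply Hc; lra.
      + apply HP. specialize (B (x - s) (s + 2 * l - y) ltac:(lra) ltac:(lra)).
        replace (s + (x - s)) with x in B by ring. replace (s + 2 * l - (s + 2 * l - y)) with y in B by ring.
        assert (C1 := Hs (x - s) ltac:(lra)). assert (C2 := Hs (s + 2 * l - y) ltac:(lra)). lra. }
  split; [now exists (J1 + J2)%C|].
  assert (E : sing_int (2 * l) s f = (J1 + J2)%C).
  { unfold sing_int. apply (is_RInt_gen_unique (V := C_R_CompleteNormedModule)); auto. }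
  rewrite E. intros a Ha. specialize (B a a Ha Ha). lra.
Qed.

(** Dominated convergence with a rate. The common majorant pays for the two end pieces of length a,
    2 + 2 for [g] and 4 for the tails of [f], hence the 8; in the middle the integrands are
    uniformly close. *)
Lemma sing_int_approx (f g : R -> C) (s l K h a E : R) : 0 < l -> 0 <= K -> 0 < h -> 0 < a <= l ->
  (forall t, s < t < s + 2 * l -> ccont f t) ->
  (forall t, s < t <= s + l -> Cmod (f t) <= K / sqrt (t - s)) ->
  (forall t, s + l <= t < s + 2 * l -> Cmod (f t) <= K / sqrt (s + 2 * l - t)) ->
  cont_on g s (s + 2 * l) ->
  (forall t, s <= t <= s + l -> Cmod (g t) <= K / sqrt (t - s + h)) ->
  (forall t, s + l <= t <= s + 2 * l -> Cmod (g t) <= K / sqrt (s + 2 * l - t + h)) ->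
  (forall t, s + a <= t <= s + 2 * l - a -> Cmod (g t - f t) <= E) ->
  Cmod (CI g s (s + 2 * l) - sing_int (2 * l) s f) <= 8 * K * sqrt a + E * (2 * l).
Proof.
  intros Hl HK Hh Ha Hc Hr Hlft Gc Gr Gl HE.
  destruct (sing_int_value f s l K Hl HK Hc Hr Hlft) as [_ B]. specialize (B a Ha).
  rewrite (CI_chasles g s (s + 2 * l) Gc (s + a)) by lra.
  rewrite (CI_chasles g (s + a) (s + 2 * l)) with (c := s + 2 * l - a); [|intros t Ht; apply Gc; lra|lra].
  set (X := sing_int (2 * l) s f) in *. set (F := CI f (s + a) (s + 2 * l - a)) in *.
  set (A1 := CI g s (s + a)). set (A2 := CI g (s + a) (s + 2 * l - a)). set (A3 := CI g (s + 2 * l - a) (s + 2 * l)).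
  replace (A1 + (A2 + A3) - X)%C with (A1 + (A3 + ((A2 - F) + (F - X))))%C by ring.
  assert (B1 : Cmod A1 <= 2 * K * sqrt a).
  { unfold A1. replace a with (s + a - s) at 2 by ring.
    apply CI_bound_sqrt' with (s := s) (h := h); auto; try lra.
    - intros t Ht; apply Gc; lra.
    - intros t Ht; apply Gr; lra. }
  assert (B3 : Cmod A3 <= 2 * K * sqrt a).
  { unfold A3. replace a with (s + 2 * l - (s + 2 * l - a)) at 2 by ring.
    apply CI_bound_sqrt_refl with (s := s + 2 * l) (h := h); auto; try lra.
    - intros t Ht; apply Gc; lra.
    - intros t Ht; apply Gl; lra. }
  assert (HE0 : 0 <= E).
  { eapply Rle_trans; [apply Cmod_ge_0|]. apply (HE (s + l)); lra. }
  assert (B2 : Cmod (A2 - F) <= E * (2 * l)).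
  { unfold A2, F. rewrite <- CI_minus; [|lra|intros t Ht; apply Gc; lra|intros t Ht; apply Hc; lra].
    eapply Rle_trans.
    - apply CI_bound with (K := E); auto; [lra|].
      intros t Ht. apply ccont_minus; [apply Gc|apply Hc]; lra.
    - apply Rmult_le_compat_l; lra. }
  eapply Rle_trans; [apply Cmod_triangle|]. assert (T1 := Cmod_triangle A3 (A2 - F + (F - X))).
  assert (T2 := Cmod_triangle (A2 - F) (F - X)). lra.
Qed.

(** * Complex power series *)

Lemma Series_zero (c : nat -> R) : (forall n, c n = 0) -> Series c = 0.
Proof.
  intros H. rewrite (Series_ext c (fun n => 0 * c n)) by (intros n; rewrite H; ring).
  rewrite Series_scal_l. ring.
Qed.

Definition abs_summable (c : nat -> C) : Prop := ex_series (fun k => Cmod (c k)).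

Lemma abs_summable_fst (c : nat -> C) : abs_summable c -> ex_series (fun k => Re (c k)).
Proof.
  intros H. apply (ex_series_le (V := R_CompleteNormedModule) (fun k => Re (c k)) (fun k => Cmod (c k))); auto.
  intros n. apply re_le_Cmod.
Qed.

Lemma abs_summable_snd (c : nat -> C) : abs_summable c -> ex_series (fun k => Im (c k)).
Proof.
  intros H. apply (ex_series_le (V := R_CompleteNormedModule) (fun k => Im (c k)) (fun k => Cmod (c k))); auto.
  intros n. apply snd_le_Cmod.
Qed.

Lemma abs_summable_le (c : nat -> C) (b : nat -> R) : (forall k, Cmod (c k) <= b k) -> ex_series b -> abs_summable c.
Proof.
  intros H Hb. apply (ex_series_le (V := R_CompleteNormedModule) _ b); auto.
  intros n. unfold norm; simpl; unfold abs; simpl. rewrite Rabs_pos_eq; [apply H|apply Cmod_ge_0].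
Qed.

(** The factor 2 comes from [CSeries] being computed componentwise: each component is at most
    [Series b]. *)
Lemma Cmod_CSeries_le (c : nat -> C) (b : nat -> R) :
  (forall k, Cmod (c k) <= b k) -> ex_series b -> Cmod (CSeries c) <= 2 * Series b.
Proof.
  intros H Hb. eapply Rle_trans; [apply Cmod_le_abs|]. unfold CSeries; simpl.
  assert (S : abs_summable c) by now apply abs_summable_le with b.
  assert (A : forall d : nat -> R, (forall k, Rabs (d k) <= Cmod (c k)) -> Rabs (Series d) <= Series b).
  { intros d Hd. assert (Hs : ex_series (fun k => Rabs (d k))).
    { apply (ex_series_le (V := R_CompleteNormedModule) _ (fun k => Cmod (c k))); auto.
      intros n. unfold norm; simpl; unfold abs; simpl. now rewrite Rabs_Rabsolu. }
    eapply Rle_trans; [now apply Series_Rabs|]. apply Series_le; auto.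
    intros n; split; [apply Rabs_pos|]. eapply Rle_trans; [apply Hd|apply H]. }
  assert (A1 := A (fun k => Re (c k)) (fun k => re_le_Cmod _)).
  assert (A2 := A (fun k => Im (c k)) (fun k => snd_le_Cmod _)). lra.
Qed.

Lemma abs_summable_scal (z : C) (c : nat -> C) : abs_summable c -> abs_summable (fun k => z * c k)%C.
Proof.
  intros Hc. apply abs_summable_le with (fun k => Cmod z * Cmod (c k)).
  - intros; rewrite Cmod_mult; lra.
  - now apply (ex_series_scal (V := R_NormedModule) (Cmod z) (fun k => Cmod (c k))).
Qed.

Lemma CSeries_ext (c d : nat -> C) : (forall k, c k = d k) -> CSeries c = CSeries d.
Proof. intros H. unfold CSeries. f_equal; apply Series_ext; intros; now rewrite H. Qed.

Lemma CSeries_plus (c d : nat -> C) : abs_summable c -> abs_summable d ->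
  CSeries (fun k => c k + d k)%C = (CSeries c + CSeries d)%C.
Proof.
  intros Hc Hd. unfold CSeries, Cplus; simpl. f_equal.
  - rewrite <- Series_plus; auto using abs_summable_fst.
  - rewrite <- Series_plus; auto using abs_summable_snd.
Qed.

Lemma CSeries_scal (z : C) (c : nat -> C) : abs_summable c -> CSeries (fun k => z * c k)%C = (z * CSeries c)%C.
Proof.
  intros Hc. assert (H1 := abs_summable_fst c Hc). assert (H2 := abs_summable_snd c Hc).
  assert (X : forall r (d : nat -> R), ex_series d -> ex_series (fun k => r * d k)).
  { intros r d Hd. now apply (ex_series_scal (V := R_NormedModule) r d). }
  unfold CSeries, Cmult; simpl. f_equal.
  - rewrite <- !Series_scal_l, <- Series_minus; auto.
  - rewrite <- !Series_scal_l, <- Series_plus; auto.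
Qed.

Lemma CSeries_minus (c d : nat -> C) : abs_summable c -> abs_summable d ->
  CSeries (fun k => c k - d k)%C = (CSeries c - CSeries d)%C.
Proof.
  intros Hc Hd. rewrite (CSeries_ext _ (fun k => c k + (-(1)) * d k)%C) by (intros; ring).
  rewrite CSeries_plus, CSeries_scal; auto using abs_summable_scal. ring.
Qed.

Lemma CSeries_incr_1 (c : nat -> C) : abs_summable c -> CSeries c = (c 0%nat + CSeries (fun k => c (S k)))%C.
Proof.
  intros Hc. unfold CSeries, Cplus; simpl. f_equal.
  - apply (Series_incr_1 (fun k => Re (c k))). now apply abs_summable_fst.
  - apply (Series_incr_1 (fun k => Im (c k))). now apply abs_summable_snd.
Qed.

Definition entire (a : nat -> R) : Prop := forall r, 0 <= r -> ex_series (fun n => Rabs (a n) * r ^ n).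

Definition CPS (a : nat -> R) (z : C) : C := CSeries (fun k => RtoC (a k) * z ^ k)%C.

Lemma entire_abs_summable (a : nat -> R) (z : C) : entire a -> abs_summable (fun k => RtoC (a k) * z ^ k)%C.
Proof.
  intros H. apply abs_summable_le with (fun k => Rabs (a k) * Cmod z ^ k).
  - intros k. rewrite Cmod_mult, Cmod_pow, Cmod_R. lra.
  - apply H, Cmod_ge_0.
Qed.

Lemma INR_le_pow2 (n : nat) : INR n <= 2 ^ n.
Proof.
  induction n as [|n IH]; [simpl; lra|]. rewrite S_INR. simpl.
  assert (1 <= 2 ^ n) by (apply pow_R1_Rle; lra). lra.
Qed.

Lemma entire_dom (a b : nat -> R) (M : R) : 0 <= M -> entire a ->
  (forall n, Rabs (b n) <= Rabs (a n) * M ^ n) -> entire b.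
Proof.
  intros HM Ha H r Hr.
  apply (ex_series_le (V := R_CompleteNormedModule) _ (fun n => Rabs (a n) * (M * r) ^ n)).
  - intros n. unfold norm; simpl; unfold abs; simpl.
    rewrite Rabs_pos_eq by (apply Rmult_le_pos; [apply Rabs_pos|apply pow_le; lra]).
    rewrite Rpow_mult_distr, <- Rmult_assoc. apply Rmult_le_compat_r; [apply pow_le; lra|auto].
  - apply Ha. nra.
Qed.

(** The factor n + 1 is at most 2^(n+1), so it is absorbed by doubling the radius; r + 1 >= 1 pays
    for the shift of the index. *)
Lemma entire_derive (a : nat -> R) : entire a -> entire (PS_derive a).
Proof.
  intros Ha r Hr.
  assert (H : ex_series (fun n => Rabs (a (S n)) * (2 * (r + 1)) ^ (S n))).
  { apply (ex_series_incr_1 (fun n => Rabs (a n) * (2 * (r + 1)) ^ n)). apply Ha. lra. }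
  apply (ex_series_le (V := R_CompleteNormedModule) _ _) with (2 := H).
  intros n. unfold norm; simpl; unfold abs; simpl.
  rewrite Rabs_pos_eq by (apply Rmult_le_pos; [apply Rabs_pos|apply pow_le; lra]).
  unfold PS_derive. rewrite Rabs_mult, (Rabs_pos_eq (INR (S n))) by apply pos_INR.
  rewrite (Rmult_comm (INR (S n))), Rmult_assoc. apply Rmult_le_compat_l; [apply Rabs_pos|].
  change (2 * (r + 1) * (2 * (r + 1)) ^ n) with ((2 * (r + 1)) ^ S n). rewrite Rpow_mult_distr.
  apply Rmult_le_compat; [apply pos_INR|apply pow_le; lra|apply INR_le_pow2|].
  apply Rle_trans with ((r + 1) ^ n); [apply pow_incr; lra|].
  simpl. assert (0 <= (r + 1) ^ n) by (apply pow_le; lra). nra.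
Qed.

Lemma Cpow_sub_bound (w z : C) (M : R) (n : nat) : 1 <= M -> Cmod w <= M -> Cmod z <= M ->
  Cmod (w ^ n - z ^ n) <= INR n * M ^ n * Cmod (w - z).
Proof.
  intros HM Hw Hz. induction n as [|n IH].
  - simpl. replace (1 - 1)%C with (RtoC 0) by ring. rewrite Cmod_0. lra.
  - replace (w ^ S n - z ^ S n)%C with (w * (w ^ n - z ^ n) + (w - z) * z ^ n)%C by (simpl; ring).
    eapply Rle_trans; [apply Cmod_triangle|]. rewrite !Cmod_mult, Cmod_pow, S_INR.
    assert (A1 := Cmod_ge_0 (w - z)). assert (A2 := Cmod_ge_0 w). assert (A3 := Cmod_ge_0 (w ^ n - z ^ n)).
    assert (A4 : Cmod z ^ n <= M ^ n) by (apply pow_incr; split; auto; apply Cmod_ge_0).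
    assert (A5 : M ^ n <= M ^ S n) by (apply Rle_pow; auto; lia).
    assert (A6 : 0 <= M ^ n) by (apply pow_le; lra).
    assert (B1 : Cmod w * Cmod (w ^ n - z ^ n) <= M * (INR n * M ^ n * Cmod (w - z))).
    { apply Rmult_le_compat; auto. }
    assert (B2 : Cmod (w - z) * Cmod z ^ n <= Cmod (w - z) * M ^ S n) by (apply Rmult_le_compat_l; lra).
    simpl in *. lra.
Qed.

(** By induction: the remainder for the next power is z times the previous remainder plus (w - z)
    (w^(n+1) - z^(n+1)), and the second term is quadratic by [Cpow_sub_bound]. *)
Lemma Cpow_taylor_bound (w z : C) (M : R) (n : nat) : 1 <= M -> Cmod w <= M -> Cmod z <= M ->
  Cmod (w ^ S n - z ^ S n - (w - z) * (RtoC (INR (S n)) * z ^ n))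
  <= INR (S n) ^ 2 * M ^ S n * Cmod (w - z) ^ 2.
Proof.
  intros HM Hw Hz. assert (A1 := Cmod_ge_0 (w - z)).
  induction n as [|n IH].
  - simpl. replace (w * 1 - z * 1 - (w - z) * (1 * 1))%C with (RtoC 0) by ring. rewrite Cmod_0.
    assert (0 <= M * 1) by lra. nra.
  - replace (w ^ S (S n) - z ^ S (S n) - (w - z) * (RtoC (INR (S (S n))) * z ^ S n))%C
      with (z * (w ^ S n - z ^ S n - (w - z) * (RtoC (INR (S n)) * z ^ n)) + (w - z) * (w ^ S n - z ^ S n))%C.
    2:{ rewrite (S_INR (S n)), RtoC_plus. simpl Cpow. ring. }
    eapply Rle_trans; [apply Cmod_triangle|]. rewrite (Cmod_mult z), (Cmod_mult (w - z)).
    assert (B := Cpow_sub_bound w z M (S n) HM Hw Hz).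
    set (D := Cmod (w ^ S n - z ^ S n - (w - z) * (RtoC (INR (S n)) * z ^ n))) in *.
    rewrite (S_INR (S n)). set (k := INR (S n)) in *. assert (Hk : 0 <= k) by apply pos_INR.
    assert (A6 : 0 <= M ^ S n) by (apply pow_le; lra).
    change (M ^ S (S n)) with (M * M ^ S n). set (P := M ^ S n) in *.
    set (d := Cmod (w - z)) in *.
    assert (HD : 0 <= D) by apply Cmod_ge_0.
    assert (B1 : Cmod z * D <= M * (k ^ 2 * P * d ^ 2)).
    { apply Rmult_le_compat; auto. apply Cmod_ge_0. }
    assert (B2 : d * Cmod (w ^ S n - z ^ S n) <= d * (k * P * d)) by (apply Rmult_le_compat_l; auto).
    assert (B3 : k * P * d ^ 2 <= (2 * k + 1) * (M * P) * d ^ 2).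
    { apply Rmult_le_compat_r; [nra|]. assert (P <= M * P) by nra. nra. }
    nra.
Qed.

(** Complex differentiability in the only form used later, a quadratic remainder uniform on a disc.
    The remainder of the k-th power carries k^2 N^k, and k^2 <= 4^k, so the series at radius 4 N
    dominates. *)
Lemma CPS_taylor (a : nat -> R) (M : R) : entire a -> exists K, 0 <= K /\
  forall w z, Cmod w <= M -> Cmod z <= M ->
    Cmod (CPS a w - CPS a z - (w - z) * CPS (PS_derive a) z) <= K * Cmod (w - z) ^ 2.
Proof.
  intros Ha. set (N := Rmax 1 M). assert (HN1 : 1 <= N) by apply Rmax_l. assert (HN2 : M <= N) by apply Rmax_r.
  set (b := fun n => Rabs (a (S n)) * (4 * N) ^ S n).
  assert (Hb : ex_series b).
  { apply (ex_series_incr_1 (fun n => Rabs (a n) * (4 * N) ^ n)). apply Ha. lra. }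
  exists (2 * Series b). split.
  { assert (0 <= Series b); [|lra].
    apply Rle_trans with (Series (fun _ => 0)); [rewrite Series_zero; auto; lra|].
    apply Series_le; auto. intros n; split; [lra|]. unfold b. apply Rmult_le_pos; [apply Rabs_pos|apply pow_le; lra]. }
  intros w z Hw Hz. unfold CPS.
  rewrite (CSeries_incr_1 (fun k => RtoC (a k) * w ^ k)%C) by now apply entire_abs_summable.
  rewrite (CSeries_incr_1 (fun k => RtoC (a k) * z ^ k)%C) by now apply entire_abs_summable.
  assert (Sw : forall v, abs_summable (fun k => RtoC (a (S k)) * v ^ S k)%C).
  { intros v. apply (ex_series_incr_1 (fun k => Cmod (RtoC (a k) * v ^ k)%C)). now apply entire_abs_summable. }
  assert (Sd := entire_abs_summable _ z (entire_derive _ Ha)).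
  match goal with |- Cmod ?X <= _ => replace X with
    (CSeries (fun k => RtoC (a (S k)) * w ^ S k)%C - CSeries (fun k => RtoC (a (S k)) * z ^ S k)%C
     - (w - z) * CSeries (fun k => RtoC (PS_derive a k) * z ^ k)%C)%C by (simpl Cpow; ring) end.
  rewrite <- CSeries_scal, <- !CSeries_minus; auto.
  2:{ eapply abs_summable_le with (fun k => Cmod (RtoC (a (S k)) * w ^ S k) + Cmod (RtoC (a (S k)) * z ^ S k)).
      - intros k. unfold Cminus. eapply Rle_trans; [apply Cmod_triangle|]. rewrite Cmod_opp. lra.
      - apply (ex_series_plus (V := R_NormedModule)); apply Sw. }
  2:{ now apply abs_summable_scal. }
  rewrite Rmult_assoc, (Rmult_comm (Series b)), <- Series_scal_l.
  apply Cmod_CSeries_le.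
  2:{ now apply (ex_series_scal (V := R_NormedModule) (Cmod (w - z) ^ 2) b). }
  intros k. unfold PS_derive. rewrite RtoC_mult.
  replace (RtoC (a (S k)) * w ^ S k - RtoC (a (S k)) * z ^ S k - (w - z) * (RtoC (INR (S k)) * RtoC (a (S k)) * z ^ k))%C
    with (RtoC (a (S k)) * (w ^ S k - z ^ S k - (w - z) * (RtoC (INR (S k)) * z ^ k)))%C by ring.
  rewrite Cmod_mult, Cmod_R. unfold b.
  assert (T := Cpow_taylor_bound w z N k HN1 ltac:(lra) ltac:(lra)).
  assert (E : INR (S k) ^ 2 * N ^ S k <= (4 * N) ^ S k).
  { rewrite Rpow_mult_distr. apply Rmult_le_compat_r; [apply pow_le; lra|].
    replace 4 with (2 * 2) by ring. rewrite Rpow_mult_distr. simpl (_ ^ 2). rewrite Rmult_1_r.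
    assert (A := INR_le_pow2 (S k)). assert (B := pos_INR (S k)). apply Rmult_le_compat; auto. }
  assert (P1 := Rabs_pos (a (S k))). assert (P2 : 0 <= Cmod (w - z) ^ 2) by apply pow2_ge_0.
  apply Rle_trans with (Rabs (a (S k)) * ((4 * N) ^ S k * Cmod (w - z) ^ 2)).
  - apply Rmult_le_compat_l; auto. eapply Rle_trans; [exact T|]. apply Rmult_le_compat_r; auto.
  - right; ring.
Qed.

Lemma CPS_bound (a : nat -> R) (M : R) : entire a -> exists K, 0 <= K /\ forall z, Cmod z <= M -> Cmod (CPS a z) <= K.
Proof.
  intros Ha. set (N := Rmax 0 M). assert (HN1 : 0 <= N) by apply Rmax_l. assert (HN2 : M <= N) by apply Rmax_r.
  exists (2 * Series (fun n => Rabs (a n) * N ^ n)).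
  assert (H : forall z, Cmod z <= M -> Cmod (CPS a z) <= 2 * Series (fun n => Rabs (a n) * N ^ n)).
  { intros z Hz. apply Cmod_CSeries_le; [|now apply Ha].
    intros k. rewrite Cmod_mult, Cmod_pow, Cmod_R. apply Rmult_le_compat_l; [apply Rabs_pos|].
    apply pow_incr. split; [apply Cmod_ge_0|lra]. }
  split; auto. assert (0 <= Series (fun n => Rabs (a n) * N ^ n)); [|lra].
  apply Rle_trans with (Series (fun _ => 0)); [rewrite Series_zero; auto; lra|].
  apply Series_le; [|now apply Ha]. intros n; split; [lra|]. apply Rmult_le_pos; [apply Rabs_pos|apply pow_le; lra].
Qed.

Lemma CPS_0 (a : nat -> R) : entire a -> CPS a 0 = RtoC (a 0%nat).
Proof.
  intros Ha. unfold CPS. rewrite CSeries_incr_1 by now apply entire_abs_summable.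
  rewrite (CSeries_ext _ (fun k => RtoC 0 * (RtoC (a (S k)) * 0 ^ k))%C) by (intros; simpl; ring).
  unfold CSeries. rewrite !Series_zero.
  - apply injective_projections; simpl; ring.
  - intros; simpl; ring.
  - intros; simpl; ring.
Qed.

(** The linear factor is what absorbs the logarithm in [K0_near_log]. *)
Lemma CPS_lipschitz0 (a : nat -> R) (M : R) : entire a -> exists K, 0 <= K /\
  forall z, Cmod z <= M -> Cmod (CPS a z - RtoC (a 0%nat)) <= K * Cmod z.
Proof.
  intros Ha. set (N := Rmax 0 M). assert (HN1 : 0 <= N) by apply Rmax_l. assert (HN2 : M <= N) by apply Rmax_r.
  destruct (CPS_taylor a N Ha) as [K [HK H]].
  set (d := Cmod (CPS (PS_derive a) 0)). assert (Hd : 0 <= d) by apply Cmod_ge_0.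
  exists (K * N + d). split; [nra|].
  intros z Hz. specialize (H z (RtoC 0) ltac:(lra) ltac:(rewrite Cmod_0; lra)).
  rewrite CPS_0 in H by auto. set (D := CPS (PS_derive a) 0) in *.
  replace (z - 0)%C with z in H by ring.
  replace (CPS a z - RtoC (a 0%nat))%C with ((CPS a z - RtoC (a 0%nat) - z * D) + z * D)%C by ring.
  eapply Rle_trans; [apply Cmod_triangle|]. rewrite Cmod_mult. fold d.
  assert (A := Cmod_ge_0 z). assert (K * Cmod z ^ 2 <= K * N * Cmod z); [|nra].
  simpl. rewrite Rmult_1_r, Rmult_assoc. apply Rmult_le_compat_l; auto. apply Rmult_le_compat_r; lra.
Qed.

(** A chain rule along a real path in which complex differentiability of [F] enters only through its
    quadratic remainder at one point, so that no derivative over C has to be defined. *)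
Lemma isd_comp_quadratic (F : C -> C) (D : C) (q : R -> C) (t : R) (q' : C) (r K : R) :
  0 < r -> 0 <= K -> isd q t q' ->
  (forall w, Cmod (w - q t) < r -> Cmod (F w - F (q t) - (w - q t) * D) <= K * Cmod (w - q t) ^ 2) ->
  isd (fun u => F (q u)) t (D * q')%C.
Proof.
  intros Hr HK Hq H. apply isd_eps. intros eps He.
  set (B := Cmod q' + 1). assert (HB : 0 < B) by (unfold B; assert (A := Cmod_ge_0 q'); lra).
  set (e1 := Rmin 1 (eps / (2 * (Cmod D + 1)))).
  assert (HD := Cmod_ge_0 D).
  assert (He1 : 0 < e1) by (apply Rmin_pos; [lra|apply Rdiv_lt_0_compat; lra]).
  destruct (proj1 (isd_eps _ _ _) Hq e1 He1) as [d1 [Hd1 K1]].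
  set (d2 := Rmin (r / (2 * B)) (eps / (2 * (K + 1) * B ^ 2))).
  assert (HB2 : 0 < B ^ 2) by (apply pow_lt; lra).
  assert (Hd2 : 0 < d2).
  { apply Rmin_pos; apply Rdiv_lt_0_compat; try lra. apply Rmult_lt_0_compat; lra. }
  exists (Rmin d1 d2). split; [now apply Rmin_pos|]. intros u Hu.
  assert (A1 := Rmin_l d1 d2). assert (A2 := Rmin_r d1 d2).
  assert (A3 : d2 <= r / (2 * B)) by apply Rmin_l. assert (A4 : d2 <= eps / (2 * (K + 1) * B ^ 2)) by apply Rmin_r.
  assert (A5 : e1 <= 1) by apply Rmin_l. assert (A6 : e1 <= eps / (2 * (Cmod D + 1))) by apply Rmin_r.
  specialize (K1 u ltac:(lra)). set (h := Rabs (u - t)) in *. assert (Hh : 0 <= h) by apply Rabs_pos.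
  assert (Lq : Cmod (q u - q t) <= B * h).
  { replace (q u - q t)%C with ((q u - q t - RtoC (u - t) * q') + RtoC (u - t) * q')%C by ring.
    eapply Rle_trans; [apply Cmod_triangle|]. rewrite Cmod_mult, Cmod_R. fold h. unfold B.
    assert (e1 * h <= 1 * h) by (apply Rmult_le_compat_r; lra). lra. }
  assert (Hlt : Cmod (q u - q t) < r).
  { apply Rle_lt_trans with (B * (r / (2 * B))).
    - eapply Rle_trans; [exact Lq|]. apply Rmult_le_compat_l; lra.
    - replace (B * (r / (2 * B))) with (r / 2) by (field; lra). lra. }
  specialize (H (q u) Hlt).
  replace (F (q u) - F (q t) - RtoC (u - t) * (D * q'))%C with
    ((F (q u) - F (q t) - (q u - q t) * D) + D * (q u - q t - RtoC (u - t) * q'))%C by ring.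
  eapply Rle_trans; [apply Cmod_triangle|]. rewrite Cmod_mult.
  assert (C1 : K * Cmod (q u - q t) ^ 2 <= eps / 2 * h).
  { apply Rle_trans with (K * (B * h) ^ 2).
    - apply Rmult_le_compat_l; auto. apply pow_incr; split; [apply Cmod_ge_0|auto].
    - apply Rle_trans with ((K + 1) * B ^ 2 * (eps / (2 * (K + 1) * B ^ 2)) * h).
      + replace (K * (B * h) ^ 2) with (K * B ^ 2 * h * h) by ring. apply Rmult_le_compat_r; auto.
        apply Rmult_le_compat; try lra; nra.
      + right. field. split; lra. }
  assert (C2 : Cmod D * Cmod (q u - q t - RtoC (u - t) * q') <= eps / 2 * h).
  { apply Rle_trans with ((Cmod D + 1) * (eps / (2 * (Cmod D + 1)) * h)).
    - apply Rmult_le_compat; [auto|apply Cmod_ge_0|lra|].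
      eapply Rle_trans; [exact K1|]. apply Rmult_le_compat_r; auto.
    - right. field. lra. }
  lra.
Qed.

Lemma isd_CPS (a : nat -> R) (q : R -> C) (t : R) (q' : C) : entire a -> isd q t q' ->
  isd (fun u => CPS a (q u)) t (CPS (PS_derive a) (q t) * q')%C.
Proof.
  intros Ha Hq. destruct (CPS_taylor a (Cmod (q t) + 1) Ha) as [K [HK H]].
  apply isd_comp_quadratic with (r := 1) (K := K); auto; [lra|].
  intros w Hw. apply H; [|lra]. replace w with ((w - q t) + q t)%C by ring.
  eapply Rle_trans; [apply Cmod_triangle|]. lra.
Qed.

Lemma CPS_incr_1 (a : nat -> R) (z : C) : entire a -> CPS (PS_incr_1 a) z = (z * CPS a z)%C.
Proof.
  intros Ha. unfold CPS.
  assert (S0 : abs_summable (fun k => RtoC (PS_incr_1 a k) * z ^ k)%C).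
  { apply (ex_series_incr_1 (fun k => Cmod (RtoC (PS_incr_1 a k) * z ^ k)%C)).
    apply abs_summable_le with (fun k => Cmod z * Cmod (RtoC (a k) * z ^ k)).
    - intros k. simpl. rewrite <- Cmod_mult. right. f_equal. ring.
    - apply (ex_series_scal (V := R_NormedModule)). now apply entire_abs_summable. }
  rewrite CSeries_incr_1 by auto. rewrite <- CSeries_scal by now apply entire_abs_summable.
  rewrite (CSeries_ext (fun k => RtoC (PS_incr_1 a (S k)) * z ^ S k)%C (fun k => z * (RtoC (a k) * z ^ k))%C)
    by (intros; simpl; ring).
  simpl. change (zero : R) with 0. ring.
Qed.

Lemma CPS_plus (a b : nat -> R) (z : C) : entire a -> entire b ->
  CPS (fun k => a k + b k) z = (CPS a z + CPS b z)%C.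
Proof.
  intros Ha Hb. unfold CPS. rewrite <- CSeries_plus; auto using entire_abs_summable.
  apply CSeries_ext. intros k. rewrite RtoC_plus. ring.
Qed.

Lemma CPS_scal (r : R) (a : nat -> R) (z : C) : entire a -> CPS (fun k => r * a k) z = (RtoC r * CPS a z)%C.
Proof.
  intros Ha. unfold CPS. rewrite <- CSeries_scal; auto using entire_abs_summable.
  apply CSeries_ext. intros k. rewrite RtoC_mult. ring.
Qed.

Lemma CPS_ext (a b : nat -> R) (z : C) : (forall k, a k = b k) -> CPS a z = CPS b z.
Proof. intros H. apply CSeries_ext. intros; now rewrite H. Qed.

Lemma entire_incr_1 (a : nat -> R) : entire a -> entire (PS_incr_1 a).
Proof.
  intros Ha r Hr. apply (ex_series_incr_1 (fun n => Rabs (PS_incr_1 a n) * r ^ n)). simpl.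
  eapply ex_series_ext; [|apply (ex_series_scal (V := R_NormedModule) r (fun n => Rabs (a n) * r ^ n)), Ha, Hr].
  intros n. unfold scal; simpl; unfold mult; simpl. ring.
Qed.

Lemma entire_scal (r : R) (a : nat -> R) : entire a -> entire (fun k => r * a k).
Proof.
  intros Ha u Hu. eapply ex_series_ext; [|apply (ex_series_scal (V := R_NormedModule) (Rabs r) (fun n => Rabs (a n) * u ^ n)), Ha, Hu].
  intros n. unfold scal; simpl; unfold mult; simpl. rewrite Rabs_mult. ring.
Qed.

(** * The Hankel kernel as a function of the squared distance *)

Lemma Cmod_pos_of_Im (q : C) : 0 < Im q -> 0 < Cmod q.
Proof. intros H. apply Cmod_gt_0. intros E. rewrite E in H. simpl in H. lra. Qed.

Lemma neq0_of_Im (q : C) : 0 < Im q -> q <> 0.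
Proof. intros H E. rewrite E in H. simpl in H. lra. Qed.

Lemma Carg_bound (q : C) : 0 < Im q -> 0 <= Carg q <= PI.
Proof. intros H. unfold Carg. destruct (Rle_dec 0 (Im q)); [apply acos_bound|lra]. Qed.

Lemma polar_bounds (q : C) : 0 < Cmod q -> -1 <= Re q / Cmod q <= 1.
Proof.
  intros H. assert (A := re_le_Cmod q). apply Rabs_le_between in A. split.
  - apply Rle_div_r; lra.
  - apply Rle_div_l; lra.
Qed.

Lemma Carg_cos (q : C) : 0 < Im q -> Cmod q * cos (Carg q) = Re q.
Proof.
  intros H. assert (P := Cmod_pos_of_Im q H). unfold Carg. destruct (Rle_dec 0 (Im q)); [|lra].
  rewrite cos_acos by now apply polar_bounds. field. lra.
Qed.

Lemma Carg_sin (q : C) : 0 < Im q -> Cmod q * sin (Carg q) = Im q.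
Proof.
  intros H. assert (P := Cmod_pos_of_Im q H).
  assert (B := Carg_bound q H). assert (S := sin_ge_0 (Carg q) ltac:(lra) ltac:(lra)).
  assert (A := Carg_cos q H). assert (N := Cmod2_alt q). rewrite <- A in N.
  assert (T := sin2_cos2 (Carg q)). unfold Rsqr in T.
  assert (E : (Cmod q * sin (Carg q)) ^ 2 = Im q ^ 2).
  { replace (Im q ^ 2) with (Cmod q ^ 2 - (Cmod q * cos (Carg q)) ^ 2) by lra.
    replace (Cmod q ^ 2) with (Cmod q ^ 2 * (sin (Carg q) * sin (Carg q) + cos (Carg q) * cos (Carg q))) by (rewrite T; ring).
    ring. }
  assert (0 <= Cmod q * sin (Carg q)) by (apply Rmult_le_pos; lra).
  nra.
Qed.

Lemma Carg_unique (q : C) (th : R) : 0 < Cmod q -> 0 <= th <= PI -> q = (Cmod q * cos th, Cmod q * sin th) ->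
  Carg q = th.
Proof.
  intros H Ht E. assert (S : 0 <= sin th) by (apply sin_ge_0; lra).
  assert (E1 : Re q = Cmod q * cos th) by (rewrite E at 1; reflexivity).
  assert (E2 : Im q = Cmod q * sin th) by (rewrite E at 1; reflexivity).
  unfold Carg. destruct (Rle_dec 0 (Im q)) as [h|h].
  - rewrite E1. replace (Cmod q * cos th / Cmod q) with (cos th) by (field; lra). now apply acos_cos.
  - exfalso; apply h. rewrite E2. apply Rmult_le_pos; lra.
Qed.

(** [acos (Re q / |q|)] is awkward to differentiate; in the upper half-plane the same angle is a
    smooth function of the single quotient Re q / Im q. *)
Lemma Carg_atan (q : C) : 0 < Im q -> Carg q = PI / 2 - atan (Re q / Im q).
Proof.
  intros H. assert (P := Cmod_pos_of_Im q H). assert (B := atan_bound (Re q / Im q)).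
  apply Carg_unique; auto; [lra|].
  rewrite cos_shift, sin_shift, sin_atan, cos_atan.
  assert (E : sqrt (1 + (Re q / Im q)²) = Cmod q / Im q).
  { replace (1 + (Re q / Im q)²) with ((Cmod q / Im q) ^ 2).
    - apply sqrt_pow2. apply Rlt_le, Rdiv_lt_0_compat; lra.
    - unfold Rsqr, Rdiv. rewrite Rpow_mult_distr, Cmod2_alt. field. lra. }
  rewrite E. destruct q as [x y]. simpl Re in *. simpl Im in *.
  apply injective_projections; simpl fst; simpl snd; field; split; lra.
Qed.

Lemma isd_Im_locally (q : R -> C) (t : R) (q' : C) : isd q t q' -> 0 < Im (q t) -> locally t (fun u => 0 < Im (q u)).
Proof.
  intros H Hq. apply isd_ccont in H. destruct (proj1 (ccont_eps _ _) H _ Hq) as [d [Hd K]].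
  exists (mkposreal d Hd). intros u Hu. specialize (K u Hu).
  assert (A := snd_le_Cmod (q u - q t)). simpl in A.
  assert (B : Rabs (snd (q u) + - snd (q t)) < Im (q t)) by lra. apply Rabs_def2 in B. unfold Im in *. lra.
Qed.

Lemma is_derive_ln_norm (f g : R -> R) (t f' g' : R) : is_derive f t f' -> is_derive g t g' ->
  0 < f t ^ 2 + g t ^ 2 ->
  is_derive (fun u => / 2 * ln (f u ^ 2 + g u ^ 2)) t ((f t * f' + g t * g') / (f t ^ 2 + g t ^ 2)).
Proof.
  intros H1 H2 D. assert (E1 : ex_derive f t) by now exists f'. assert (E2 : ex_derive g t) by now exists g'.
  simpl in *. auto_derive; [repeat split; auto; lra|].
  change (Derive (fun x : R => f x) t) with (Derive f t). change (Derive (fun x : R => g x) t) with (Derive g t).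
  rewrite (is_derive_unique f t f' H1), (is_derive_unique g t g' H2). field. lra.
Qed.

Lemma is_derive_atan_quot (f g : R -> R) (t f' g' : R) : is_derive f t f' -> is_derive g t g' -> 0 < g t ->
  is_derive (fun u => PI / 2 - atan (f u / g u)) t ((f t * g' - f' * g t) / (f t ^ 2 + g t ^ 2)).
Proof.
  intros H1 H2 D. assert (E1 : ex_derive f t) by now exists f'. assert (E2 : ex_derive g t) by now exists g'.
  auto_derive; [repeat split; auto; lra|].
  change (Derive (fun x : R => f x) t) with (Derive f t). change (Derive (fun x : R => g x) t) with (Derive g t).
  rewrite (is_derive_unique f t f' H1), (is_derive_unique g t g' H2). field. repeat split; nra.
Qed.

Lemma is_derive_div_norm (f g h : R -> R) (t f' g' h' : R) : is_derive f t f' -> is_derive g t g' ->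
  is_derive h t h' -> 0 < f t ^ 2 + g t ^ 2 ->
  is_derive (fun u => h u / (f u ^ 2 + g u ^ 2)) t
    ((h' * (f t ^ 2 + g t ^ 2) - h t * (2 * f t * f' + 2 * g t * g')) / (f t ^ 2 + g t ^ 2) ^ 2).
Proof.
  intros H1 H2 H3 D. assert (E1 : ex_derive f t) by now exists f'. assert (E2 : ex_derive g t) by now exists g'.
  assert (E3 : ex_derive h t) by now exists h'.
  simpl in *. auto_derive; [repeat split; auto; lra|].
  change (Derive (fun x : R => f x) t) with (Derive f t). change (Derive (fun x : R => g x) t) with (Derive g t).
  change (Derive (fun x : R => h x) t) with (Derive h t).
  rewrite (is_derive_unique f t f' H1), (is_derive_unique g t g' H2), (is_derive_unique h t h' H3). field. lra.
Qed.

Lemma Cmod2_pos (z : C) : z <> 0 -> 0 < fst z ^ 2 + snd z ^ 2.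
Proof.
  intros H. assert (A := proj1 (Cmod_gt_0 _) H). assert (B := Cmod2_alt z). unfold Re, Im in B.
  rewrite <- B. now apply pow_lt.
Qed.

(** The upper half-plane is open, so near t the two components may be replaced by half the logarithm
    of |q|^2 and by the arctangent formula; their real derivatives are the components of q'/q. *)
Lemma isd_Clog (q : R -> C) (t : R) (q' : C) : isd q t q' -> 0 < Im (q t) -> isd (fun u => Clog (q u)) t (q' / q t)%C.
Proof.
  intros H Hq. assert (L := isd_Im_locally q t q' H Hq).
  apply isd_pair in H. destruct H as [H1 H2].
  assert (D := Cmod2_pos _ (neq0_of_Im _ Hq)).
  apply isd_pair. split.
  - apply is_derive_ext_loc with (fun u => / 2 * ln (fst (q u) ^ 2 + snd (q u) ^ 2)).
    + revert L. apply filter_imp. intros u Hu.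
      assert (D' := Cmod2_pos _ (neq0_of_Im _ Hu)). set (X := fst (q u) ^ 2 + snd (q u) ^ 2) in *.
      assert (P := sqrt_lt_R0 X D'). change (/ 2 * ln X = ln (sqrt X)).
      replace (ln X) with (ln (sqrt X * sqrt X)) by (f_equal; apply sqrt_sqrt; lra).
      rewrite ln_mult by auto. field.
    + evar_last; [apply (is_derive_ln_norm _ _ _ _ _ H1 H2 D)|].
      destruct (q t) as [x y], q' as [x' y']. simpl in *. field. lra.
  - apply is_derive_ext_loc with (fun u => PI / 2 - atan (fst (q u) / snd (q u))).
    + revert L. apply filter_imp. intros u Hu. simpl. symmetry. now apply Carg_atan.
    + evar_last; [apply (is_derive_atan_quot _ _ _ _ _ H1 H2 Hq)|].
      destruct (q t) as [x y], q' as [x' y']. simpl in *. field. lra.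
Qed.

Lemma isd_Cinv (q : R -> C) (t : R) (q' : C) : isd q t q' -> q t <> 0 -> isd (fun u => / q u)%C t (- q' / (q t * q t))%C.
Proof.
  intros H Hq. assert (D := Cmod2_pos _ Hq). apply isd_pair in H. destruct H as [H1 H2].
  (* The denominator |q q|^2 left by [field] is |q|^4, hence nonzero. *)
  assert (E : forall x y : R, (x * x - y * y) ^ 2 + (x * y + y * x) ^ 2 = (x * (x * 1) + y * (y * 1)) ^ 2) by (intros; ring).
  apply isd_pair. split.
  - evar_last; [apply (is_derive_div_norm _ _ _ _ _ _ _ H1 H2 H1 D)|].
    destruct (q t) as [x y], q' as [x' y']. simpl in *. field. split; [|lra].
    intros E0. assert (0 < (x * (x * 1) + y * (y * 1)) ^ 2) by now apply pow_lt.
    specialize (E x y). nra.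
  - assert (H3 : is_derive (fun u => - snd (q u)) t (- snd q')) by apply (is_derive_opp (V := R_NormedModule) _ _ _ H2).
    evar_last; [apply (is_derive_div_norm _ _ _ _ _ _ _ H1 H2 H3 D)|].
    destruct (q t) as [x y], q' as [x' y']. simpl in *. field. split; [|lra].
    intros E0. assert (0 < (x * (x * 1) + y * (y * 1)) ^ 2) by now apply pow_lt.
    specialize (E x y). nra.
Qed.

(** * Power series of the Hankel function in q, and the Bessel equation *)

Definition coefJ (k0 : R) (k : nat) : R := (-1) ^ k / INR (fact k) ^ 2 * (k0 ^ 2 / 4) ^ k.
(** [coefJ] gives J_0(k0 sqrt q) and [coefY] the non-logarithmic series of Y_0, both in powers of q.
    Only even powers of the argument occur in these functions, so the square root disappears and
    both become entire in q. *)
Definition coefY (k0 : R) (k : nat) : R := coefJ k0 k * harmonic k.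

Lemma harmonic_S (k : nat) : harmonic (S k) = harmonic k + / INR (S k).
Proof. unfold harmonic. rewrite sum_n_Sm by lia. reflexivity. Qed.

Lemma harmonic_bound (k : nat) : 0 <= harmonic k <= INR k.
Proof.
  induction k as [|k IH].
  - unfold harmonic. rewrite sum_n_m_zero by lia. simpl. unfold zero; simpl. lra.
  - rewrite harmonic_S, S_INR. assert (A := pos_INR k).
    assert (0 < / (INR k + 1)) by (apply Rinv_0_lt_compat; lra).
    assert (/ (INR k + 1) <= 1); [|lra]. rewrite <- Rinv_1. apply Rinv_le_contravar; lra.
Qed.

Lemma entire_coefJ (k0 : R) : entire (coefJ k0).
Proof.
  intros r Hr. set (x := k0 ^ 2 / 4 * r). assert (Hx : 0 <= x) by (unfold x; assert (A := pow2_ge_0 k0); nra).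
  apply (ex_series_le (V := R_CompleteNormedModule) _ (fun n => / INR (fact n) * x ^ n)).
  - intros n. unfold norm; simpl; unfold abs; simpl.
    rewrite Rabs_pos_eq by (apply Rmult_le_pos; [apply Rabs_pos|apply pow_le; lra]).
    unfold coefJ. assert (F := INR_fact_lt_0 n).
    assert (F1 : 1 <= INR (fact n)). { replace 1 with (INR 1) by reflexivity. apply le_INR, lt_O_fact. }
    rewrite Rabs_mult. unfold Rdiv at 1. rewrite Rabs_mult, pow_1_abs, Rmult_1_l.
    rewrite (Rabs_pos_eq (_ ^ n)) by (apply pow_le; assert (A := pow2_ge_0 k0); lra).
    rewrite Rabs_pos_eq by (apply Rlt_le, Rinv_0_lt_compat, pow_lt; lra).
    unfold x. rewrite (Rpow_mult_distr _ r), <- Rmult_assoc.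
    apply Rmult_le_compat_r; [apply pow_le; lra|].
    apply Rmult_le_compat_r; [apply pow_le; assert (A := pow2_ge_0 k0); lra|].
    apply Rinv_le_contravar; [lra|]. simpl. nra.
  - assert (H := is_exp_Reals x). eexists. eapply is_series_ext; [|exact H].
    intros n. simpl. unfold scal; simpl; unfold mult; simpl. rewrite pow_n_pow. ring.
Qed.

Lemma entire_coefY (k0 : R) : entire (coefY k0).
Proof.
  apply entire_dom with (coefJ k0) 2; [lra|apply entire_coefJ|]. intros n. unfold coefY. rewrite Rabs_mult.
  apply Rmult_le_compat_l; [apply Rabs_pos|]. assert (A := harmonic_bound n). rewrite Rabs_pos_eq by lra.
  assert (B := INR_le_pow2 n). lra.
Qed.

(** This two-term recurrence is the Bessel equation for P(q) = J_0(k0 sqrt q), written 4 (q P'' +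
    P') = - k0^2 P in the variable q. *)
Lemma coefJ_S (k0 : R) (k : nat) : INR (S k) ^ 2 * coefJ k0 (S k) = - (k0 ^ 2 / 4) * coefJ k0 k.
Proof.
  unfold coefJ. rewrite fact_simpl, mult_INR. assert (F := INR_fact_neq_0 k).
  assert (INR (S k) <> 0) by (apply not_0_INR; lia). change ((-1) ^ S k) with (-1 * (-1) ^ k).
  change ((k0 ^ 2 / 4) ^ S k) with (k0 ^ 2 / 4 * (k0 ^ 2 / 4) ^ k).
  generalize ((k0 ^ 2 / 4) ^ k) ((-1) ^ k). intros. field. auto.
Qed.

Fixpoint PS_der (n : nat) (a : nat -> R) : nat -> R :=
  match n with O => a | S m => PS_derive (PS_der m a) end.

Lemma entire_PS_der (n : nat) (a : nat -> R) : entire a -> entire (PS_der n a).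
Proof. intros Ha. induction n; simpl; auto. now apply entire_derive. Qed.

(** The coefficient of z^k on the left is k (k+1) a_(k+1) + (k+1) a_(k+1). *)
Lemma CPS_bessel_op (a : nat -> R) (z : C) : entire a ->
  (z * CPS (PS_der 2 a) z + CPS (PS_der 1 a) z)%C = CPS (fun k => INR (S k) ^ 2 * a (S k)) z.
Proof.
  intros Ha. rewrite <- CPS_incr_1 by now apply entire_PS_der.
  rewrite <- CPS_plus by (try apply entire_incr_1; now apply entire_PS_der).
  apply CPS_ext. intros [|k]; simpl PS_incr_1; unfold PS_der, PS_derive.
  - unfold zero; simpl. ring.
  - rewrite !(S_INR (S k)). ring.
Qed.

Lemma CPS_coefJ_ode (k0 : R) (z : C) :
  (z * CPS (PS_der 2 (coefJ k0)) z + CPS (PS_der 1 (coefJ k0)) z)%C = (RtoC (- (k0 ^ 2 / 4)) * CPS (coefJ k0) z)%C.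
Proof.
  rewrite CPS_bessel_op by apply entire_coefJ. rewrite <- CPS_scal by apply entire_coefJ.
  apply CPS_ext, coefJ_S.
Qed.

(** The harmonic numbers differ by 1/(k+1), which leaves the source term P'. It is exactly what the
    logarithm produces with the opposite sign in [K_ode]. *)
Lemma CPS_coefY_ode (k0 : R) (z : C) :
  (z * CPS (PS_der 2 (coefY k0)) z + CPS (PS_der 1 (coefY k0)) z)%C
  = (RtoC (- (k0 ^ 2 / 4)) * CPS (coefY k0) z + CPS (PS_der 1 (coefJ k0)) z)%C.
Proof.
  rewrite CPS_bessel_op by apply entire_coefY. rewrite <- CPS_scal by apply entire_coefY.
  rewrite <- CPS_plus by (try apply entire_scal; try apply (entire_PS_der 1); first [apply entire_coefY|apply entire_coefJ]).
  apply CPS_ext. intros k. unfold coefY, PS_der, PS_derive. rewrite harmonic_S.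
  assert (H : INR (S k) <> 0) by (apply not_0_INR; lia).
  replace (INR (S k) ^ 2 * (coefJ k0 (S k) * (harmonic k + / INR (S k))))
    with (INR (S k) ^ 2 * coefJ k0 (S k) * harmonic k + INR (S k) * coefJ k0 (S k)) by (field; auto).
  rewrite coefJ_S. ring.
Qed.

(** In J_0 + i Y_0 the factor 2 i / pi multiplies ln(k0/2) + (Log q)/2 + gamma. The half of Log q
    leaves i/pi, which is [cP]; the constants, together with the 1 of J_0, form [cR]. *)
Definition cP : C := (RtoC (/ PI) * Ci)%C.
Definition cR (k0 : R) : C := (1 + 2 * cP * RtoC (ln (k0 / 2) + euler_gamma))%C.
Definition Jser (k0 : R) (n : nat) (q : C) : C := CPS (PS_der n (coefJ k0)) q.
Definition Rser (k0 : R) (n : nat) (q : C) : C := (cR k0 * Jser k0 n q - 2 * cP * CPS (PS_der n (coefY k0)) q)%C.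

(* [K0 k0 q] is H_0^(1)(k0 sqrt q) on the upper half-plane; [K1], [K2], [K3] are its derivatives in [q]. *)
Definition K0 (k0 : R) (q : C) : C := (cP * (Jser k0 0 q * Clog q) + Rser k0 0 q)%C.
Definition K1 (k0 : R) (q : C) : C := (cP * (Jser k0 1 q * Clog q + Jser k0 0 q / q) + Rser k0 1 q)%C.
Definition K2 (k0 : R) (q : C) : C :=
  (cP * (Jser k0 2 q * Clog q + 2 * Jser k0 1 q / q - Jser k0 0 q / (q * q)) + Rser k0 2 q)%C.
Definition K3 (k0 : R) (q : C) : C :=
  (cP * (Jser k0 3 q * Clog q + 3 * Jser k0 2 q / q - 3 * Jser k0 1 q / (q * q) + 2 * Jser k0 0 q / (q * (q * q))) + Rser k0 3 q)%C.

Lemma isd_Jser (k0 : R) (n : nat) (q : R -> C) (t : R) (q' : C) : isd q t q' ->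
  isd (fun u => Jser k0 n (q u)) t (Jser k0 (S n) (q t) * q')%C.
Proof. intros H. apply isd_CPS; auto. apply entire_PS_der, entire_coefJ. Qed.

Lemma isd_Rser (k0 : R) (n : nat) (q : R -> C) (t : R) (q' : C) : isd q t q' ->
  isd (fun u => Rser k0 n (q u)) t (Rser k0 (S n) (q t) * q')%C.
Proof.
  intros H. eapply isd_eq.
  - apply isd_minus; apply isd_scal; [apply isd_Jser, H|].
    apply isd_CPS; [apply entire_PS_der, entire_coefY|exact H].
  - unfold Rser. simpl PS_der. ring.
Qed.

(** In q K2 + K1 the poles cancel and the logarithm is multiplied by q P'' + P'. The remaining cross
    term 2 [cP] P' is cancelled by the source term of the second series. *)
Lemma K_ode (k0 : R) (q : C) : q <> 0 -> (4 * (q * K2 k0 q + K1 k0 q))%C = (- RtoC (k0 ^ 2) * K0 k0 q)%C.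
Proof.
  intros Hq. assert (A := CPS_coefJ_ode k0 q). assert (B := CPS_coefY_ode k0 q).
  unfold K0, K1, K2, Rser, Jser. simpl PS_der in *.
  set (P0 := CPS (coefJ k0) q) in *. set (Q1 := CPS (PS_derive (coefJ k0)) q) in *.
  set (Q2 := CPS (PS_derive (PS_derive (coefJ k0))) q) in *.
  set (Y0 := CPS (coefY k0) q) in *. set (Y1 := CPS (PS_derive (coefY k0)) q) in *.
  set (Y2 := CPS (PS_derive (PS_derive (coefY k0))) q) in *.
  assert (E : RtoC (k0 ^ 2) = (-4 * RtoC (- (k0 ^ 2 / 4)))%C).
  { rewrite <- RtoC_mult. f_equal. field. }
  rewrite E. set (m := RtoC (- (k0 ^ 2 / 4))) in *. clearbody m. clear E.
  transitivity (4 * (cP * ((q * Q2 + Q1) * Clog q + 2 * Q1) + cR k0 * (q * Q2 + Q1) - 2 * cP * (q * Y2 + Y1)))%C.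
  - field. exact Hq.
  - rewrite A, B. ring.
Qed.

Lemma isd_K0 (k0 : R) (q : R -> C) (t : R) (q' : C) : isd q t q' -> 0 < Im (q t) ->
  isd (fun u => K0 k0 (q u)) t (K1 k0 (q t) * q')%C.
Proof.
  intros H Hq. assert (N := neq0_of_Im _ Hq). eapply isd_eq.
  - apply isd_plus; [apply isd_scal, isd_mult|]; [apply isd_Jser, H|apply isd_Clog; eauto|apply isd_Rser, H].
  - unfold K1. field. exact N.
Qed.

Lemma isd_K1 (k0 : R) (q : R -> C) (t : R) (q' : C) : isd q t q' -> 0 < Im (q t) ->
  isd (fun u => K1 k0 (q u)) t (K2 k0 (q t) * q')%C.
Proof.
  intros H Hq. assert (N := neq0_of_Im _ Hq). eapply isd_eq.
  - apply isd_plus; [apply isd_scal, isd_plus; apply isd_mult|].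
    + apply isd_Jser, H.
    + apply isd_Clog; eauto.
    + apply isd_Jser, H.
    + apply isd_Cinv; eauto.
    + apply isd_Rser, H.
  - unfold K2. field. exact N.
Qed.

Lemma isd_K2 (k0 : R) (q : R -> C) (t : R) (q' : C) : isd q t q' -> 0 < Im (q t) ->
  isd (fun u => K2 k0 (q u)) t (K3 k0 (q t) * q')%C.
Proof.
  intros H Hq. assert (N := neq0_of_Im _ Hq). eapply isd_eq.
  - apply isd_plus; [apply isd_scal, isd_minus; [apply isd_plus|]; apply isd_mult|].
    + apply isd_Jser, H.
    + apply isd_Clog; eauto.
    + apply isd_scal, isd_Jser, H.
    + apply isd_Cinv; eauto.
    + apply isd_Jser, H.
    + apply (isd_Cinv (fun u => q u * q u)%C); [apply isd_mult; exact H|].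
      apply Cmult_neq_0; auto.
    + apply isd_Rser, H.
  - unfold K3. field. exact N.
Qed.

(** * Identification of [K0] with the Hankel function *)

Lemma Csqrt_polar (q : C) : 0 < Im q ->
  Csqrt q = (sqrt (Cmod q) * cos (Carg q / 2), sqrt (Cmod q) * sin (Carg q / 2)).
Proof.
  intros H. assert (B := Carg_bound q H). assert (P := PI_RGT_0). unfold Csqrt, arg_cut.
  destruct (Rlt_dec (Carg q) (- PI / 2)); [lra|reflexivity].
Qed.

Lemma Csqrt_sqr (q : C) : 0 < Im q -> (Csqrt q * Csqrt q)%C = q.
Proof.
  intros H. rewrite Csqrt_polar by auto. set (a := Carg q / 2).
  assert (S := sqrt_sqrt (Cmod q) (Cmod_ge_0 q)).
  assert (A := Carg_cos q H). assert (B := Carg_sin q H).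
  replace (Carg q) with (2 * a) in A, B by (unfold a; field). rewrite cos_2a in A. rewrite sin_2a in B.
  rewrite <- S in A, B. clearbody a. revert A B. generalize (sqrt (Cmod q)). intros r A B.
  destruct q as [x y]. apply injective_projections; simpl in *.
  - rewrite <- A. ring.
  - rewrite <- B. ring.
Qed.

(** The square root has its argument in [0, pi/2], so halving the argument crosses no branch cut of
    [Clog]. *)
Lemma Clog_scal_Csqrt (c : R) (q : C) : 0 < c -> 0 < Im q ->
  Clog (RtoC c * Csqrt q) = (RtoC (ln c) + Clog q / 2)%C.
Proof.
  intros Hc H. assert (P := Cmod_pos_of_Im q H). assert (S := sqrt_lt_R0 _ P). assert (B := Carg_bound q H).
  assert (M : Cmod (RtoC c * Csqrt q) = c * sqrt (Cmod q)).
  { rewrite Cmod_mult, Cmod_R, Rabs_pos_eq by lra. f_equal.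
    rewrite <- (Csqrt_sqr q H) at 2. rewrite Cmod_mult, sqrt_square; auto. apply Cmod_ge_0. }
  unfold Clog. rewrite M.
  rewrite (Carg_unique (RtoC c * Csqrt q) (Carg q / 2)).
  - rewrite ln_mult by auto.
    replace (ln (Cmod q)) with (ln (sqrt (Cmod q) * sqrt (Cmod q))) by (f_equal; apply sqrt_sqrt; lra).
    rewrite ln_mult by auto. apply injective_projections; simpl; field.
  - rewrite M. now apply Rmult_lt_0_compat.
  - lra.
  - rewrite M, Csqrt_polar by auto. apply injective_projections; simpl; ring.
Qed.

(** Both series of the Hankel function see their argument only through its square k0^2 q, and the
    logarithm splits by [Clog_scal_Csqrt]. *)
Lemma hankel_K0 (k0 : R) (q : C) : 0 < k0 -> 0 < Im q -> hankel_H0 (RtoC k0 * Csqrt q) = K0 k0 q.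
Proof.
  intros Hk H.
  assert (E : (RtoC k0 * Csqrt q / 2)%C = (RtoC (k0 / 2) * Csqrt q)%C) by (rewrite RtoC_div by lra; field).
  assert (W : forall k, ((RtoC (k0 / 2) * Csqrt q) ^ (2 * k))%C = (RtoC ((k0 ^ 2 / 4) ^ k) * q ^ k)%C).
  { intros k. rewrite RtoC_pow, <- Cpow_mult_l, Cpow_mult_r. f_equal.
    transitivity (RtoC (k0 / 2) * RtoC (k0 / 2) * (Csqrt q * Csqrt q))%C; [simpl Cpow; ring|].
    rewrite Csqrt_sqr by auto. rewrite <- RtoC_mult. f_equal. f_equal. field. }
  assert (J : bessel_J0 (RtoC k0 * Csqrt q) = CPS (coefJ k0) q).
  { unfold bessel_J0, CPS. apply CSeries_ext. intros k. rewrite E, W. unfold coefJ.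
    rewrite RtoC_mult. ring. }
  unfold hankel_H0, bessel_Y0. rewrite J, E, Clog_scal_Csqrt by (auto; lra).
  rewrite (CSeries_ext _ (fun k => RtoC (coefY k0 k) * q ^ k)%C).
  2:{ intros k. rewrite W. unfold coefY, coefJ.
      replace (RtoC ((-1) ^ k / INR (fact k) ^ 2 * (k0 ^ 2 / 4) ^ k * harmonic k))
        with (RtoC ((-1) ^ k * harmonic k / INR (fact k) ^ 2) * RtoC ((k0 ^ 2 / 4) ^ k))%C.
      - ring.
      - rewrite <- RtoC_mult. f_equal. field. apply INR_fact_neq_0. }
  fold (CPS (coefY k0) q). unfold K0, Rser, Jser, cR, cP. simpl PS_der.
  replace (RtoC (2 / PI)) with (2 * RtoC (/ PI))%C by (rewrite <- RtoC_mult; f_equal).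
  rewrite RtoC_plus. field.
Qed.

(** * Size of the kernel and of its derivatives near q = 0 *)

Lemma Cmod_plus_le (a b : C) (x y : R) : Cmod a <= x -> Cmod b <= y -> Cmod (a + b) <= x + y.
Proof. intros. eapply Rle_trans; [apply Cmod_triangle|]. lra. Qed.

Lemma Cmod_minus_le (a b : C) (x y : R) : Cmod a <= x -> Cmod b <= y -> Cmod (a - b) <= x + y.
Proof. intros. unfold Cminus. apply Cmod_plus_le; auto. now rewrite Cmod_opp. Qed.

Lemma Cmod_mult_le (a b : C) (x y : R) : Cmod a <= x -> Cmod b <= y -> Cmod (a * b) <= x * y.
Proof. intros. rewrite Cmod_mult. apply Rmult_le_compat; auto; apply Cmod_ge_0. Qed.

Lemma ln_abs_le (x : R) : 0 < x -> Rabs (ln x) <= x + / x.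
Proof.
  intros Hx. assert (W : forall y, 0 < y -> ln y <= y).
  { intros y Hy. assert (A := exp_ineq1_le (ln y)). rewrite exp_ln in A; lra. }
  assert (A := W x Hx). assert (Hi := Rinv_0_lt_compat x Hx). assert (B := W _ Hi). rewrite ln_Rinv in B by auto.
  apply Rabs_le. lra.
Qed.

(** A fourth root, because q scales like the square of a distance: |q|^(-1/4) becomes the inverse
    square root of the distance. *)
Lemma ln_abs_root (x : R) : 0 < x -> Rabs (ln x) <= 4 * (sqrt (sqrt x) + / sqrt (sqrt x)).
Proof.
  intros Hx. set (y := sqrt (sqrt x)). assert (Hy : 0 < y) by (unfold y; do 2 apply sqrt_lt_R0; assumption).
  assert (E : x = y ^ 4).
  { unfold y. replace (sqrt (sqrt x) ^ 4) with ((sqrt (sqrt x) * sqrt (sqrt x)) * (sqrt (sqrt x) * sqrt (sqrt x))) by ring.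
    rewrite (sqrt_sqrt (sqrt x)) by apply sqrt_pos. rewrite sqrt_sqrt; lra. }
  rewrite E, ln_pow by auto. rewrite Rabs_mult, Rabs_pos_eq by (simpl; lra).
  replace (INR 4) with 4 by (simpl; ring). apply Rmult_le_compat_l; [lra|]. now apply ln_abs_le.
Qed.

Lemma Clog_bound (q : C) : 0 < Im q -> Cmod (Clog q) <= Rabs (ln (Cmod q)) + PI.
Proof.
  intros H. eapply Rle_trans; [apply Cmod_le_abs|]. simpl. assert (B := Carg_bound q H).
  rewrite (Rabs_pos_eq (Carg q)) by lra. lra.
Qed.

Lemma qClog_bound (q : C) (M : R) : 0 < Im q -> Cmod q <= M -> Cmod (q * Clog q) <= M * M + 1 + PI * M.
Proof.
  intros H HM. assert (P := Cmod_pos_of_Im q H). rewrite Cmod_mult.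
  assert (A := Clog_bound q H). assert (B := ln_abs_le _ P). assert (PP := PI_RGT_0).
  apply Rle_trans with (Cmod q * (Cmod q + / Cmod q + PI)).
  - apply Rmult_le_compat_l; lra.
  - replace (Cmod q * (Cmod q + / Cmod q + PI)) with (Cmod q * Cmod q + 1 + PI * Cmod q) by (field; lra). nra.
Qed.

Lemma Jser_bound (k0 : R) (n : nat) (M : R) : exists K, 0 <= K /\ forall q, Cmod q <= M -> Cmod (Jser k0 n q) <= K.
Proof. apply CPS_bound, entire_PS_der, entire_coefJ. Qed.

Lemma Rser_bound (k0 : R) (n : nat) (M : R) : exists K, 0 <= K /\ forall q, Cmod q <= M -> Cmod (Rser k0 n q) <= K.
Proof.
  destruct (Jser_bound k0 n M) as [A [HA KA]].
  destruct (CPS_bound (PS_der n (coefY k0)) M) as [B [HB KB]]; [apply entire_PS_der, entire_coefY|].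
  exists (Cmod (cR k0) * A + Cmod (2 * cP) * B). split.
  - assert (X := Cmod_ge_0 (cR k0)). assert (Y := Cmod_ge_0 (2 * cP)). nra.
  - intros q Hq. unfold Rser. apply Cmod_minus_le; apply Cmod_mult_le; try lra; auto.
Qed.

(** Assembles a bound for a modulus along the sums, differences and products of an expression. The
    right-hand side is an existential variable, filled at the leaves from the context, or by the
    modulus itself for constants; as the variable is older than [q], the resulting constant cannot
    depend on [q]. *)
Ltac cbound := repeat first [eassumption | lazymatch goal with
  | |- Cmod (_ + _) <= _ => apply Cmod_plus_le
  | |- Cmod (_ - _) <= _ => apply Cmod_minus_le
  | |- Cmod (_ * _) <= _ => apply Cmod_mult_le
  | |- _ => apply Rle_refl end].

(** Multiplication by q removes the pole and turns Log q into q Log q, so q K1 is built from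
    functions bounded on a disc. The next two bounds use q^2 and q^3 in the same way. *)
Lemma K1_bound (k0 M : R) : exists K, forall q, 0 < Im q -> Cmod q <= M -> Cmod (K1 k0 q) <= K / Cmod q.
Proof.
  destruct (Jser_bound k0 0 M) as [A0 [_ B0]]. destruct (Jser_bound k0 1 M) as [A1 [_ B1]].
  destruct (Rser_bound k0 1 M) as [A2 [_ B2]].
  eexists. intros q Hq HM. specialize (B0 q HM). specialize (B1 q HM). specialize (B2 q HM).
  assert (L := qClog_bound q M Hq HM). assert (P := Cmod_pos_of_Im q Hq). assert (N := neq0_of_Im q Hq).
  apply Rle_div_r; [lra|]. rewrite Rmult_comm, <- Cmod_mult.
  replace (q * K1 k0 q)%C with (cP * (Jser k0 1 q * (q * Clog q) + Jser k0 0 q) + q * Rser k0 1 q)%C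
    by (unfold K1; field; auto).
  cbound.
Qed.

Lemma K2_bound (k0 M : R) : exists K, forall q, 0 < Im q -> Cmod q <= M -> Cmod (K2 k0 q) <= K / (Cmod q * Cmod q).
Proof.
  destruct (Jser_bound k0 0 M) as [A0 [_ B0]]. destruct (Jser_bound k0 1 M) as [A1 [_ B1]].
  destruct (Jser_bound k0 2 M) as [A2 [_ B2]]. destruct (Rser_bound k0 2 M) as [A3 [_ B3]].
  eexists. intros q Hq HM. specialize (B0 q HM). specialize (B1 q HM). specialize (B2 q HM). specialize (B3 q HM).
  assert (L := qClog_bound q M Hq HM). assert (P := Cmod_pos_of_Im q Hq). assert (N := neq0_of_Im q Hq).
  apply Rle_div_r; [nra|]. rewrite Rmult_comm, <- !Cmod_mult.
  replace (q * q * K2 k0 q)%C with (cP * (Jser k0 2 q * (q * (q * Clog q)) + 2 * Jser k0 1 q * q - Jser k0 0 q) + q * (q * Rser k0 2 q))%C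
    by (unfold K2; field; auto).
  cbound.
Qed.

Lemma K3_bound (k0 M : R) : exists K, forall q, 0 < Im q -> Cmod q <= M ->
  Cmod (K3 k0 q) <= K / (Cmod q * Cmod q * Cmod q).
Proof.
  destruct (Jser_bound k0 0 M) as [A0 [_ B0]]. destruct (Jser_bound k0 1 M) as [A1 [_ B1]].
  destruct (Jser_bound k0 2 M) as [A2 [_ B2]]. destruct (Jser_bound k0 3 M) as [A4 [_ B4]].
  destruct (Rser_bound k0 3 M) as [A3 [_ B3]].
  eexists. intros q Hq HM. specialize (B0 q HM). specialize (B1 q HM). specialize (B2 q HM). specialize (B3 q HM).
  specialize (B4 q HM).
  assert (L := qClog_bound q M Hq HM). assert (P := Cmod_pos_of_Im q Hq). assert (N := neq0_of_Im q Hq).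
  apply Rle_div_r; [assert (0 < Cmod q * Cmod q) by nra; nra|]. rewrite Rmult_comm, <- !Cmod_mult.
  replace (q * q * q * K3 k0 q)%C with (cP * (Jser k0 3 q * (q * (q * (q * Clog q))) + 3 * Jser k0 2 q * (q * q)
     - 3 * Jser k0 1 q * q + 2 * Jser k0 0 q) + q * (q * (q * Rser k0 3 q)))%C
    by (unfold K3; field; auto).
  cbound.
Qed.

Lemma coefJ_0 (k0 : R) : coefJ k0 0 = 1.
Proof. unfold coefJ; simpl. field. Qed.

(** The coefficient P of the logarithm equals 1 at 0, so (P(q) - 1) Log q = O(|q Log q|) stays
    bounded: the singularity of the kernel is a pure logarithm. *)
Lemma K0_near_log (k0 M : R) : exists K, 0 <= K /\ forall q, 0 < Im q -> Cmod q <= M -> Cmod (K0 k0 q - cP * Clog q) <= K.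
Proof.
  destruct (CPS_lipschitz0 (coefJ k0) M (entire_coefJ k0)) as [A [HA B]]. destruct (Rser_bound k0 0 M) as [A2 [H2 B2]].
  assert (PP := PI_RGT_0).
  exists (Cmod cP * (A * (M * M + 1 + PI * Rmax 0 M)) + A2). split.
  { assert (X := Cmod_ge_0 cP). assert (Y := Rmax_l 0 M).
    assert (0 <= A * (M * M + 1 + PI * Rmax 0 M)); [apply Rmult_le_pos; nra|]. nra. }
  intros q Hq HM. specialize (B q HM). specialize (B2 q HM). rewrite coefJ_0 in B.
  assert (L := qClog_bound q M Hq HM).
  assert (P := Cmod_pos_of_Im q Hq). rewrite Rmax_right by lra. rewrite Cmod_mult in L.
  replace (K0 k0 q - cP * Clog q)%C with (cP * ((CPS (coefJ k0) q - RtoC 1) * Clog q) + Rser k0 0 q)%C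
    by (unfold K0, Jser; simpl PS_der; ring).
  apply Cmod_plus_le; auto. apply Cmod_mult_le; [lra|]. rewrite Cmod_mult.
  assert (X := Cmod_ge_0 (Clog q)).
  apply Rle_trans with (A * Cmod q * Cmod (Clog q)); [apply Rmult_le_compat_r; auto|].
  rewrite Rmult_assoc. apply Rmult_le_compat_l; auto.
Qed.

Lemma K0_bound (k0 M : R) : exists K, forall q, 0 < Im q -> Cmod q <= M -> Cmod (K0 k0 q) <= K / sqrt (sqrt (Cmod q)).
Proof.
  destruct (K0_near_log k0 M) as [A [HA B]].
  set (m := sqrt (sqrt M)). assert (PP := PI_RGT_0).
  exists (A * m + Cmod cP * (4 * (m * m + 1) + PI * m)). intros q Hq HM. specialize (B q Hq HM).
  assert (P := Cmod_pos_of_Im q Hq). set (y := sqrt (sqrt (Cmod q))).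
  assert (Hy : 0 < y) by (unfold y; do 2 apply sqrt_lt_R0; assumption).
  assert (Hym : y <= m) by (unfold y, m; do 2 apply sqrt_le_1_alt; assumption).
  assert (L := Clog_bound q Hq). assert (Rt := ln_abs_root _ P). fold y in Rt.
  apply Rle_div_r; [lra|].
  replace (K0 k0 q) with ((K0 k0 q - cP * Clog q) + cP * Clog q)%C by ring.
  assert (X := Cmod_ge_0 cP).
  apply Rle_trans with ((A + Cmod cP * (4 * (y + / y) + PI)) * y).
  - apply Rmult_le_compat_r; [lra|]. apply Cmod_plus_le; auto. apply Cmod_mult_le; lra.
  - replace ((A + Cmod cP * (4 * (y + / y) + PI)) * y) with (A * y + Cmod cP * (4 * (y * y + 1) + PI * y)) by (field; lra).
    apply Rplus_le_compat; [apply Rmult_le_compat_l; lra|]. apply Rmult_le_compat_l; auto.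
    assert (y * y <= m * m) by (apply Rmult_le_compat; lra).
    assert (PI * y <= PI * m) by (apply Rmult_le_compat_l; lra). lra.
Qed.

(** * The anisotropic kernel and its regularization *)

Section Kernel.
Variables (k0 : R) (e1 e2 : C).
Hypotheses (h1 : 0 < Im e1) (h2 : 0 < Im e2).

(* Planar vectors are complex numbers; [Qf] and [Bf] are the complex quadratic and bilinear forms of [A^-1],
   so that [rtilde x y] is the square root of [Qf (x - y)]. *)
Definition Qf (z : C) : C := (e1 * RtoC (fst z ^ 2) + e2 * RtoC (snd z ^ 2))%C.
Definition Bf (z v : C) : C := (e1 * RtoC (fst z * fst v) + e2 * RtoC (snd z * snd v))%C.
(* Adding [i rho^2] keeps the argument in the upper half-plane even at [z = 0]. *)
Definition qr (rho : R) (z : C) : C := (Qf z + Ci * RtoC (rho ^ 2))%C.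
Definition G0 (rho : R) (z : C) : C := K0 k0 (qr rho z).
Definition G1 (rho : R) (z v : C) : C := (2 * K1 k0 (qr rho z) * Bf z v)%C.
(** [v] is the velocity of the point [z]; [w] is the direction of the first derivative and [w'] the
    rate at which this direction itself turns, 0 for a fixed direction. *)
Definition G2 (rho : R) (z v w w' : C) : C :=
  (4 * K2 k0 (qr rho z) * Bf z v * Bf z w + 2 * K1 k0 (qr rho z) * (Bf v w + Bf z w'))%C.

(** Coercivity constant of Im [qr]; the 1 is the coefficient of rho^2. *)
Definition cQ : R := Rmin 1 (Rmin (Im e1) (Im e2)).
Definition EQ : R := Cmod e1 + Cmod e2.

Lemma cQ_pos : 0 < cQ.
Proof. unfold cQ. repeat apply Rmin_pos; lra. Qed.

Lemma EQ_pos : 0 < EQ.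
Proof. unfold EQ. assert (A := Cmod_pos_of_Im e1 h1). assert (B := Cmod_pos_of_Im e2 h2). lra. Qed.

Lemma Im_qr (rho : R) (z : C) : Im (qr rho z) = Im e1 * fst z ^ 2 + Im e2 * snd z ^ 2 + rho ^ 2.
Proof. unfold qr, Qf, Im. simpl. ring. Qed.

Lemma Im_qr_ge (rho : R) (z : C) : cQ * (Cmod z ^ 2 + rho ^ 2) <= Im (qr rho z).
Proof.
  rewrite Im_qr, Cmod2_alt. unfold Re, Im at 1.
  assert (A1 : cQ <= 1) by apply Rmin_l.
  assert (A2 : cQ <= Im e1) by (eapply Rle_trans; [apply Rmin_r|apply Rmin_l]).
  assert (A3 : cQ <= Im e2) by (eapply Rle_trans; [apply Rmin_r|apply Rmin_r]).
  assert (B1 := pow2_ge_0 (fst z)). assert (B2 := pow2_ge_0 (snd z)). assert (B3 := pow2_ge_0 rho). nra.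
Qed.

Lemma Cmod_qr_ge (rho : R) (z : C) : cQ * (Cmod z ^ 2 + rho ^ 2) <= Cmod (qr rho z).
Proof.
  eapply Rle_trans; [apply Im_qr_ge|]. eapply Rle_trans; [apply Rle_abs|apply snd_le_Cmod].
Qed.

Lemma Im_qr_pos (rho : R) (z : C) : 0 < Cmod z + rho -> 0 <= rho -> 0 < Im (qr rho z).
Proof.
  intros H Hr. eapply Rlt_le_trans; [|apply Im_qr_ge]. assert (A := cQ_pos). assert (B := Cmod_ge_0 z).
  apply Rmult_lt_0_compat; auto.
  destruct (Req_dec rho 0) as [->|N]; [|assert (0 < rho ^ 2) by (apply pow_lt; lra); nra].
  assert (0 < Cmod z ^ 2) by (apply pow_lt; lra). lra.
Qed.

Lemma Cmod_Qf_le (z : C) : Cmod (Qf z) <= EQ * Cmod z ^ 2.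
Proof.
  unfold Qf, EQ. rewrite Rmult_plus_distr_r. assert (N := Cmod2_alt z). unfold Re, Im in N.
  assert (B1 := pow2_ge_0 (fst z)). assert (B2 := pow2_ge_0 (snd z)).
  apply Cmod_plus_le; apply Cmod_mult_le; try apply Rle_refl; rewrite Cmod_R, Rabs_pos_eq; lra.
Qed.

Lemma Cmod_qr_le (rho : R) (z : C) : Cmod (qr rho z) <= EQ * Cmod z ^ 2 + rho ^ 2.
Proof.
  unfold qr. apply Cmod_plus_le; [apply Cmod_Qf_le|]. rewrite Cmod_mult, Cmod_Ci, Cmod_R, Rabs_pos_eq by apply pow2_ge_0. lra.
Qed.

Lemma Cmod_Bf_le (z v : C) : Cmod (Bf z v) <= EQ * (Cmod z * Cmod v).
Proof.
  unfold Bf, EQ. rewrite Rmult_plus_distr_r.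
  apply Cmod_plus_le; apply Cmod_mult_le; try apply Rle_refl; rewrite Cmod_R, Rabs_mult;
  apply Rmult_le_compat; try apply Rabs_pos; try apply fst_le_Cmod; apply snd_le_Cmod.
Qed.

Lemma qr_0 (z : C) : qr 0 z = Qf z.
Proof. unfold qr. replace (0 ^ 2) with 0 by ring. ring. Qed.

Lemma isd_Bf (z w : R -> C) (t : R) (v w' : C) : isd z t v -> isd w t w' ->
  isd (fun u => Bf (z u) (w u)) t (Bf v (w t) + Bf (z t) w')%C.
Proof.
  intros Hz Hw. eapply isd_eq.
  - apply isd_plus; apply isd_scal.
    + apply is_derive_ext with (fun u => RtoC (fst (z u)) * RtoC (fst (w u)))%C.
      { intros; now rewrite <- RtoC_mult. }
      apply isd_mult; apply isd_fst; eassumption.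
    + apply is_derive_ext with (fun u => RtoC (snd (z u)) * RtoC (snd (w u)))%C.
      { intros; now rewrite <- RtoC_mult. }
      apply isd_mult; apply isd_snd; eassumption.
  - unfold Bf. rewrite !RtoC_mult. ring.
Qed.

Lemma isd_qr (rho : R) (z : R -> C) (t : R) (v : C) : isd z t v ->
  isd (fun u => qr rho (z u)) t (2 * Bf (z t) v)%C.
Proof.
  intros Hz. apply is_derive_ext with (fun u => Bf (z u) (z u) + Ci * RtoC (rho ^ 2))%C.
  { intros u. unfold qr, Qf, Bf. f_equal. f_equal; f_equal; f_equal; ring. }
  eapply isd_eq; [apply isd_plus; [apply isd_Bf; exact Hz|apply isd_const]|].
  unfold Bf. rewrite !RtoC_mult. ring.
Qed.

Lemma isd_G0 (rho : R) (z : R -> C) (t : R) (v : C) : isd z t v -> 0 < Im (qr rho (z t)) ->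
  isd (fun u => G0 rho (z u)) t (G1 rho (z t) v).
Proof.
  intros Hz Hq. eapply isd_eq.
  - apply (isd_K0 k0 (fun u => qr rho (z u))); [apply isd_qr, Hz|exact Hq].
  - unfold G1. ring.
Qed.

Lemma isd_K1qr (rho : R) (z : R -> C) (t : R) (v : C) : isd z t v -> 0 < Im (qr rho (z t)) ->
  isd (fun u => K1 k0 (qr rho (z u))) t (2 * K2 k0 (qr rho (z t)) * Bf (z t) v)%C.
Proof.
  intros Hz Hq. eapply isd_eq.
  - apply (isd_K1 k0 (fun u => qr rho (z u))); [apply isd_qr, Hz|exact Hq].
  - ring.
Qed.

Lemma isd_K2qr (rho : R) (z : R -> C) (t : R) (v : C) : isd z t v -> 0 < Im (qr rho (z t)) ->
  isd (fun u => K2 k0 (qr rho (z u))) t (2 * K3 k0 (qr rho (z t)) * Bf (z t) v)%C.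
Proof.
  intros Hz Hq. eapply isd_eq.
  - apply (isd_K2 k0 (fun u => qr rho (z u))); [apply isd_qr, Hz|exact Hq].
  - ring.
Qed.

Lemma isd_G1 (rho : R) (z w : R -> C) (t : R) (v w' : C) : isd z t v -> isd w t w' -> 0 < Im (qr rho (z t)) ->
  isd (fun u => G1 rho (z u) (w u)) t (G2 rho (z t) v (w t) w').
Proof.
  intros Hz Hw Hq. unfold G1. eapply isd_eq.
  - apply isd_mult; [apply isd_scal, isd_K1qr; eassumption|apply isd_Bf; eassumption].
  - unfold G2. ring.
Qed.

Lemma Bf_minus_r (z v w : C) : Bf z (v - w) = (Bf z v - Bf z w)%C.
Proof. unfold Bf. simpl. rewrite !Rmult_plus_distr_l, !RtoC_plus, <- !Ropp_mult_distr_r, !RtoC_opp. ring. Qed.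

Lemma G1_minus (rho : R) (z v w : C) : G1 rho z (v - w) = (G1 rho z v - G1 rho z w)%C.
Proof. unfold G1. rewrite Bf_minus_r. ring. Qed.

Definition MQ (M : R) : R := EQ * M ^ 2 + 1.

Lemma Cmod_qr_MQ (M rho : R) (z : C) : Cmod z <= M -> 0 <= rho <= 1 -> Cmod (qr rho z) <= MQ M.
Proof.
  intros Hz Hr. eapply Rle_trans; [apply Cmod_qr_le|]. unfold MQ.
  assert (A := Cmod_ge_0 z). assert (B := EQ_pos).
  assert (Cmod z ^ 2 <= M ^ 2) by (apply pow_incr; lra).
  assert (rho ^ 2 <= 1). { replace 1 with (1 ^ 2) by ring. apply pow_incr; lra. }
  assert (EQ * Cmod z ^ 2 <= EQ * M ^ 2) by (apply Rmult_le_compat_l; lra). lra.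
Qed.

Lemma Rdiv_le_weaken (K K' x y : R) : K <= K' -> 0 <= K' -> 0 < x <= y -> K / y <= K' / x.
Proof.
  intros H1' H2' H. apply Rle_trans with (K' / y).
  - apply Rmult_le_compat_r; [apply Rlt_le, Rinv_0_lt_compat; lra|lra].
  - apply Rmult_le_compat_l; auto. apply Rinv_le_contravar; lra.
Qed.

(** Adding rho^2 can only increase Im [qr], so one constant serves the kernel and all its
    regularizations with rho in [0, 1]. *)
Lemma K1_qr_bound (M : R) : exists K, 0 < K /\ forall (rho : R) (z : C), 0 <= rho <= 1 -> z <> RtoC 0 -> Cmod z <= M ->
  Cmod (K1 k0 (qr rho z)) <= K / Cmod z ^ 2.
Proof.
  destruct (K1_bound k0 (MQ M)) as [K H]. assert (c := cQ_pos).
  exists ((Rabs K + 1) / cQ). assert (KP := Rabs_pos K). split; [apply Rdiv_lt_0_compat; lra|].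
  intros rho z Hr Hz HM. assert (P := proj1 (Cmod_gt_0 z) Hz).
  assert (P2 : 0 < Cmod z ^ 2) by now apply pow_lt.
  eapply Rle_trans; [apply H; [apply Im_qr_pos; lra|now apply Cmod_qr_MQ]|].
  replace ((Rabs K + 1) / cQ / Cmod z ^ 2) with ((Rabs K + 1) / (cQ * Cmod z ^ 2)) by (field; lra).
  apply Rdiv_le_weaken; [assert (A := Rle_abs K); lra|lra|]. split; [now apply Rmult_lt_0_compat|].
  eapply Rle_trans; [|apply Cmod_qr_ge]. apply Rmult_le_compat_l; [lra|]. assert (A := pow2_ge_0 rho). lra.
Qed.

Lemma K2_qr_bound (M : R) : exists K, 0 < K /\ forall (rho : R) (z : C), 0 <= rho <= 1 -> z <> RtoC 0 -> Cmod z <= M ->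
  Cmod (K2 k0 (qr rho z)) <= K / Cmod z ^ 4.
Proof.
  destruct (K2_bound k0 (MQ M)) as [K H]. assert (c := cQ_pos).
  exists ((Rabs K + 1) / cQ ^ 2). assert (KP := Rabs_pos K). split; [apply Rdiv_lt_0_compat; [lra|now apply pow_lt]|].
  intros rho z Hr Hz HM. assert (P := proj1 (Cmod_gt_0 z) Hz).
  assert (P2 : 0 < Cmod z ^ 2) by now apply pow_lt.
  eapply Rle_trans; [apply H; [apply Im_qr_pos; lra|now apply Cmod_qr_MQ]|].
  replace ((Rabs K + 1) / cQ ^ 2 / Cmod z ^ 4) with ((Rabs K + 1) / ((cQ * Cmod z ^ 2) * (cQ * Cmod z ^ 2))) by (field; lra).
  assert (L : cQ * Cmod z ^ 2 <= Cmod (qr rho z)).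
  { eapply Rle_trans; [|apply Cmod_qr_ge]. apply Rmult_le_compat_l; [lra|]. assert (A := pow2_ge_0 rho). lra. }
  assert (0 < cQ * Cmod z ^ 2) by now apply Rmult_lt_0_compat.
  apply Rdiv_le_weaken; [assert (A := Rle_abs K); lra|lra|]. split; [nra|]. apply Rmult_le_compat; lra.
Qed.

Lemma K3_qr_bound (M : R) : exists K, 0 < K /\ forall (rho : R) (z : C), 0 <= rho <= 1 -> z <> RtoC 0 -> Cmod z <= M ->
  Cmod (K3 k0 (qr rho z)) <= K / Cmod z ^ 6.
Proof.
  destruct (K3_bound k0 (MQ M)) as [K H]. assert (c := cQ_pos).
  exists ((Rabs K + 1) / cQ ^ 3). assert (KP := Rabs_pos K). split; [apply Rdiv_lt_0_compat; [lra|now apply pow_lt]|].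
  intros rho z Hr Hz HM. assert (P := proj1 (Cmod_gt_0 z) Hz).
  assert (P2 : 0 < Cmod z ^ 2) by now apply pow_lt.
  eapply Rle_trans; [apply H; [apply Im_qr_pos; lra|now apply Cmod_qr_MQ]|].
  replace ((Rabs K + 1) / cQ ^ 3 / Cmod z ^ 6) with ((Rabs K + 1) / ((cQ * Cmod z ^ 2) * (cQ * Cmod z ^ 2) * (cQ * Cmod z ^ 2))) by (field; lra).
  assert (L : cQ * Cmod z ^ 2 <= Cmod (qr rho z)).
  { eapply Rle_trans; [|apply Cmod_qr_ge]. apply Rmult_le_compat_l; [lra|]. assert (A := pow2_ge_0 rho). lra. }
  assert (X : 0 < cQ * Cmod z ^ 2) by now apply Rmult_lt_0_compat.
  assert (Y : 0 < cQ * Cmod z ^ 2 * (cQ * Cmod z ^ 2)) by now apply Rmult_lt_0_compat.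
  apply Rdiv_le_weaken; [assert (A := Rle_abs K); lra|lra|]. split; [now apply Rmult_lt_0_compat|].
  apply Rmult_le_compat; try lra. apply Rmult_le_compat; lra.
Qed.

Lemma G1_bound (M : R) : exists K, 0 < K /\ forall (rho : R) (z v : C), 0 <= rho <= 1 -> z <> RtoC 0 -> Cmod z <= M ->
  Cmod (G1 rho z v) <= K * Cmod v / Cmod z.
Proof.
  destruct (K1_qr_bound M) as [K [HK H]]. assert (E := EQ_pos).
  exists (2 * K * EQ). split; [nra|]. intros rho z v Hr Hz HM. assert (P := proj1 (Cmod_gt_0 z) Hz).
  replace (2 * K * EQ * Cmod v / Cmod z) with (2 * (K / Cmod z ^ 2) * (EQ * (Cmod z * Cmod v))) by (field; lra).
  unfold G1. repeat apply Cmod_mult_le; [rewrite Cmod_R, Rabs_pos_eq; lra|now apply H|apply Cmod_Bf_le].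
Qed.

Lemma G2_bound (M : R) : exists K, 0 < K /\ forall (rho : R) (z v w w' : C), 0 <= rho <= 1 -> z <> RtoC 0 -> Cmod z <= M ->
  Cmod (G2 rho z v w w') <= K * (Cmod v * Cmod w / Cmod z ^ 2 + Cmod w' / Cmod z).
Proof.
  destruct (K1_qr_bound M) as [K [HK H]]. destruct (K2_qr_bound M) as [K' [HK' H']]. assert (E := EQ_pos).
  exists (4 * K' * EQ ^ 2 + 2 * K * EQ). split; [nra|]. intros rho z v w w' Hr Hz HM. assert (P := proj1 (Cmod_gt_0 z) Hz).
  apply Rle_trans with (4 * (K' / Cmod z ^ 4) * (EQ * (Cmod z * Cmod v)) * (EQ * (Cmod z * Cmod w))
    + 2 * (K / Cmod z ^ 2) * (EQ * (Cmod v * Cmod w) + EQ * (Cmod z * Cmod w'))).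
  - unfold G2. apply Cmod_plus_le.
    + repeat apply Cmod_mult_le; try apply Cmod_Bf_le; [rewrite Cmod_R, Rabs_pos_eq; lra|now apply H'].
    + apply Cmod_mult_le; [apply Cmod_mult_le; [rewrite Cmod_R, Rabs_pos_eq; lra|now apply H]|].
      apply Cmod_plus_le; apply Cmod_Bf_le.
  - assert (V := Cmod_ge_0 v). assert (W := Cmod_ge_0 w). assert (W' := Cmod_ge_0 w').
    set (X := Cmod v * Cmod w / Cmod z ^ 2). set (Y := Cmod w' / Cmod z).
    assert (HX : 0 <= X) by (apply Rdiv_le_0_compat; [nra|now apply pow_lt]).
    assert (HY : 0 <= Y) by (apply Rdiv_le_0_compat; lra).
    replace (4 * (K' / Cmod z ^ 4) * (EQ * (Cmod z * Cmod v)) * (EQ * (Cmod z * Cmod w))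
    + 2 * (K / Cmod z ^ 2) * (EQ * (Cmod v * Cmod w) + EQ * (Cmod z * Cmod w')))
    with (4 * K' * EQ ^ 2 * X + 2 * K * EQ * (X + Y)) by (unfold X, Y; field; lra).
    clearbody X Y. assert (0 <= 4 * K' * EQ ^ 2 * Y); [|lra]. assert (0 < EQ ^ 2) by now apply pow_lt.
    repeat apply Rmult_le_pos; lra.
Qed.

Lemma isd_vertical (z : C) (t : R) : isd (fun u => Qf z + Ci * RtoC u)%C t Ci.
Proof.
  eapply isd_eq; [apply isd_plus; [apply isd_const|apply isd_scal, isd_id]|]. ring.
Qed.

Lemma vertical_qr (z : C) (u : R) : 0 <= u -> (Qf z + Ci * RtoC u)%C = qr (sqrt u) z.
Proof. intros Hu. unfold qr. now rewrite pow2_sqrt. Qed.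

(** Mean value bound in the variable u = rho^2 along the vertical segment Q(z) + i u, which stays in
    the upper half-plane; hence the quadratic rate in rho. *)
Lemma G0_rho_bound (M : R) : exists K, 0 < K /\ forall (rho : R) (z : C), 0 <= rho <= 1 -> z <> RtoC 0 -> Cmod z <= M ->
  Cmod (G0 rho z - G0 0 z) <= K * rho ^ 2 / Cmod z ^ 2.
Proof.
  destruct (K1_qr_bound M) as [K [HK H]]. exists K. split; auto. intros rho z Hr Hz HM.
  assert (P := proj1 (Cmod_gt_0 z) Hz). assert (R2 := pow2_ge_0 rho).
  assert (R1 : rho ^ 2 <= 1). { replace 1 with (1 ^ 2) by ring. apply pow_incr; lra. }
  replace (K * rho ^ 2 / Cmod z ^ 2) with (K / Cmod z ^ 2 * (rho ^ 2 - 0)) by (field; lra).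
  replace (G0 0 z) with (K0 k0 (Qf z + Ci * RtoC 0)) by (unfold G0, qr; now replace (0 ^ 2) with 0 by ring).
  apply (mvt_C (fun u => K0 k0 (Qf z + Ci * RtoC u)) (fun u => K1 k0 (Qf z + Ci * RtoC u) * Ci)%C); auto.
  intros t Ht. assert (S1 : sqrt t <= 1) by (rewrite <- sqrt_1; apply sqrt_le_1_alt; lra).
  assert (S0 := sqrt_pos t). split.
  - apply (isd_K0 k0 (fun u => Qf z + Ci * RtoC u)%C); [apply isd_vertical|].
    rewrite vertical_qr by lra. apply Im_qr_pos; lra.
  - rewrite Cmod_mult, Cmod_Ci, Rmult_1_r, vertical_qr by lra. apply H; auto.
Qed.

Lemma G1_rho_bound (M : R) : exists K, 0 < K /\ forall (rho : R) (z v : C), 0 <= rho <= 1 -> z <> RtoC 0 -> Cmod z <= M ->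
  Cmod (G1 rho z v - G1 0 z v) <= K * rho ^ 2 * Cmod v / Cmod z ^ 3.
Proof.
  destruct (K2_qr_bound M) as [K [HK H]]. assert (E := EQ_pos).
  exists (2 * K * EQ). split; [nra|]. intros rho z v Hr Hz HM.
  assert (P := proj1 (Cmod_gt_0 z) Hz). assert (R2 := pow2_ge_0 rho).
  assert (R1 : rho ^ 2 <= 1). { replace 1 with (1 ^ 2) by ring. apply pow_incr; lra. }
  unfold G1.
  replace (2 * K1 k0 (qr rho z) * Bf z v - 2 * K1 k0 (qr 0 z) * Bf z v)%C with
    (2 * (K1 k0 (qr rho z) - K1 k0 (qr 0 z)) * Bf z v)%C by ring.
  replace (2 * K * EQ * rho ^ 2 * Cmod v / Cmod z ^ 3) with
    (2 * (K / Cmod z ^ 4 * (rho ^ 2 - 0)) * (EQ * (Cmod z * Cmod v))) by (field; lra).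
  apply Cmod_mult_le; [|apply Cmod_Bf_le]. apply Cmod_mult_le; [rewrite Cmod_R, Rabs_pos_eq; lra|].
  replace (qr 0 z) with (Qf z + Ci * RtoC 0)%C by (unfold qr; now replace (0 ^ 2) with 0 by ring).
  apply (mvt_C (fun u => K1 k0 (Qf z + Ci * RtoC u)) (fun u => K2 k0 (Qf z + Ci * RtoC u) * Ci)%C); auto.
  intros t Ht. assert (S1 : sqrt t <= 1) by (rewrite <- sqrt_1; apply sqrt_le_1_alt; lra).
  assert (S0 := sqrt_pos t). split.
  - apply (isd_K1 k0 (fun u => Qf z + Ci * RtoC u)%C); [apply isd_vertical|].
    rewrite vertical_qr by lra. apply Im_qr_pos; lra.
  - rewrite Cmod_mult, Cmod_Ci, Rmult_1_r, vertical_qr by lra. apply H; auto.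
Qed.

(** |z|^2 + rho^2 >= (|z| + rho)^2 / 2, so |z| + rho plays the role of a regularized distance. *)
Lemma sqrt2_qr_ge (rho : R) (z : C) : 0 <= rho ->
  sqrt (sqrt (cQ / 2)) * sqrt (Cmod z + rho) <= sqrt (sqrt (Cmod (qr rho z))).
Proof.
  intros Hr. assert (c := cQ_pos). assert (A := Cmod_ge_0 z).
  rewrite <- (sqrt_pow2 (Cmod z + rho)) at 1 by lra.
  rewrite <- !sqrt_mult; try apply sqrt_pos; try apply pow2_ge_0; try lra.
  do 2 apply sqrt_le_1_alt. eapply Rle_trans; [|apply Cmod_qr_ge].
  assert (B := pow2_ge_0 (Cmod z - rho)). nra.
Qed.

Lemma G0_bound (M : R) : exists K, 0 < K /\ forall (rho : R) (z : C), 0 <= rho <= 1 -> 0 < Cmod z + rho -> Cmod z <= M ->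
  Cmod (G0 rho z) <= K / sqrt (Cmod z + rho).
Proof.
  destruct (K0_bound k0 (MQ M)) as [K H]. assert (c := cQ_pos).
  set (s := sqrt (sqrt (cQ / 2))). assert (Hs : 0 < s) by (unfold s; do 2 apply sqrt_lt_R0; lra).
  assert (KP := Rabs_pos K).
  exists ((Rabs K + 1) / s). split; [apply Rdiv_lt_0_compat; lra|]. intros rho z Hr HP HM.
  assert (P := sqrt_lt_R0 _ HP).
  eapply Rle_trans; [apply H; [apply Im_qr_pos; lra|now apply Cmod_qr_MQ]|].
  replace ((Rabs K + 1) / s / sqrt (Cmod z + rho)) with ((Rabs K + 1) / (s * sqrt (Cmod z + rho))) by (field; lra).
  apply Rdiv_le_weaken; [assert (A := Rle_abs K); lra|lra|]. split; [now apply Rmult_lt_0_compat|].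
  apply sqrt2_qr_ge; lra.
Qed.

(** A scale-free bound: after division by d^2 only the ratio d / (|z| + rho) remains, and no ln d is
    lost as d tends to 0. *)
Lemma ln_qr_scaled : exists K, 0 < K /\ forall (rho d : R) (z : C), 0 < rho <= d -> Cmod z <= 3 * d ->
  Rabs (ln (Cmod (qr rho z) / d ^ 2)) <= K * (1 + sqrt (d / (Cmod z + rho))).
Proof.
  set (s := sqrt (sqrt (cQ / 2))). assert (c := cQ_pos).
  assert (Hs : 0 < s) by (unfold s; do 2 apply sqrt_lt_R0; lra).
  (* From |z| <= 3 d and rho <= d one gets |q| / d^2 <= 9 [EQ] + 1. *)
  set (m := sqrt (sqrt (EQ * 9 + 1))). assert (Hm : 0 <= m) by apply sqrt_pos.
  exists (4 * (m + / s + 1)). assert (Hi := Rinv_0_lt_compat s Hs). split; [lra|].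
  intros rho d z Hr Hz. assert (A := Cmod_ge_0 z). assert (D2 : 0 < d ^ 2) by (apply pow_lt; lra).
  assert (PI' := Im_qr_pos rho z ltac:(lra) ltac:(lra)). assert (P := Cmod_pos_of_Im _ PI').
  set (x := Cmod (qr rho z) / d ^ 2). assert (Hx : 0 < x) by now apply Rdiv_lt_0_compat.
  eapply Rle_trans; [now apply ln_abs_root|].
  assert (U : sqrt (sqrt x) <= m).
  { unfold m. do 2 apply sqrt_le_1_alt. unfold x. apply Rle_div_l; [lra|].
    eapply Rle_trans; [apply Cmod_qr_le|]. assert (E := EQ_pos).
    assert (Cmod z ^ 2 <= (3 * d) ^ 2) by (apply pow_incr; lra).
    assert (rho ^ 2 <= d ^ 2) by (apply pow_incr; lra).
    assert (EQ * Cmod z ^ 2 <= EQ * (3 * d) ^ 2) by (apply Rmult_le_compat_l; lra). nra. }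
  assert (HZ : 0 < (Cmod z + rho) / d) by (apply Rdiv_lt_0_compat; lra).
  assert (SZ := sqrt_lt_R0 _ HZ).
  assert (V : s * sqrt ((Cmod z + rho) / d) <= sqrt (sqrt x)).
  { assert (V := sqrt2_qr_ge rho z ltac:(lra)). fold s in V.
    assert (E1 : sqrt (sqrt x) = sqrt (sqrt (Cmod (qr rho z))) / sqrt d).
    { unfold x. rewrite sqrt_div_alt by lra. rewrite sqrt_pow2 by lra. rewrite sqrt_div_alt by lra. reflexivity. }
    rewrite E1, sqrt_div_alt by lra. assert (SD := sqrt_lt_R0 d ltac:(lra)).
    unfold Rdiv. rewrite <- Rmult_assoc. apply Rmult_le_compat_r; [apply Rlt_le, Rinv_0_lt_compat; lra|auto]. }
  assert (W : / sqrt (sqrt x) <= / s * sqrt (d / (Cmod z + rho))).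
  { replace (d / (Cmod z + rho)) with (/ ((Cmod z + rho) / d)) by (field; lra).
    rewrite sqrt_inv, <- Rinv_mult. apply Rinv_le_contravar; auto. now apply Rmult_lt_0_compat. }
  assert (T := sqrt_pos (d / (Cmod z + rho))).
  assert (0 <= m * sqrt (d / (Cmod z + rho))) by now apply Rmult_le_pos. nra.
Qed.

(** The terms ln d^2 of the two points cancel in the difference. Without this cancellation the inner
    interval of [tangential_estimate] would cost |ln d| times the oscillation of the density, which
    need not tend to 0. The radius 3 d covers targets moved by d and parameters up to 2 d away. *)
Lemma G0_log_diff : exists K, 0 < K /\ forall (rho d : R) (a b : C), 0 < rho <= d -> d <= 1 -> Cmod a <= 3 * d -> Cmod b <= 3 * d ->
  Cmod (G0 rho a - G0 rho b) <= K * (1 + sqrt (d / (Cmod a + rho)) + sqrt (d / (Cmod b + rho))).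
Proof.
  destruct (K0_near_log k0 (MQ 3)) as [A [HA B]]. destruct ln_qr_scaled as [K [HK H]]. assert (PP := PI_RGT_0).
  assert (XP := Cmod_ge_0 cP).
  exists (2 * A + Cmod cP * (2 * K + PI) + 1). split; [nra|].
  intros rho d a b Hr Hd Ha Hb. assert (Na := Cmod_ge_0 a). assert (Nb := Cmod_ge_0 b).
  assert (Ia := Im_qr_pos rho a ltac:(lra) ltac:(lra)). assert (Ib := Im_qr_pos rho b ltac:(lra) ltac:(lra)).
  assert (Ba := B _ Ia (Cmod_qr_MQ 3 rho a ltac:(lra) ltac:(lra))).
  assert (Bb := B _ Ib (Cmod_qr_MQ 3 rho b ltac:(lra) ltac:(lra))).
  specialize (H rho d). assert (La := H a Hr Ha). assert (Lb := H b Hr Hb).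
  assert (D2 : 0 < d ^ 2) by (apply pow_lt; lra).
  assert (Pa := Cmod_pos_of_Im _ Ia). assert (Pb := Cmod_pos_of_Im _ Ib).
  unfold Rdiv in La, Lb. rewrite ln_mult in La, Lb by (auto; now apply Rinv_0_lt_compat).
  set (qa := qr rho a) in *. set (qb := qr rho b) in *.
  fold (d / (Cmod a + rho)) in La. fold (d / (Cmod b + rho)) in Lb.
  set (sa := sqrt (d / (Cmod a + rho))) in *. set (sb := sqrt (d / (Cmod b + rho))) in *.
  assert (Sa : 0 <= sa) by apply sqrt_pos. assert (Sb : 0 <= sb) by apply sqrt_pos.
  assert (LL : Cmod (Clog qa - Clog qb) <= K * (2 + sa + sb) + PI).
  { eapply Rle_trans; [apply Cmod_le_abs|]. simpl. assert (Ca := Carg_bound _ Ia). assert (Cb := Carg_bound _ Ib).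
    apply Rplus_le_compat.
    - apply Rabs_le_between in La. apply Rabs_le_between in Lb. apply Rabs_le. nra.
    - apply Rabs_le. lra. }
  unfold G0. fold qa qb.
  replace (K0 k0 qa - K0 k0 qb)%C with ((K0 k0 qa - cP * Clog qa) - (K0 k0 qb - cP * Clog qb) + cP * (Clog qa - Clog qb))%C by ring.
  apply Rle_trans with ((A + A) + Cmod cP * (K * (2 + sa + sb) + PI)).
  - apply Cmod_plus_le; [now apply Cmod_minus_le|]. now apply Cmod_mult_le; [lra|].
  - assert (0 <= (2 * A + 1) * (sa + sb)) by (apply Rmult_le_pos; lra).
    assert (X1 : 0 <= PI * (sa + sb)) by (apply Rmult_le_pos; lra).
    assert (X2 := Rmult_le_pos _ _ XP X1).
    assert (X3 : 0 <= K * (sa + sb)) by (apply Rmult_le_pos; lra).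
    assert (X4 := Rmult_le_pos _ _ XP X3). nra.
Qed.
End Kernel.

(** * Chord-arc estimates *)

Lemma ccont_min_pos (f : R -> C) (a b : R) : a <= b -> cont_on f a b -> (forall t, a <= t <= b -> f t <> RtoC 0) ->
  exists m, 0 < m /\ forall t, a <= t <= b -> m <= Cmod (f t).
Proof.
  intros Hab Hc Hn. destruct (continuity_ab_min (fun t => Cmod (f t)) a b Hab) as [x [Hx Hx']].
  - intros c Hc'. apply continuity_pt_filterlim. apply (cont_Cmod f c), Hc, Hc'.
  - exists (Cmod (f x)). split; auto. now apply Cmod_gt_0, Hn.
Qed.

Lemma Cmod_sub_ge (a b : C) : Cmod a - Cmod b <= Cmod (a + b).
Proof. assert (H := Cmod_triangle (a + b) (- b)). replace (a + b + - b)%C with a in H by ring. rewrite Cmod_opp in H. lra. Qed.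

Section Curve.
Variables (L : R) (gam tau dtau : R -> C).
Hypotheses (HL : 0 < L) (Hper : forall t, gam (t + L) = gam t)
  (Hsimple : forall s t, 0 <= s < L -> 0 <= t < L -> gam s = gam t -> s = t)
  (Hgam : forall t : R, isd gam t (tau t)) (Htau : forall t : R, isd tau t (dtau t))
  (Hdtau : forall t : R, ccont dtau t) (Hunit : forall t, Cmod (tau t) = 1).

Lemma periodic_IZR (A : Type) (f : R -> A) : (forall t, f (t + L) = f t) -> forall (k : Z) (t : R), f (t + IZR k * L) = f t.
Proof.
  intros H. assert (N : forall (n : nat) t, f (t + INR n * L) = f t).
  { induction n as [|n IH]; intros t; [simpl; f_equal; ring|].
    rewrite S_INR. replace (t + (INR n + 1) * L) with (t + INR n * L + L) by ring. now rewrite H. }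
  intros k t. destruct (Z_le_gt_dec 0 k) as [h|h].
  - rewrite <- (Z2Nat.id k h), <- INR_IZR_INZ. apply N.
  - rewrite <- (N (Z.to_nat (- k)) (t + IZR k * L)). f_equal.
    rewrite INR_IZR_INZ, Z2Nat.id by lia. rewrite opp_IZR. ring.
Qed.

Lemma reduce_period (t : R) : exists k : Z, 0 <= t + IZR k * L < L.
Proof.
  (* [up x] is strictly above x and at most x + 1, so [up x - 1] is the floor of x. *)
  destruct (archimed (t / L)) as [A B]. exists (1 - up (t / L))%Z. rewrite minus_IZR.
  assert (T : t = t / L * L) by (field; lra). set (x := t / L) in *. rewrite T. clearbody x.
  replace (x * L + (1 - IZR (up x)) * L) with ((x + 1 - IZR (up x)) * L) by ring.
  assert (0 <= x + 1 - IZR (up x) < 1) by lra. split; nra.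
Qed.

Lemma gam_injective (s t : R) : Rabs (s - t) < L -> gam s = gam t -> s = t.
Proof.
  intros H E. destruct (reduce_period s) as [k Hk]. destruct (reduce_period t) as [m Hm].
  assert (E' : s + IZR k * L = t + IZR m * L).
  { apply Hsimple; auto. now rewrite !(periodic_IZR _ gam Hper). }
  assert (D : s - t = IZR (m - k) * L) by (rewrite minus_IZR; lra).
  rewrite D in H. rewrite Rabs_mult, (Rabs_pos_eq L) in H by lra.
  assert (H' : Rabs (IZR (m - k)) < 1) by nra.
  rewrite <- abs_IZR in H'. apply lt_IZR in H'. assert (Z0 : (m - k = 0)%Z) by lia.
  rewrite Z0 in D. lra.
Qed.

Lemma gam_ccont (t : R) : ccont gam t.
Proof. eapply isd_ccont, Hgam. Qed.

Lemma gam_lipschitz (s t : R) : Cmod (gam t - gam s) <= Rabs (t - s).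
Proof.
  rewrite <- (Rmult_1_l (Rabs (t - s))). apply (mvt_C_abs gam tau).
  intros u _. split; [apply Hgam|]. now rewrite Hunit; right.
Qed.

Lemma curve_taylor (s : R) : exists M, 0 < M /\ forall t t', Rabs (t - s) <= 2 * L -> Rabs (t' - s) <= 2 * L ->
  Cmod (tau t - tau t') <= M * Rabs (t - t') /\ Cmod (gam t - gam t' - RtoC (t - t') * tau t') <= M * (t - t') ^ 2.
Proof.
  destruct (ccont_bounded dtau (s - 2 * L) (s + 2 * L)) as [K [HK H]]; [lra|intros; apply Hdtau|].
  exists K. split; auto. intros t t' Ht Ht'. apply Rabs_le_between in Ht. apply Rabs_le_between in Ht'.
  assert (W : forall u, Rmin t' t <= u <= Rmax t' t -> Cmod (dtau u) <= K).
  { intros u Hu. apply H. revert Hu. unfold Rmin, Rmax. destruct Rle_dec; lra. }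
  split.
  - apply (mvt_C_abs tau dtau). intros u Hu. split; [apply Htau|now apply W].
  - apply (taylor_C gam tau dtau). intros u Hu. split; [apply Hgam|split; [apply Htau|now apply W]].
Qed.

(** Injectivity and compactness. The window 3 L / 4 is larger than the half period plus the later
    displacement of the base point, yet below L, where the curve closes up. *)
Lemma gam_far (s eta : R) : 0 < eta < 3 * L / 4 -> exists m, 0 < m /\ forall t, eta <= Rabs (t - s) <= 3 * L / 4 -> m <= Cmod (gam s - gam t).
Proof.
  intros He.
  assert (Hc : forall a b, cont_on (fun t => gam s - gam t)%C a b).
  { intros a b t _. apply ccont_minus; [apply ccont_const|apply gam_ccont]. }
  assert (Hn : forall t, eta <= Rabs (t - s) <= 3 * L / 4 -> (gam s - gam t)%C <> RtoC 0).
  { intros t Ht E. assert (E' : gam s = gam t) by (rewrite <- (Cplus_0_r (gam t)), <- E; ring).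
    apply gam_injective in E'; [|rewrite Rabs_minus_sym; lra]. subst t. rewrite Rminus_diag, Rabs_R0 in Ht. lra. }
  destruct (ccont_min_pos (fun t => gam s - gam t)%C (s + eta) (s + 3 * L / 4)) as [m1 [P1 Q1]]; [lra|apply Hc| |].
  { intros t Ht. apply Hn. rewrite Rabs_pos_eq; lra. }
  destruct (ccont_min_pos (fun t => gam s - gam t)%C (s - 3 * L / 4) (s - eta)) as [m2 [P2 Q2]]; [lra|apply Hc| |].
  { intros t Ht. apply Hn. rewrite Rabs_left1; lra. }
  exists (Rmin m1 m2). split; [now apply Rmin_pos|]. intros t Ht.
  assert (A1 := Rmin_l m1 m2). assert (A2 := Rmin_r m1 m2).
  destruct (Rle_dec 0 (t - s)) as [h|h].
  - rewrite Rabs_pos_eq in Ht by lra. specialize (Q1 t ltac:(lra)). lra.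
  - rewrite Rabs_left in Ht by lra. specialize (Q2 t ltac:(lra)). lra.
Qed.

(** For close parameters the Taylor expansion gives |u| - M u^2 >= |u| / 2 once |u| <= 1/(2M).
    Otherwise [gam_far] at the fixed base point [s] applies, and moving the base point by at most d0
    is paid for by half of [m]. *)
Lemma chord_arc (s : R) : exists c d0, 0 < c /\ 0 < d0 <= L / 8 /\ forall r t, Rabs r <= d0 -> Rabs (t - s) <= L / 2 + d0 ->
  c * Rabs (s + r - t) <= Cmod (gam (s + r) - gam t).
Proof.
  destruct (curve_taylor s) as [M [HM T]].
  set (eta := Rmin (/ (2 * M)) (L / 8)).
  assert (E1 : eta <= / (2 * M)) by apply Rmin_l. assert (E2 : eta <= L / 8) by apply Rmin_r.
  assert (E3 : 0 < eta). { apply Rmin_pos; [apply Rinv_0_lt_compat; lra|lra]. }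
  destruct (gam_far s (eta / 2)) as [m [Hm Hfar]]; [lra|].
  (* eta / 2 keeps t away from s when it is away from s + r; m / 2 absorbs the displacement of the
     base point. *)
  set (d0 := Rmin (eta / 2) (m / 2)).
  assert (D1 : d0 <= eta / 2) by apply Rmin_l. assert (D2 : d0 <= m / 2) by apply Rmin_r.
  assert (D3 : 0 < d0) by (apply Rmin_pos; lra).
  exists (Rmin (1 / 2) (m / (2 * L))), d0.
  assert (C1 := Rmin_l (1 / 2) (m / (2 * L))). assert (C2 := Rmin_r (1 / 2) (m / (2 * L))).
  assert (C0 : 0 < Rmin (1 / 2) (m / (2 * L))) by (apply Rmin_pos; [lra|apply Rdiv_lt_0_compat; lra]).
  split; auto. split; [lra|].
  set (c := Rmin (1 / 2) (m / (2 * L))) in *.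
  intros r t Hr Ht. set (u := s + r - t). assert (Hu := Rabs_pos u).
  destruct (Rle_dec (Rabs u) eta) as [h|h].
  - destruct (T (s + r) t) as [_ T2].
    { replace (s + r - s) with r by ring. lra. } { lra. }
    fold u in T2.
    assert (A := Cmod_sub_ge (RtoC u * tau t) (gam (s + r) - gam t - RtoC u * tau t)).
    replace (RtoC u * tau t + (gam (s + r) - gam t - RtoC u * tau t))%C with (gam (s + r) - gam t)%C in A by ring.
    rewrite Cmod_mult, Cmod_R, Hunit in A.
    assert (B : M * u ^ 2 <= / 2 * Rabs u).
    { rewrite <- (pow2_abs u). replace (M * Rabs u ^ 2) with (M * Rabs u * Rabs u) by ring.
      apply Rmult_le_compat_r; auto. apply Rle_trans with (M * / (2 * M)); [apply Rmult_le_compat_l; lra|].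
      right; field; lra. }
    assert (c * Rabs u <= 1 / 2 * Rabs u) by (apply Rmult_le_compat_r; lra). lra.
  - assert (A1 : eta / 2 <= Rabs (t - s)).
    { assert (X := Rabs_triang (t - s) (- r)). rewrite Rabs_Ropp in X.
      replace (t - s + - r) with (- u) in X by (unfold u; ring). rewrite Rabs_Ropp in X. lra. }
    assert (Hf := Hfar t ltac:(lra)).
    assert (A := Cmod_sub_ge (gam s - gam t) (gam (s + r) - gam s)).
    replace (gam s - gam t + (gam (s + r) - gam s))%C with (gam (s + r) - gam t)%C in A by ring.
    assert (B := gam_lipschitz s (s + r)). replace (s + r - s) with r in B by ring.
    assert (U : Rabs u <= L).
    { assert (X := Rabs_triang r (- (t - s))). rewrite Rabs_Ropp in X.
      replace (r + - (t - s)) with u in X by (unfold u; ring). lra. }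
    assert (c * Rabs u <= m / (2 * L) * L) by (apply Rmult_le_compat; lra).
    replace (m / (2 * L) * L) with (m / 2) in H by (field; lra). lra.
Qed.

(** To first order the difference is h nu - u tau with orthogonal unit vectors, so its modulus is
    the square root of h^2 + u^2, at least (|h| + |u|) / 2; curvature costs at most |u| / 4. The
    hypothesis on [tau s] says that the tangent is the normal turned by a right angle. *)
Lemma chord_normal (s : R) (nus : C) : tau s = (Ci * nus)%C -> exists c d0, 0 < c /\ 0 < d0 <= 1 /\
  forall h t, Rabs h <= d0 -> Rabs (t - s) <= L / 2 ->
  c * (Rabs (t - s) + Rabs h) <= Cmod (gam s + RtoC h * nus - gam t).
Proof.
  intros Hnu. assert (Unu : Cmod nus = 1).
  { rewrite <- (Hunit s), Hnu, Cmod_mult, Cmod_Ci. ring. }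
  destruct (curve_taylor s) as [M [HM T]].
  set (eta := Rmin (/ (4 * M)) (L / 8)).
  assert (E1 : eta <= / (4 * M)) by apply Rmin_l. assert (E2 : eta <= L / 8) by apply Rmin_r.
  assert (E3 : 0 < eta). { apply Rmin_pos; [apply Rinv_0_lt_compat; lra|lra]. }
  destruct (gam_far s eta) as [m [Hm Hfar]]; [lra|].
  set (d0 := Rmin 1 (Rmin (L / 2) (m / 2))).
  assert (D0 : d0 <= 1) by apply Rmin_l.
  assert (D1 : d0 <= L / 2) by (eapply Rle_trans; [apply Rmin_r|apply Rmin_l]).
  assert (D2 : d0 <= m / 2) by (eapply Rle_trans; [apply Rmin_r|apply Rmin_r]).
  assert (D3 : 0 < d0) by (repeat apply Rmin_pos; lra).
  exists (Rmin (1 / 4) (m / (2 * L))), d0.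
  assert (C1 := Rmin_l (1 / 4) (m / (2 * L))). assert (C2 := Rmin_r (1 / 4) (m / (2 * L))).
  assert (C0 : 0 < Rmin (1 / 4) (m / (2 * L))) by (apply Rmin_pos; [lra|apply Rdiv_lt_0_compat; lra]).
  split; auto. split; [lra|].
  set (c := Rmin (1 / 4) (m / (2 * L))) in *.
  intros h t Hh Ht. set (u := t - s) in *. assert (Hu := Rabs_pos u). assert (Hh0 := Rabs_pos h).
  destruct (Rle_dec (Rabs u) eta) as [k|k].
  - destruct (T t s) as [_ T2]; [fold u; lra|rewrite Rminus_diag, Rabs_R0; lra|]. fold u in T2.
    assert (A := Cmod_sub_ge (RtoC h * nus - RtoC u * tau s) (- (gam t - gam s - RtoC u * tau s))).
    replace (RtoC h * nus - RtoC u * tau s + - (gam t - gam s - RtoC u * tau s))%C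
      with (gam s + RtoC h * nus - gam t)%C in A by ring.
    rewrite Cmod_opp in A.
    assert (N : (Rabs u + Rabs h) / 2 <= Cmod (RtoC h * nus - RtoC u * tau s)).
    { rewrite Hnu. replace (RtoC h * nus - RtoC u * (Ci * nus))%C with (nus * (h, (- u)%R))%C.
      - rewrite Cmod_mult, Unu, Rmult_1_l. unfold Cmod. simpl fst. simpl snd.
        rewrite <- (sqrt_pow2 ((Rabs u + Rabs h) / 2)) by lra. apply sqrt_le_1_alt.
        rewrite <- (pow2_abs h), <- (pow2_abs (- u)), Rabs_Ropp.
        assert (Q := pow2_ge_0 (Rabs u - Rabs h)). assert (Q1 := pow2_ge_0 (Rabs u)). assert (Q2 := pow2_ge_0 (Rabs h)). nra.
      - destruct nus as [a b]. apply injective_projections; simpl; ring. }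
    assert (B : M * u ^ 2 <= / 4 * Rabs u).
    { rewrite <- (pow2_abs u). replace (M * Rabs u ^ 2) with (M * Rabs u * Rabs u) by ring.
      apply Rmult_le_compat_r; auto. apply Rle_trans with (M * / (4 * M)); [apply Rmult_le_compat_l; lra|].
      right; field; lra. }
    assert (c * (Rabs u + Rabs h) <= 1 / 4 * (Rabs u + Rabs h)) by (apply Rmult_le_compat_r; lra). lra.
  - assert (Hf := Hfar t ltac:(fold u; lra)).
    assert (A := Cmod_sub_ge (gam s - gam t) (RtoC h * nus)).
    replace (gam s - gam t + RtoC h * nus)%C with (gam s + RtoC h * nus - gam t)%C in A by ring.
    rewrite Cmod_mult, Cmod_R, Unu in A.
    assert (c * (Rabs u + Rabs h) <= m / (2 * L) * L) by (apply Rmult_le_compat; lra).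
    replace (m / (2 * L) * L) with (m / 2) in H by (field; lra). lra.
Qed.
End Curve.

(** * Tangential and normal limits of single layers *)

Lemma CI_dom (f : R -> C) (g : R -> R) (a b : R) : a <= b -> cont_on f a b -> cont_on (fun t => RtoC (g t)) a b ->
  (forall t, a <= t <= b -> Cmod (f t) <= g t) -> Cmod (CI f a b) <= Cmod (CI (fun t => RtoC (g t)) a b).
Proof.
  intros Hab Hf Hg H.
  apply Rle_trans with (fst (CI (fun t => RtoC (g t)) a b)).
  - rewrite <- norm_Cmod. apply (norm_RInt_le (V := C_R_NormedModule) f g a b); auto.
    + intros x Hx. rewrite norm_Cmod. now apply H.
    + now apply CI_correct.
    + apply (isI_fst (fun t => RtoC (g t))). now apply CI_correct.
  - eapply Rle_trans; [apply Rle_abs|apply fst_le_Cmod].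
Qed.

Lemma ccont_RtoC (g : R -> R) (t : R) : continuous g t -> ccont (fun u => RtoC (g u)) t.
Proof.
  intros H. apply ccont_eps. intros eps He.
  destruct (proj1 (filterlim_locally_ball_norm (K := R_AbsRing) (U := R_NormedModule) g (g t)) H (mkposreal eps He)) as [d Hd].
  exists d; split; [apply cond_pos|]. intros u Hu. rewrite <- RtoC_minus, Cmod_R. apply (Hd u Hu).
Qed.

(** Two singular points because a difference of kernels with targets s + delta and s is nearly
    singular at both. *)
Lemma CI_bound_sqrt2 (f : R -> C) (a b p q h A B : R) : a <= p <= b -> a <= q <= b -> 0 <= A -> 0 <= B -> 0 < h ->
  cont_on f a b ->
  (forall t, a <= t <= b -> Cmod (f t) <= A + B / sqrt (Rabs (t - p) + h) + B / sqrt (Rabs (t - q) + h)) ->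
  Cmod (CI f a b) <= A * (b - a) + 8 * B * sqrt (b - a).
Proof.
  intros Hp Hq HA HB Hh Hc H.
  assert (S : forall x u, 0 < sqrt (Rabs (u - x) + h)).
  { intros x u. apply sqrt_lt_R0. assert (Y := Rabs_pos (u - x)). lra. }
  assert (D : forall x u v, cont_on (fun t => RtoC (B / sqrt (Rabs (t - x) + h))) u v).
  { intros x u v t _. apply ccont_RtoC.
    apply (continuous_mult (K := R_AbsRing) (fun _ => B)); [apply continuous_const|].
    apply (continuous_Rinv_comp (fun t => sqrt (Rabs (t - x) + h))); [|assert (Y := S x t); lra].
    apply continuous_sqrt_comp. apply (continuous_plus (V := R_NormedModule)); [|apply continuous_const].
    apply continuous_Rabs_comp. apply (continuous_minus (V := R_NormedModule)); [apply continuous_id|apply continuous_const]. }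
  assert (B1 : forall x, a <= x <= b -> Cmod (CI (fun t => RtoC (B / sqrt (Rabs (t - x) + h))) a b) <= 4 * B * sqrt (b - a)).
  { intros x Hx. apply CI_bound_sqrt_abs with (p := x) (h := h); auto.
    intros t Ht. rewrite Cmod_R, Rabs_pos_eq; [lra|]. apply Rdiv_le_0_compat; auto. }
  eapply Rle_trans.
  - apply (CI_dom f (fun t => A + B / sqrt (Rabs (t - p) + h) + B / sqrt (Rabs (t - q) + h))); auto; [lra|].
    intros t Ht. apply ccont_ext_loc with (fun t => RtoC A + RtoC (B / sqrt (Rabs (t - p) + h)) + RtoC (B / sqrt (Rabs (t - q) + h)))%C 1; [lra| |].
    + intros u _. now rewrite !RtoC_plus.
    + apply ccont_plus; [apply ccont_plus; [apply ccont_const|]|]; eapply D; exact Ht.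
  - rewrite (CI_ext _ (fun t => (RtoC A + RtoC (B / sqrt (Rabs (t - p) + h))) + RtoC (B / sqrt (Rabs (t - q) + h)))%C);
      [|lra|intros; now rewrite !RtoC_plus].
    assert (C0 : cont_on (fun _ => RtoC A) a b) by (intros t _; apply ccont_const).
    rewrite CI_plus, CI_plus; [|lra|auto|apply D|lra|intros t Ht; apply ccont_plus; [apply ccont_const|eapply D; exact Ht]|apply D].
    assert (K0 : Cmod (CI (fun _ => RtoC A) a b) <= A * (b - a)).
    { apply CI_bound; auto; [lra|]. intros. rewrite Cmod_R, Rabs_pos_eq; lra. }
    assert (K1 := B1 p Hp). assert (K2 := B1 q Hq).
    eapply Rle_trans; [apply Cmod_triangle|].
    assert (X := Cmod_triangle (CI (fun _ => RtoC A) a b) (CI (fun t => RtoC (B / sqrt (Rabs (t - p) + h))) a b)). lra.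
Qed.

Ltac ccont_tac := repeat lazymatch goal with
  | |- continuous (fun _ => ?c) _ => apply ccont_const
  | |- continuous (fun t => Cplus (@?f t) (@?g t)) _ => apply (ccont_plus f g)
  | |- continuous (fun t => Cminus (@?f t) (@?g t)) _ => apply (ccont_minus f g)
  | |- continuous (fun t => Cmult (@?f t) (@?g t)) _ => apply (ccont_mult f g)
  end.

Lemma ccont_comb (A B D P : R -> C) (c : C) (t : R) : ccont A t -> ccont B t -> ccont D t -> ccont P t ->
  ccont (fun t => (A t - B t) * (P t - c) + c * (D t - B t))%C t.
Proof.
  intros. ccont_tac; auto.
Qed.

(** Meant for a [D] with the same integral as [A], a translate of it: the last term then vanishes,
    and the combination on the left, small near the singularity, has the integral of (A - B) P. *)
Lemma CI_comb (A B D P : R -> C) (c : C) (a b : R) : a <= b ->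
  (forall t, ccont A t) -> (forall t, ccont B t) -> (forall t, ccont D t) -> (forall t, ccont P t) ->
  CI (fun t => (A t - B t) * (P t - c) + c * (D t - B t))%C a b
  = (CI (fun t => A t * P t)%C a b - CI (fun t => B t * P t)%C a b + c * (CI D a b - CI A a b))%C.
Proof.
  intros Hab HA HB HD HP.
  rewrite (CI_ext _ (fun t => (A t * P t - B t * P t) + c * (D t - A t))%C) by (auto; intros; ring).
  assert (C1 : forall F G : R -> C, (forall t, ccont F t) -> (forall t, ccont G t) -> cont_on (fun t => F t - G t)%C a b).
  { intros F G HF HG t _. ccont_tac; auto. }
  assert (C2 : forall F G : R -> C, (forall t, ccont F t) -> (forall t, ccont G t) -> cont_on (fun t => F t * G t)%C a b).
  { intros F G HF HG t _. ccont_tac; auto. }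
  rewrite (CI_plus (fun t => A t * P t - B t * P t)%C (fun t => c * (D t - A t))%C); auto.
  - rewrite (CI_scal (fun t => D t - A t)%C), (CI_minus (fun t => A t * P t)%C (fun t => B t * P t)%C), (CI_minus D A); auto;
      intros t _; auto.
  - intros t _. ccont_tac; auto.
  - intros t _. ccont_tac; auto.
Qed.

Section Main.
Variables (k0 : R) (e1 e2 : C) (l : R) (gam tau dtau psi : R -> C).
Hypotheses (h1 : 0 < Im e1) (h2 : 0 < Im e2)
  (Hl : 0 < l) (Hper : forall t, gam (t + 2 * l) = gam t)
  (Hsimple : forall s t, 0 <= s < 2 * l -> 0 <= t < 2 * l -> gam s = gam t -> s = t)
  (Hgam : forall t : R, isd gam t (tau t)) (Htau : forall t : R, isd tau t (dtau t))
  (Hdtau : forall t : R, ccont dtau t) (Hunit : forall t, Cmod (tau t) = 1)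
  (Hpsi : forall t : R, ccont psi t).

Local Notation g0 := (G0 k0 e1 e2).
Local Notation g1 := (G1 k0 e1 e2).
Local Notation g2 := (G2 k0 e1 e2).
(** Common radius for all arguments of the kernels: arc length makes the curve 1-Lipschitz, and
    displacements along the normal are at most 1. *)
Local Notation MM := (2 * l + 1).

Let HL : 0 < 2 * l.
Proof. lra. Qed.

Let lip := gam_lipschitz gam tau Hgam Hunit.
Let ctaylor := curve_taylor (2 * l) gam tau dtau HL Hgam Htau Hdtau.

Lemma chord_arc' (s : R) : exists c d0, 0 < c <= 1 /\ 0 < d0 <= Rmin 1 (l / 4) /\
  forall r t, Rabs r <= d0 -> Rabs (t - s) <= l + d0 -> c * Rabs (s + r - t) <= Cmod (gam (s + r) - gam t).
Proof.
  destruct (chord_arc (2 * l) gam tau dtau HL Hper Hsimple Hgam Htau Hdtau Hunit s) as [c [d0 [Hc [Hd H]]]].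
  exists (Rmin c 1), (Rmin d0 (Rmin 1 (l / 4))).
  assert (A1 := Rmin_l d0 (Rmin 1 (l / 4))). assert (A2 := Rmin_r d0 (Rmin 1 (l / 4))).
  split; [split; [apply Rmin_pos; lra|apply Rmin_r]|]. split.
  { split; auto. repeat apply Rmin_pos; lra. }
  intros r t Hr Ht. eapply Rle_trans; [|apply H; lra].
  apply Rmult_le_compat_r; [apply Rabs_pos|apply Rmin_l].
Qed.

Lemma isd_sub_gam (x : C) (t : R) : isd (fun t => x - gam t)%C t (- tau t)%C.
Proof. eapply isd_eq; [apply isd_minus; [apply isd_const|apply Hgam]|]. ring. Qed.

Lemma isd_path (x v : C) (r : R) : isd (fun r => x + RtoC r * v)%C r v.
Proof.
  eapply isd_eq; [apply isd_plus; [apply isd_const|apply (isd_mult (fun r => RtoC r) (fun _ => v)); [apply isd_id|apply isd_const]]|]. cbv beta. ring.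
Qed.

Lemma g0_ccont (rho : R) (Z : R -> C) (t : R) (v : C) : isd Z t v -> 0 <= rho -> 0 < Cmod (Z t) + rho ->
  ccont (fun t => g0 rho (Z t)) t.
Proof. intros HZ Hr HP. eapply isd_ccont, isd_G0; [exact HZ|]. now apply Im_qr_pos. Qed.

Lemma g1_ccont (rho : R) (Z w : R -> C) (t : R) (v w' : C) : isd Z t v -> isd w t w' -> 0 <= rho -> 0 < Cmod (Z t) + rho ->
  ccont (fun t => g1 rho (Z t) (w t)) t.
Proof. intros HZ Hw Hr HP. eapply isd_ccont, isd_G1; [exact HZ|exact Hw|]. now apply Im_qr_pos. Qed.

(** One convergence statement for both approximations of the single layer on the curve: [Z] is the
    chord itself with rho > 0 in [sl_rho], or the chord from a displaced target with rho = 0 in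
    [sl_normal]. The lower bounds in t - s + h and s + 2 l - t + h give the common inverse square
    root majorant required by [sing_int_approx]. *)
Lemma sl_limit (s : R) (m : R -> C) : (forall t, ccont m t) -> forall c, 0 < c <= 1 ->
  ex_sing_int (2 * l) s (fun t => g0 0 (gam s - gam t) * m t)%C /\
  exists K, 0 < K /\ forall (Z : R -> C) (rho h a E : R), 0 <= rho <= 1 -> 0 < h -> 0 < a <= l ->
    (forall t, exists v, isd Z t v) ->
    (forall t, s <= t <= s + 2 * l -> Cmod (Z t) <= MM) ->
    (forall t, s <= t <= s + l -> c * (t - s + h) <= Cmod (Z t) + rho) ->
    (forall t, s + l <= t <= s + 2 * l -> c * (s + 2 * l - t + h) <= Cmod (Z t) + rho) ->
    (forall t, s + a <= t <= s + 2 * l - a -> Cmod (g0 rho (Z t) - g0 0 (gam s - gam t)) <= E) ->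
    Cmod (CI (fun t => g0 rho (Z t) * m t)%C s (s + 2 * l) - sing_int (2 * l) s (fun t => g0 0 (gam s - gam t) * m t)%C)
      <= K * sqrt a + K * E.
Proof.
  intros Hm c Hc.
  destruct (G0_bound k0 e1 e2 h1 h2 MM) as [K [HK HB]].
  destruct (chord_arc' s) as [c1 [d0 [Hc1 [Hd0 Hch]]]].
  destruct (ccont_bounded m s (s + 2 * l)) as [Mm [HMm Bm]]; [lra|intros; apply Hm|].
  assert (D0 : d0 <= l / 4) by (eapply Rle_trans; [apply Hd0|apply Rmin_r]).
  set (c' := Rmin c c1). assert (C1 : c' <= c) by apply Rmin_l. assert (C2 : c' <= c1) by apply Rmin_r.
  assert (C3 : 0 < c') by (apply Rmin_pos; lra). assert (SC := sqrt_lt_R0 _ C3).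
  set (K' := K * Mm / sqrt c'). assert (HK' : 0 < K') by (apply Rdiv_lt_0_compat; [nra|lra]).
  set (f := fun t => (g0 0 (gam s - gam t) * m t)%C).
  assert (GB : forall rho z mt d, 0 <= rho <= 1 -> Cmod z <= MM -> Cmod mt <= Mm -> 0 < d -> c' * d <= Cmod z + rho ->
    Cmod (g0 rho z * mt) <= K' / sqrt d).
  { intros rho z mt d Hr Hz Hmt Hd Hcd. assert (PD : 0 < c' * d) by nra. assert (SD := sqrt_lt_R0 _ Hd).
    unfold K'. replace (K * Mm / sqrt c' / sqrt d) with (K / sqrt (c' * d) * Mm) by (rewrite sqrt_mult by lra; field; lra).
    apply Cmod_mult_le; auto. eapply Rle_trans; [apply HB; auto; lra|].
    apply Rdiv_le_weaken; try lra. split; [now apply sqrt_lt_R0|]. now apply sqrt_le_1_alt. }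
  assert (F1 : forall t, s <= t <= s + l -> c' * (t - s) <= Cmod (gam s - gam t)).
  { intros t Ht. assert (A := Hch 0 t ltac:(rewrite Rabs_R0; lra) ltac:(rewrite Rabs_pos_eq; lra)).
    rewrite Rplus_0_r in A. rewrite Rabs_minus_sym, Rabs_pos_eq in A by lra.
    eapply Rle_trans; [|exact A]. apply Rmult_le_compat_r; lra. }
  (* On the second half of the period the nearest singular parameter is s + 2 l, so the chord
     estimate is used at t - 2 l. *)
  assert (F2 : forall t, s + l <= t <= s + 2 * l -> c' * (s + 2 * l - t) <= Cmod (gam s - gam t)).
  { intros t Ht. assert (A := Hch 0 (t - 2 * l) ltac:(rewrite Rabs_R0; lra) ltac:(rewrite Rabs_left1; lra)).
    rewrite <- (Hper (t - 2 * l)) in A. replace (t - 2 * l + 2 * l) with t in A by ring.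
    rewrite Rplus_0_r in A. rewrite Rabs_pos_eq in A by lra.
    eapply Rle_trans; [|exact A]. replace (s + 2 * l - t) with (s - (t - 2 * l)) by ring. apply Rmult_le_compat_r; lra. }
  assert (FM : forall t, s <= t <= s + 2 * l -> Cmod (gam s - gam t) <= MM).
  { intros t Ht. eapply Rle_trans; [apply lip|]. rewrite Rabs_left1; lra. }
  assert (Fc : forall t, s < t < s + 2 * l -> ccont f t).
  { intros t Ht. apply ccont_mult; [|apply Hm]. eapply g0_ccont; [apply isd_sub_gam|lra|].
    destruct (Rle_dec t (s + l)) as [k|k].
    - specialize (F1 t ltac:(lra)). assert (0 < c' * (t - s)) by (apply Rmult_lt_0_compat; lra). lra.
    - specialize (F2 t ltac:(lra)). assert (0 < c' * (s + 2 * l - t)) by (apply Rmult_lt_0_compat; lra). lra. }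
  assert (Fr : forall t, s < t <= s + l -> Cmod (f t) <= K' / sqrt (t - s)).
  { intros t Ht. unfold f. apply (GB 0 (gam s - gam t)%C (m t) (t - s)); try lra; [apply FM; lra|apply Bm; lra|].
    rewrite Rplus_0_r. apply F1; lra. }
  assert (Fl : forall t, s + l <= t < s + 2 * l -> Cmod (f t) <= K' / sqrt (s + 2 * l - t)).
  { intros t Ht. unfold f. apply (GB 0 (gam s - gam t)%C (m t) (s + 2 * l - t)); try lra; [apply FM; lra|apply Bm; lra|].
    rewrite Rplus_0_r. apply F2; lra. }
  split; [apply (sing_int_value f s l K'); auto; lra|].
  exists (8 * K' + 2 * l * Mm). split; [nra|].
  intros Z rho h a E Hr Hh Ha HZ HZM HZr HZl HE.
  assert (SA := sqrt_pos a).
  assert (HE0 : 0 <= E) by (eapply Rle_trans; [apply Cmod_ge_0|apply (HE (s + l)); lra]).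
  assert (PZ : forall t, s <= t <= s + 2 * l -> 0 < Cmod (Z t) + rho).
  { intros t Ht. destruct (Rle_dec t (s + l)).
    - eapply Rlt_le_trans; [|apply HZr; lra]. apply Rmult_lt_0_compat; lra.
    - eapply Rlt_le_trans; [|apply HZl; lra]. apply Rmult_lt_0_compat; lra. }
  apply Rle_trans with (8 * K' * sqrt a + (Mm * E) * (2 * l)).
  2:{ assert (0 <= 8 * K' * E) by nra. assert (0 <= 2 * l * Mm * sqrt a) by (apply Rmult_le_pos; nra). lra. }
  apply (sing_int_approx f (fun t => g0 rho (Z t) * m t)%C s l K' h a (Mm * E)); auto; try lra.
  - intros t Ht. apply ccont_mult; [|apply Hm]. destruct (HZ t) as [v Hv]. eapply g0_ccont; [exact Hv|lra|now apply PZ].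
  - intros t Ht. apply (GB rho (Z t) (m t) (t - s + h)); auto; [apply HZM; lra|apply Bm; lra|lra|].
    eapply Rle_trans; [|apply HZr; lra]. apply Rmult_le_compat_r; lra.
  - intros t Ht. apply (GB rho (Z t) (m t) (s + 2 * l - t + h)); auto; [apply HZM; lra|apply Bm; lra|lra|].
    eapply Rle_trans; [|apply HZl; lra]. apply Rmult_le_compat_r; lra.
  - intros t Ht. unfold f. replace (g0 rho (Z t) * m t - g0 0 (gam s - gam t) * m t)%C
      with (m t * (g0 rho (Z t) - g0 0 (gam s - gam t)))%C by ring.
    apply Cmod_mult_le; [apply Bm; lra|apply HE; lra].
Qed.

(** * The truncated principal value and its comparison with limits along the normal *)

Lemma isd_gam_translate (t r : R) : isd (fun r => gam (t + r)) r (tau (t + r)).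
Proof.
  apply is_derive_ext with (fun r => gam (r + t)); [intros; f_equal; ring|].
  apply isd_shift. replace (r + t) with (t + r) by ring. apply Hgam.
Qed.

Lemma isd_tau_translate (t r : R) : isd (fun r => tau (t + r)) r (dtau (t + r)).
Proof.
  apply is_derive_ext with (fun r => tau (r + t)); [intros; f_equal; ring|].
  apply isd_shift. replace (r + t) with (t + r) by ring. apply Htau.
Qed.

(** Both sides of [s] are included so that a single function of |t - s| dominates. The summand [u]
    makes it dominate the Lipschitz function [tau] too, so one weight serves both terms of [Yk]. *)
Definition oscillation (s u : R) : R := Cmod (psi (s + u) - psi s) + Cmod (psi (s - u) - psi s) + u.

Lemma oscillation_small (s eps : R) : 0 < eps -> exists d, 0 < d /\ forall u, 0 <= u <= d -> oscillation s u <= eps.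
Proof.
  intros He. destruct (proj1 (ccont_eps _ _) (Hpsi s) (eps / 3) ltac:(lra)) as [d [Hd H]].
  exists (Rmin (d / 2) (eps / 3)). split; [apply Rmin_pos; lra|]. intros u Hu.
  assert (A1 := Rmin_l (d / 2) (eps / 3)). assert (A2 := Rmin_r (d / 2) (eps / 3)). unfold oscillation.
  assert (B1 := H (s + u)). assert (B2 := H (s - u)).
  replace (s + u - s) with u in B1 by ring. replace (s - u - s) with (- u) in B2 by ring. rewrite Rabs_Ropp in B2.
  rewrite (Rabs_pos_eq u) in B1, B2 by lra. specialize (B1 ltac:(lra)). specialize (B2 ltac:(lra)). lra.
Qed.

Lemma oscillation_bounded (s : R) : exists W, 0 < W /\ forall u, 0 <= u <= l -> oscillation s u <= W.
Proof.
  destruct (ccont_bounded (fun t => psi t - psi s)%C (s - l) (s + l)) as [K [HK H]]; [lra|intros; apply ccont_minus; [apply Hpsi|apply ccont_const]|].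
  exists (2 * K + l). split; [lra|]. intros u Hu. unfold oscillation.
  assert (B1 := H (s + u) ltac:(lra)). assert (B2 := H (s - u) ltac:(lra)). simpl in B1, B2. lra.
Qed.

Lemma oscillation_psi (s t : R) : Cmod (psi t - psi s) <= oscillation s (Rabs (t - s)).
Proof.
  unfold oscillation. assert (A := Rabs_pos (t - s)).
  assert (B1 := Cmod_ge_0 (psi (s + Rabs (t - s)) - psi s)). assert (B2 := Cmod_ge_0 (psi (s - Rabs (t - s)) - psi s)).
  destruct (Rle_dec 0 (t - s)) as [h|h].
  - rewrite (Rabs_pos_eq (t - s)) in * by lra. replace (s + (t - s)) with t in * by ring. lra.
  - rewrite (Rabs_left (t - s)) in * by lra. replace (s - - (t - s)) with t in * by ring. lra.
Qed.

Lemma oscillation_ge (s u : R) : u <= oscillation s u.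
Proof.
  unfold oscillation. assert (B1 := Cmod_ge_0 (psi (s + u) - psi s)). assert (B2 := Cmod_ge_0 (psi (s - u) - psi s)). lra.
Qed.

(* Truncated principal-value integrand: the term [psi s * (tau s - tau t)] replaces [psi s * tau s] because
   the derivative of the kernel along the curve integrates to zero over a period. *)
Definition Yk (s rho : R) (t : R) : C :=
  (g1 rho (gam s - gam t) (tau s) * (psi t - psi s) + psi s * g1 rho (gam s - gam t) (tau s - tau t))%C.

Definition PVk (s rho h : R) : C := (CI (Yk s rho) (s - l) (s - h) + CI (Yk s rho) (s + h) (s + l))%C.

(** The derivative in the direction [tau s] of the single layer with density [psi], taken at the
    point at signed distance [h] from the curve. *)
Definition Tk (s : R) (nus : C) (h : R) : C :=
  CI (fun t => g1 0 (gam s + RtoC h * nus - gam t) (tau s) * psi t)%C (s - l) (s + l).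

Lemma isd_const_tau (s t : R) : isd (fun t => tau s - tau t)%C t (- dtau t)%C.
Proof. eapply isd_eq; [apply isd_minus; [apply isd_const|apply Htau]|]. ring. Qed.

Lemma Yk_form_ccont (s rho : R) (Z : R -> C) (t : R) (v : C) : isd Z t v -> 0 <= rho -> 0 < Cmod (Z t) + rho ->
  ccont (fun t => g1 rho (Z t) (tau s) * (psi t - psi s) + psi s * g1 rho (Z t) (tau s - tau t))%C t.
Proof.
  intros HZ Hr HP. apply ccont_plus; apply ccont_mult.
  - eapply (g1_ccont rho Z (fun _ => tau s)); [exact HZ|apply isd_const|lra|lra].
  - apply ccont_minus; [apply Hpsi|apply ccont_const].
  - apply ccont_const.
  - eapply (g1_ccont rho Z (fun t => tau s - tau t)%C); [exact HZ|apply isd_const_tau|lra|lra].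
Qed.

Lemma gam_neq (s t : R) : 0 < Rabs (t - s) <= l -> 0 < Cmod (gam s - gam t).
Proof.
  intros H. destruct (chord_arc' s) as [c [d0 [Hc [Hd0 Hch]]]].
  assert (A := Hch 0 t ltac:(rewrite Rabs_R0; lra) ltac:(lra)). rewrite Rplus_0_r, Rabs_minus_sym in A.
  eapply Rlt_le_trans; [|exact A]. apply Rmult_lt_0_compat; lra.
Qed.

Lemma Yk_ccont (s rho t : R) : 0 <= rho -> 0 < Rabs (t - s) <= l -> ccont (Yk s rho) t.
Proof.
  intros Hr Ht. eapply (Yk_form_ccont s rho (fun t => gam s - gam t)%C); [apply isd_sub_gam|lra|].
  assert (A := gam_neq s t Ht). lra.
Qed.

Lemma tau_diff_weight (s : R) : exists M, 0 < M /\ forall t, Rabs (t - s) <= l ->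
  Cmod (tau s - tau t) <= M * oscillation s (Rabs (t - s)).
Proof.
  destruct (ctaylor s) as [M [HM T]]. exists M. split; auto. intros t Ht.
  destruct (T s t) as [A _]; [rewrite Rminus_diag, Rabs_R0; lra|lra|].
  eapply Rle_trans; [exact A|]. apply Rmult_le_compat_l; [lra|]. rewrite Rabs_minus_sym. apply oscillation_ge.
Qed.

Lemma cont_on_outer (f : R -> C) (s h : R) : 0 < h -> (forall t, h <= Rabs (t - s) <= l -> ccont f t) ->
  cont_on f (s - l) (s - h) /\ cont_on f (s + h) (s + l).
Proof.
  intros Hh H. split; intros t Ht; apply H.
  - rewrite Rabs_left1; lra.
  - rewrite Rabs_pos_eq; lra.
Qed.

Lemma CI_split3 (f : R -> C) (s h : R) : 0 < h <= l -> cont_on f (s - l) (s + l) ->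
  CI f (s - l) (s + l) = (CI f (s - h) (s + h) + (CI f (s - l) (s - h) + CI f (s + h) (s + l)))%C.
Proof.
  intros Hh Hc. rewrite (CI_chasles f (s - l) (s + l) Hc (s - h)) by lra.
  rewrite (CI_chasles f (s - h) (s + l)) with (c := s + h); [ring| |lra].
  intros t Ht; apply Hc; lra.
Qed.

(** After the constant part of the density is corrected as in [Yk], the integral is split at |t - s|
    = 2 |h|. Inside, the kernel is at most a multiple of 1/|h| on length 4 |h|, times a small
    oscillation. Outside, replacing the displaced target by [gam s] costs |h| / u^2 times the
    oscillation, and [outer_small2] applies. *)
Lemma normal_limit (s : R) (nus : C) : tau s = (Ci * nus)%C -> forall eps, 0 < eps -> exists d, 0 < d /\
  forall h, 0 < Rabs h < d -> Cmod (Tk s nus h - PVk s 0 (2 * Rabs h)) <= eps.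
Proof.
  intros Hnu eps He.
  assert (Unu : Cmod nus = 1).
  { rewrite <- (Hunit s), Hnu, Cmod_mult, Cmod_Ci. ring. }
  destruct (chord_normal (2 * l) gam tau dtau HL Hper Hsimple Hgam Htau Hdtau Hunit s nus Hnu) as [c [d0 [Hc [Hd0 Hch]]]].
  replace (2 * l / 2) with l in Hch by field.
  destruct (G1_bound k0 e1 e2 h1 h2 MM) as [A [HA BA]].
  destruct (G2_bound k0 e1 e2 h1 h2 MM) as [B [HB BB]].
  destruct (tau_diff_weight s) as [M [HM TW]].
  destruct (oscillation_bounded s) as [W [HW BW]].
  set (w := oscillation s) in *. set (P := 1 + Cmod (psi s) * M).
  assert (NP := Cmod_ge_0 (psi s)). assert (HP : 0 < P) by (unfold P; nra).
  set (z := fun h t => (gam s + RtoC h * nus - gam t)%C).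
  set (F := fun h t => (g1 0 (z h t) (tau s) * (psi t - psi s) + psi s * g1 0 (z h t) (tau s - tau t))%C).
  assert (Hz : forall h t, isd (z h) t (- tau t)%C) by (intros; apply isd_sub_gam).
  assert (Zpos : forall h t, 0 < Rabs h <= d0 -> Rabs (t - s) <= l -> c * (Rabs (t - s) + Rabs h) <= Cmod (z h t) /\ 0 < Cmod (z h t)).
  { intros h t Hh Ht. assert (X := Hch h t ltac:(lra) Ht). split; auto.
    eapply Rlt_le_trans; [|exact X]. apply Rmult_lt_0_compat; [lra|]. assert (Y := Rabs_pos (t - s)). lra. }
  assert (Zup : forall h t, Rabs h <= d0 -> Rabs (t - s) <= l -> Cmod (z h t) <= MM).
  { intros h t Hh Ht. unfold z. replace (gam s + RtoC h * nus - gam t)%C with ((gam s - gam t) + RtoC h * nus)%C by ring.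
    eapply Rle_trans; [apply Cmod_plus_le; [apply lip|apply Cmod_mult_le; apply Rle_refl]|].
    rewrite Cmod_R, Unu, Rabs_minus_sym. lra. }
  assert (Fc : forall h, 0 < Rabs h <= d0 -> cont_on (F h) (s - l) (s + l)).
  { intros h Hh t Ht. eapply (Yk_form_ccont s 0 (z h)); [apply Hz|lra|].
    destruct (Zpos h t Hh) as [_ X]; [apply Rabs_le; lra|lra]. }
  assert (TF : forall h, 0 < Rabs h <= d0 -> Tk s nus h = CI (F h) (s - l) (s + l)).
  { intros h Hh.
    (* [- g1 0 z (tau t)] is the derivative of [g0 0 z] along the curve and integrates to 0 over a
       period. Hence [psi s * g1 0 z (tau t)] can be subtracted freely, which turns [tau s] into
       [tau s - tau t] where the density is replaced by its value at [s]. *)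
    assert (E0 : CI (fun t => - g1 0 (z h t) (tau t))%C (s - l) (s + l) = RtoC 0).
    { rewrite (CI_derive (fun t => g0 0 (z h t))).
      - unfold z. replace (s + l) with (s - l + 2 * l) by ring. rewrite Hper. ring.
      - lra.
      - intros t Ht. eapply isd_eq; [apply isd_G0; [apply Hz|apply Im_qr_pos; auto; try lra]|].
        + destruct (Zpos h t Hh) as [_ X]; [apply Rabs_le; lra|lra].
        + unfold G1, Bf. simpl. rewrite <- !Ropp_mult_distr_r, !RtoC_opp. ring.
      - intros t Ht. apply ccont_ext_loc with (fun t => RtoC (-1) * g1 0 (z h t) (tau t))%C 1; [lra| |].
        + intros u _. ring.
        + apply ccont_mult; [apply ccont_const|]. eapply (g1_ccont 0 (z h) tau); [apply Hz|apply Htau|lra|].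
          destruct (Zpos h t Hh) as [_ X]; [apply Rabs_le; lra|lra]. }
    unfold Tk. rewrite (CI_ext _ (fun t => F h t + (- psi s) * (- g1 0 (z h t) (tau t)))%C).
    - rewrite CI_plus, CI_scal, E0; [ring|lra| |lra|now apply Fc|].
      + intros t Ht. apply ccont_ext_loc with (fun t => RtoC (-1) * g1 0 (z h t) (tau t))%C 1; [lra|intros; ring|].
        apply ccont_mult; [apply ccont_const|]. eapply (g1_ccont 0 (z h) tau); [apply Hz|apply Htau|lra|].
        destruct (Zpos h t Hh) as [_ X]; [apply Rabs_le; lra|lra].
      + intros t Ht. apply ccont_mult; [apply ccont_const|]. apply ccont_ext_loc with (fun t => RtoC (-1) * g1 0 (z h t) (tau t))%C 1; [lra|intros; ring|].
        apply ccont_mult; [apply ccont_const|]. eapply (g1_ccont 0 (z h) tau); [apply Hz|apply Htau|lra|].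
        destruct (Zpos h t Hh) as [_ X]; [apply Rabs_le; lra|lra].
    - lra.
    - intros t Ht. unfold F. rewrite G1_minus. fold (z h t). ring. }
  assert (HwV : vanishing w).
  { intros e Hpe. destruct (oscillation_small s e Hpe) as [d [Hd H]]. exists d; split; auto. intros; apply H; lra. }
  (* The cutoff is 2 |h| while the estimate is linear in |h|, hence the 1/2. *)
  destruct (outer_small2 w l (B / c ^ 2 * P / 2) W Hl) with (eps := eps / 2) as [o [Ho Hout]]; auto.
  { apply Rlt_le. assert (0 < B / c ^ 2) by (apply Rdiv_lt_0_compat; [lra|apply pow_lt; lra]). nra. }
  { intros; apply BW; lra. }
  { lra. }
  (* Kernel bound A / (c |h|) times the length 4 |h| of the inner interval. *)
  set (Kc := A / c * P * 4). assert (HKc : 0 < Kc) by (unfold Kc; assert (0 < A / c) by (apply Rdiv_lt_0_compat; lra); nra).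
  destruct (oscillation_small s (eps / (2 * Kc))) as [d1 [Hd1 Hos]]; [apply Rdiv_lt_0_compat; lra|].
  exists (Rmin (Rmin d0 (l / 2)) (Rmin (o / 2) (d1 / 2))).
  split; [repeat apply Rmin_pos; lra|]. intros h Hh.
  assert (R1 := Rmin_l (Rmin d0 (l / 2)) (Rmin (o / 2) (d1 / 2))). assert (R2 := Rmin_r (Rmin d0 (l / 2)) (Rmin (o / 2) (d1 / 2))).
  assert (R3 := Rmin_l d0 (l / 2)). assert (R4 := Rmin_r d0 (l / 2)). assert (R5 := Rmin_l (o / 2) (d1 / 2)). assert (R6 := Rmin_r (o / 2) (d1 / 2)).
  assert (Hh' : 0 < Rabs h <= d0) by lra.
  set (a := Rabs h) in *.
  assert (wt : forall t x y X, Rabs (t - s) <= l -> 0 <= X -> Cmod x <= X * Cmod (psi t - psi s) -> Cmod y <= X * Cmod (tau s - tau t) ->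
     Cmod (x + psi s * y) <= X * P * w (Rabs (t - s))).
  { intros t x y X Ht HX Hx Hy. assert (Q1 := oscillation_psi s t). assert (Q2 := TW t Ht).
    apply Rle_trans with (X * w (Rabs (t - s)) + Cmod (psi s) * (X * (M * w (Rabs (t - s))))).
    - apply Cmod_plus_le.
      + eapply Rle_trans; [exact Hx|]. apply Rmult_le_compat_l; auto.
      + apply Cmod_mult_le; [lra|]. eapply Rle_trans; [exact Hy|]. apply Rmult_le_compat_l; auto.
    - unfold P. right. ring. }
  rewrite TF by auto. rewrite (CI_split3 (F h) s (2 * a)) by (auto; lra). unfold PVk.
  destruct (cont_on_outer (F h) s (2 * a)) as [Fo1 Fo2]; [lra|intros t Ht; apply Fc; auto; apply Rabs_le_between' ; lra|].
  destruct (cont_on_outer (Yk s 0) s (2 * a)) as [Yo1 Yo2]; [lra|intros t Ht; apply Yk_ccont; lra|].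
  match goal with |- Cmod ?X <= _ => replace X with
   (CI (F h) (s - 2 * a) (s + 2 * a) + ((CI (F h) (s - l) (s - 2 * a) - CI (Yk s 0) (s - l) (s - 2 * a))
     + (CI (F h) (s + 2 * a) (s + l) - CI (Yk s 0) (s + 2 * a) (s + l))))%C by ring end.
  rewrite <- !CI_minus; auto; try lra.
  replace eps with (eps / 2 + eps / 2) by field. apply Cmod_plus_le.
  - apply Rle_trans with (A / (c * a) * P * (eps / (2 * Kc)) * (s + 2 * a - (s - 2 * a))).
    + apply CI_bound; [lra| |].
      * intros t Ht. apply Fc; auto; lra.
      * intros t Ht. assert (Ht' : Rabs (t - s) <= 2 * a) by (apply Rabs_le; lra). assert (Q := Rabs_pos (t - s)).
        destruct (Zpos h t Hh' ltac:(lra)) as [Z1 Z2]. fold a in Z1.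
        assert (Z3 : z h t <> RtoC 0) by now apply Cmod_gt_0.
        assert (Z4 : forall v, Cmod (g1 0 (z h t) v) <= A / (c * a) * Cmod v).
        { intros v. eapply Rle_trans; [apply BA; auto; [lra|apply Zup; fold a; lra]|].
          replace (A / (c * a) * Cmod v) with (A * Cmod v / (c * a)) by (field; lra).
          assert (0 <= A * Cmod v) by (apply Rmult_le_pos; [lra|apply Cmod_ge_0]).
          apply Rdiv_le_weaken; try lra. split; [nra|]. assert (0 <= c * Rabs (t - s)) by (apply Rmult_le_pos; lra). lra. }
        assert (0 <= A / (c * a)) by (apply Rdiv_le_0_compat; nra).
        eapply Rle_trans; [apply (wt t _ _ (A / (c * a))); auto; [lra|]|].
        -- apply Rle_trans with (A / (c * a) * Cmod (tau s) * Cmod (psi t - psi s)); [|rewrite Hunit; lra].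
           rewrite Cmod_mult. apply Rmult_le_compat_r; [apply Cmod_ge_0|apply Z4].
        -- apply Rmult_le_compat_l; [nra|]. apply Hos. lra.
    + right. unfold Kc. field. lra.
  - apply Hout; [lra| | |].
    + intros t Ht. apply ccont_minus; [now apply Fo1|now apply Yo1].
    + intros t Ht. apply ccont_minus; [now apply Fo2|now apply Yo2].
    + intros t Ht. set (u := Rabs (t - s)) in *.
      assert (Hu2 : (t - s) ^ 2 = u ^ 2) by (unfold u; now rewrite pow2_abs).
      rewrite Hu2.
      replace (B / c ^ 2 * P / 2 * (2 * a) / u ^ 2 * w u) with (B * a / (c * u) ^ 2 * P * w u) by (field; split; lra).
      (* Mean value bound in the normal displacement r between 0 and h: the derivative has size
         1/|z|^2, and |z| >= c u all along. *)
      assert (D : forall v, Cmod (g1 0 (z h t) v - g1 0 (gam s - gam t) v) <= B * a / (c * u) ^ 2 * Cmod v).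
      { intros v. replace (gam s - gam t)%C with (gam s - gam t + RtoC 0 * nus)%C by ring.
        replace (z h t) with (gam s - gam t + RtoC h * nus)%C by (unfold z; ring).
        replace (B * a / (c * u) ^ 2 * Cmod v) with (B * Cmod v / (c * u) ^ 2 * Rabs (h - 0))
          by (rewrite Rminus_0_r; fold a; field; split; lra).
        apply (mvt_C_abs (fun r => g1 0 (gam s - gam t + RtoC r * nus) v) (fun r => g2 0 (gam s - gam t + RtoC r * nus) nus v 0)).
        intros r Hr. assert (Hra : Rabs r <= d0).
        { apply Rle_trans with a; [|lra]. revert Hr. unfold a, Rmin, Rmax, Rabs. repeat destruct Rle_dec; repeat destruct Rcase_abs; lra. }
        assert (Er : (gam s - gam t + RtoC r * nus)%C = z r t) by (unfold z; ring).
        assert (Z1 : c * u <= Cmod (z r t)).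
        { eapply Rle_trans; [|apply (Hch r t Hra); fold u; lra]. fold u. assert (Y := Rabs_pos r). apply Rmult_le_compat_l; lra. }
        assert (CU : 0 < c * u) by (apply Rmult_lt_0_compat; lra).
        split.
        - apply (isd_G1 k0 e1 e2 0 (fun r => gam s - gam t + RtoC r * nus)%C (fun _ => v) r nus (RtoC 0)); [apply isd_path|apply isd_const|].
          rewrite Er. apply Im_qr_pos; lra.
        - rewrite Er. eapply Rle_trans; [apply BB; [lra|apply Cmod_gt_0; lra|apply Zup; auto; fold u; lra]|].
          rewrite Unu, Cmod_0. replace (B * (1 * Cmod v / Cmod (z r t) ^ 2 + 0 / Cmod (z r t))) with (B * Cmod v / Cmod (z r t) ^ 2) by (field; lra).
          assert (0 <= B * Cmod v) by (apply Rmult_le_pos; [lra|apply Cmod_ge_0]).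
          apply Rdiv_le_weaken; try lra. split; [now apply pow_lt|]. apply pow_incr; lra. }
      assert (0 <= B * a / (c * u) ^ 2) by (apply Rdiv_le_0_compat; [nra|apply pow_lt; nra]).
      unfold F, Yk. fold (z h t).
      match goal with |- Cmod ?X <= _ => replace X with
        ((g1 0 (z h t) (tau s) - g1 0 (gam s - gam t) (tau s)) * (psi t - psi s)
         + psi s * (g1 0 (z h t) (tau s - tau t) - g1 0 (gam s - gam t) (tau s - tau t)))%C by ring end.
      apply (wt t); auto; [fold u; lra|].
      apply Rle_trans with (B * a / (c * u) ^ 2 * Cmod (tau s) * Cmod (psi t - psi s)); [|rewrite Hunit; lra].
      rewrite Cmod_mult. apply Rmult_le_compat_r; [apply Cmod_ge_0|apply D].
Qed.
(** Two motions are compared to first order. Moving only the target gives a remainder d^2 / u^2,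
    valid beyond the cutoff 2 |d|. Moving target and source together changes the chord with velocity
    tau(s + r) - tau(t + r) = O(u), which gains one power of u in the remainder and makes the plain
    difference O(|d|) up to the diagonal. The joint motion serves the constant part of the
    density. *)
Lemma along_bounds (s : R) : exists c d0 K, 0 < c <= 1 /\ 0 < d0 <= Rmin 1 (l / 4) /\ 0 < K /\
  (forall r t, Rabs r <= d0 -> Rabs (t - s) <= l + d0 -> c * Rabs (s + r - t) <= Cmod (gam (s + r) - gam t)) /\
  (forall rho d t, 0 <= rho <= 1 -> Rabs d <= d0 -> 2 * Rabs d <= Rabs (t - s) <= l -> 0 < Rabs (t - s) ->
    Cmod (g0 rho (gam (s + d) - gam t) - g0 rho (gam s - gam t) - RtoC d * g1 rho (gam s - gam t) (tau s))
      <= K * d ^ 2 / Rabs (t - s) ^ 2) /\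
  (forall rho d t, 0 <= rho <= 1 -> Rabs d <= d0 -> 0 < Rabs (t - s) <= l ->
    Cmod (g0 rho (gam (s + d) - gam (t + d)) - g0 rho (gam s - gam t) - RtoC d * g1 rho (gam s - gam t) (tau s - tau t))
      <= K * d ^ 2 / Rabs (t - s)) /\
  (forall rho d t, 0 <= rho <= 1 -> Rabs d <= d0 -> Rabs (t - s) <= l ->
    Cmod (g0 rho (gam (s + d) - gam (t + d)) - g0 rho (gam s - gam t)) <= K * Rabs d).
Proof.
  destruct (chord_arc' s) as [c [d0 [Hc [Hd0 Hch]]]].
  destruct (G1_bound k0 e1 e2 h1 h2 MM) as [A [HA BA]].
  destruct (G2_bound k0 e1 e2 h1 h2 MM) as [B [HB BB]].
  destruct (ctaylor s) as [M [HM T]].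
  destruct (ccont_bounded dtau (s - 2 * l) (s + 2 * l)) as [D [HD BD]]; [lra|intros; apply Hdtau|].
  assert (D1 : d0 <= 1) by (eapply Rle_trans; [apply Hd0|apply Rmin_l]).
  assert (D2 : d0 <= l / 4) by (eapply Rle_trans; [apply Hd0|apply Rmin_r]).
  assert (Up : forall x y, Rabs (x - y) <= MM -> Cmod (gam x - gam y) <= MM) by (intros; eapply Rle_trans; [apply lip|auto]).
  assert (Hpath : forall (t r : R), isd (fun r => gam (s + r) - gam t)%C r (tau (s + r))).
  { intros t r. eapply isd_eq; [apply (isd_minus (fun r => gam (s + r)) (fun _ => gam t)); [apply isd_gam_translate|apply isd_const]|]. ring. }
  assert (Hpath2 : forall (t r : R), isd (fun r => gam (s + r) - gam (t + r))%C r (tau (s + r) - tau (t + r))%C).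
  { intros t r. apply (isd_minus (fun r => gam (s + r)) (fun r => gam (t + r))); apply isd_gam_translate. }
  assert (Hbet : forall d r, Rmin 0 d <= r <= Rmax 0 d -> Rabs r <= Rabs d).
  { intros d r. unfold Rmin, Rmax, Rabs. repeat destruct Rle_dec; repeat destruct Rcase_abs; lra. }
  assert (Hz2 : forall t r, Rabs r <= d0 -> Rabs (t - s) <= l -> c * Rabs (t - s) <= Cmod (gam (s + r) - gam (t + r)) <= MM).
  { intros t r Hr Ht. split.
    - assert (X := Hch r (t + r) Hr). replace (s + r - (t + r)) with (- (t - s)) in X by ring. rewrite Rabs_Ropp in X.
      apply X. replace (t + r - s) with ((t - s) + r) by ring. eapply Rle_trans; [apply Rabs_triang|]. lra.
    - apply Up. replace (s + r - (t + r)) with (- (t - s)) by ring. rewrite Rabs_Ropp. lra. }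
  assert (Hv : forall t r, Rabs r <= d0 -> Rabs (t - s) <= l -> Cmod (tau (s + r) - tau (t + r)) <= M * Rabs (t - s)).
  { intros t r Hr Ht. destruct (T (s + r) (t + r)) as [X _].
    - replace (s + r - s) with r by ring. lra.
    - replace (t + r - s) with ((t - s) + r) by ring. eapply Rle_trans; [apply Rabs_triang|]. lra.
    - replace (s + r - (t + r)) with (- (t - s)) in X by ring. now rewrite Rabs_Ropp in X. }
  set (Ka := B * (1 + D * MM) * 4 / c ^ 2). set (Kb := B * (M ^ 2 * l / c ^ 2 + 2 * D / c)). set (Kc := A * M / c).
  assert (C2 : 0 < c ^ 2) by (apply pow_lt; lra). assert (M2 : 0 < M ^ 2) by (apply pow_lt; lra).
  assert (HKa : 0 < Ka). { apply Rdiv_lt_0_compat; auto. assert (0 < D * MM) by (apply Rmult_lt_0_compat; lra). nra. }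
  assert (HKb : 0 < Kb).
  { apply Rmult_lt_0_compat; auto. assert (0 < M ^ 2 * l / c ^ 2) by (apply Rdiv_lt_0_compat; nra).
    assert (0 < 2 * D / c) by (apply Rdiv_lt_0_compat; lra). lra. }
  assert (HKc : 0 < Kc) by (apply Rdiv_lt_0_compat; nra).
  exists c, d0, (Ka + Kb + Kc). split; [auto|]. split; [auto|]. split; [lra|]. split; [exact Hch|].
  split; [|split].
  - intros rho d t Hr Hd Ht Hpos. set (u := Rabs (t - s)) in *.
    assert (U2 : 0 < u ^ 2) by now apply pow_lt.
    apply Rle_trans with (Ka / u ^ 2 * (d - 0) ^ 2).
    2:{ replace (Ka / u ^ 2 * (d - 0) ^ 2) with (Ka * d ^ 2 / u ^ 2) by (field; lra).
        apply Rmult_le_compat_r; [apply Rlt_le, Rinv_0_lt_compat; lra|]. apply Rmult_le_compat_r; [apply pow2_ge_0|lra]. }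
    assert (X := taylor_C (fun r => g0 rho (gam (s + r) - gam t)) (fun r => g1 rho (gam (s + r) - gam t) (tau (s + r)))
      (fun r => g2 rho (gam (s + r) - gam t) (tau (s + r)) (tau (s + r)) (dtau (s + r))) 0 d (Ka / u ^ 2)).
    cbv beta in X. rewrite Rplus_0_r, Rminus_0_r in X. rewrite Rminus_0_r. apply X.
    intros r Hr'. apply Hbet in Hr'. assert (Hrd : Rabs r <= d0) by lra.
    (* From |r| <= |d| <= u / 2 the parameters s + r and t remain at least u / 2 apart. *)
    assert (Z1 : c * u / 2 <= Cmod (gam (s + r) - gam t)).
    { eapply Rle_trans; [|apply Hch; auto; fold u; lra].
      assert (Y : u <= Rabs (s + r - t) + Rabs r).
      { unfold u. replace (t - s) with (- (s + r - t) + r) by ring. eapply Rle_trans; [apply Rabs_triang|]. rewrite Rabs_Ropp. lra. }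
      replace (c * u / 2) with (c * (u / 2)) by field. apply Rmult_le_compat_l; lra. }
    assert (CU : 0 < c * u / 2) by (apply Rdiv_lt_0_compat; [nra|lra]).
    assert (Z2 : Cmod (gam (s + r) - gam t) <= MM).
    { apply Up. replace (s + r - t) with (- (t - s) + r) by ring. eapply Rle_trans; [apply Rabs_triang|]. rewrite Rabs_Ropp. fold u. lra. }
    assert (IP : 0 < Im (qr e1 e2 rho (gam (s + r) - gam t))) by (apply Im_qr_pos; lra).
    split; [apply isd_G0; [apply Hpath|exact IP]|]. split.
    + apply (isd_G1 k0 e1 e2 rho (fun r => gam (s + r) - gam t)%C (fun r => tau (s + r))); [apply Hpath|apply isd_tau_translate|exact IP].
    + eapply Rle_trans; [apply BB; auto; apply Cmod_gt_0; lra|]. rewrite Hunit.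
      set (z := Cmod (gam (s + r) - gam t)) in *.
      assert (BDr := BD (s + r) ltac:(apply Rabs_le_between in Hrd; lra)).
      apply Rle_trans with (B * (1 + D * MM) / (c * u / 2) ^ 2).
      * replace (B * (1 + D * MM) / (c * u / 2) ^ 2) with (B * ((1 + D * MM) / (c * u / 2) ^ 2)) by (unfold Rdiv; ring).
        apply Rmult_le_compat_l; [lra|].
        replace (1 * 1 / z ^ 2 + Cmod (dtau (s + r)) / z) with ((1 + Cmod (dtau (s + r)) * z) / z ^ 2) by (field; lra).
        assert (Cmod (dtau (s + r)) * z <= D * MM) by (apply Rmult_le_compat; try lra; apply Cmod_ge_0).
        assert (0 <= D * MM) by (apply Rmult_le_pos; lra).
        apply Rdiv_le_weaken; try lra. split; [now apply pow_lt|]. apply pow_incr; lra.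
      * right. unfold Ka. field. lra.
  - intros rho d t Hr Hd Ht. set (u := Rabs (t - s)) in *.
    apply Rle_trans with (Kb / u * (d - 0) ^ 2).
    2:{ replace (Kb / u * (d - 0) ^ 2) with (Kb * d ^ 2 / u) by (field; lra).
        apply Rmult_le_compat_r; [apply Rlt_le, Rinv_0_lt_compat; lra|]. apply Rmult_le_compat_r; [apply pow2_ge_0|lra]. }
    assert (X := taylor_C (fun r => g0 rho (gam (s + r) - gam (t + r))) (fun r => g1 rho (gam (s + r) - gam (t + r)) (tau (s + r) - tau (t + r)))
      (fun r => g2 rho (gam (s + r) - gam (t + r)) (tau (s + r) - tau (t + r)) (tau (s + r) - tau (t + r)) (dtau (s + r) - dtau (t + r))) 0 d (Kb / u)).
    cbv beta in X. rewrite !Rplus_0_r, Rminus_0_r in X. rewrite Rminus_0_r. apply X.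
    intros r Hr'. apply Hbet in Hr'. assert (Hrd : Rabs r <= d0) by lra.
    destruct (Hz2 t r Hrd ltac:(fold u; lra)) as [Z1 Z2]. fold u in Z1.
    assert (CU : 0 < c * u) by (apply Rmult_lt_0_compat; lra).
    assert (IP : 0 < Im (qr e1 e2 rho (gam (s + r) - gam (t + r)))) by (apply Im_qr_pos; lra).
    split; [apply isd_G0; [apply Hpath2|exact IP]|]. split.
    + apply (isd_G1 k0 e1 e2 rho (fun r => gam (s + r) - gam (t + r))%C (fun r => tau (s + r) - tau (t + r))%C); [apply Hpath2| |exact IP].
      apply (isd_minus (fun r => tau (s + r)) (fun r => tau (t + r))); apply isd_tau_translate.
    + eapply Rle_trans; [apply BB; auto; apply Cmod_gt_0; lra|].
      set (z := Cmod (gam (s + r) - gam (t + r))) in *.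
      assert (V := Hv t r Hrd ltac:(fold u; lra)). fold u in V. set (v := Cmod (tau (s + r) - tau (t + r))) in *.
      assert (V0 : 0 <= v) by apply Cmod_ge_0.
      assert (Ub : -l <= t - s <= l) by (apply Rabs_le_between; fold u; lra).
      assert (Rb : -d0 <= r <= d0) by (apply Rabs_le_between; lra).
      assert (W : Cmod (dtau (s + r) - dtau (t + r)) <= 2 * D).
      { replace (2 * D) with (D + D) by ring. apply Cmod_minus_le; apply BD; lra. }
      unfold Kb. replace (B * (M ^ 2 * l / c ^ 2 + 2 * D / c) / u) with (B * (M ^ 2 * l / c ^ 2 / u + 2 * D / (c * u))) by (field; lra).
      apply Rmult_le_compat_l; [lra|]. apply Rplus_le_compat.
      * apply Rle_trans with ((M * u) * (M * u) / (c * u) ^ 2).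
        -- apply Rdiv_le_weaken; [apply Rmult_le_compat; lra|apply Rle_0_sqr|]. split; [now apply pow_lt|apply pow_incr; lra].
        -- replace (M * u * (M * u) / (c * u) ^ 2) with (M ^ 2 / c ^ 2) by (field; lra).
           replace (M ^ 2 * l / c ^ 2 / u) with (M ^ 2 / c ^ 2 * (l / u)) by (field; lra).
           rewrite <- (Rmult_1_r (M ^ 2 / c ^ 2)) at 1. apply Rmult_le_compat_l; [apply Rdiv_le_0_compat; lra|].
           apply Rle_div_r; lra.
      * apply Rdiv_le_weaken; lra.
  (* On the diagonal both chords vanish and the two values coincide; elsewhere the chord never
     vanishes along the motion and the mean value bound applies. *)
  - intros rho d t Hr Hd Ht. destruct (Req_dec t s) as [->|N].
    + replace (g0 rho (gam (s + d) - gam (s + d)) - g0 rho (gam s - gam s))%C with (RtoC 0).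
      * rewrite Cmod_0. apply Rmult_le_pos; [lra|apply Rabs_pos].
      * replace (gam (s + d) - gam (s + d))%C with (gam s - gam s)%C by ring. ring.
    + assert (Hu : 0 < Rabs (t - s)) by (apply Rabs_pos_lt; lra). set (u := Rabs (t - s)) in *.
      apply Rle_trans with (Kc * Rabs (d - 0)); [|rewrite Rminus_0_r; apply Rmult_le_compat_r; [apply Rabs_pos|lra]].
      assert (X := mvt_C_abs (fun r => g0 rho (gam (s + r) - gam (t + r))) (fun r => g1 rho (gam (s + r) - gam (t + r)) (tau (s + r) - tau (t + r))) 0 d Kc).
      cbv beta in X. rewrite !Rplus_0_r in X. apply X.
      intros r Hr'. apply Hbet in Hr'. assert (Hrd : Rabs r <= d0) by lra.
      destruct (Hz2 t r Hrd ltac:(fold u; lra)) as [Z1 Z2]. fold u in Z1.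
      assert (CU : 0 < c * u) by (apply Rmult_lt_0_compat; lra).
      assert (IP : 0 < Im (qr e1 e2 rho (gam (s + r) - gam (t + r)))) by (apply Im_qr_pos; lra).
      split; [apply isd_G0; [apply Hpath2|exact IP]|].
      eapply Rle_trans; [apply BA; auto; apply Cmod_gt_0; lra|].
      assert (V := Hv t r Hrd ltac:(fold u; lra)). fold u in V.
      unfold Kc. replace (A * M / c) with (A * (M * u) / (c * u)) by (field; lra).
      apply Rdiv_le_weaken; [apply Rmult_le_compat_l; lra| |lra]. repeat apply Rmult_le_pos; lra.
Qed.
(** The window stays centred at [s] while the target [s'] moves, so that two targets can be compared
    under one integral. *)
Definition Ik (rho : R) (s s' : R) : C := CI (fun t => g0 rho (gam s' - gam t) * psi t)%C (s - l) (s + l).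

(** The increment of the single layer is rewritten with the target moved alone against psi t - psi
    s, and with target and source moved together against the constant [psi s]. Below 2 |dl| the
    scale-free bound [G0_log_diff] times the oscillation is integrated; above it the first-order
    terms form exactly dl times [Yk]. All estimates are uniform in rho <= |dl|, so that rho can
    later tend to 0 with dl fixed. *)
Lemma tangential_estimate (s : R) : forall eps, 0 < eps -> exists d, 0 < d /\
  forall dl rho, 0 < Rabs dl < d -> 0 < rho <= Rabs dl ->
    Cmod (Ik rho s (s + dl) - Ik rho s s - RtoC dl * PVk s rho (2 * Rabs dl)) <= eps * Rabs dl.
Proof.
  intros eps He.
  destruct (along_bounds s) as [c [d0 [K [Hc [Hd0 [HK [Hch [HA1 [HA2 HA3]]]]]]]]].
  destruct (G0_log_diff k0 e1 e2 h1 h2) as [J [HJ HJB]].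
  destruct (oscillation_bounded s) as [W [HW BW]].
  set (w := oscillation s) in *. assert (NP := Cmod_ge_0 (psi s)). set (ps := Cmod (psi s)) in *.
  assert (D1 : d0 <= 1) by (eapply Rle_trans; [apply Hd0|apply Rmin_l]).
  assert (D2 : d0 <= l / 4) by (eapply Rle_trans; [apply Hd0|apply Rmin_r]).
  assert (SC : 0 < sqrt c) by (apply sqrt_lt_R0; lra).
  assert (HwV : vanishing w).
  { intros e Hpe. destruct (oscillation_small s e Hpe) as [d [Hd H]]. exists d; split; auto. intros; apply H; lra. }
  destruct (outer_small2 w l (K * (1 + ps) / 2) W Hl) with (eps := eps / 2) as [o [Ho Hout]]; auto; [nra|intros; apply BW; lra|lra|].
  (* Inner interval of length 4 a: the constant term gives 4, the two inverse square roots give 8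
     sqrt(4 a) sqrt a = 16 a over sqrt c. *)
  set (Q := J * (4 + 16 / sqrt c)). assert (HQ : 0 < Q).
  { apply Rmult_lt_0_compat; auto. assert (0 < 16 / sqrt c) by (apply Rdiv_lt_0_compat; lra). lra. }
  destruct (oscillation_small s (eps / (4 * Q))) as [d1 [Hd1 Hos]]; [apply Rdiv_lt_0_compat; lra|]. fold w in Hos.
  set (om := eps / (4 * Q)) in *. assert (Hom : 0 < om) by (apply Rdiv_lt_0_compat; lra).
  (* The joint motion contributes at most ps K a on length 4 a; this choice keeps it below a eps /
     4. *)
  set (d3 := eps / (16 * (ps * K + 1))). assert (HpK : 0 <= ps * K) by (apply Rmult_le_pos; lra).
  assert (Hd3 : 0 < d3) by (apply Rdiv_lt_0_compat; lra).
  exists (Rmin (Rmin d0 d3) (Rmin (o / 2) (d1 / 2))). split; [repeat apply Rmin_pos; lra|].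
  intros dl rho Hdl Hrho.
  assert (R1 := Rmin_l (Rmin d0 d3) (Rmin (o / 2) (d1 / 2))). assert (R2 := Rmin_r (Rmin d0 d3) (Rmin (o / 2) (d1 / 2))).
  assert (R3 := Rmin_l d0 d3). assert (R4 := Rmin_r d0 d3). assert (R5 := Rmin_l (o / 2) (d1 / 2)). assert (R6 := Rmin_r (o / 2) (d1 / 2)).
  set (a := Rabs dl) in *.
  set (Fa := fun t => g0 rho (gam (s + dl) - gam t)). set (Fb := fun t => g0 rho (gam s - gam t)).
  set (Fc := fun t => g0 rho (gam (s + dl) - gam (t + dl))).
  assert (Ga : forall x (t : R), ccont (fun t => g0 rho (gam x - gam t)) t).
  { intros x t. eapply g0_ccont; [apply isd_sub_gam|lra|]. assert (Y := Cmod_ge_0 (gam x - gam t)). lra. }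
  assert (CFa : forall t : R, ccont Fa t) by (intros; apply Ga).
  assert (CFb : forall t : R, ccont Fb t) by (intros; apply Ga).
  assert (CFc : forall t : R, ccont Fc t) by (intros; apply (ccont_shift Fa), CFa).
  set (X := fun t => ((Fa t - Fb t) * (psi t - psi s) + psi s * (Fc t - Fb t))%C).
  assert (CX : forall t : R, ccont X t).
  { intros t. apply (ccont_comb Fa Fb Fc psi (psi s)); auto. }
  (* [Fc] is [Fa] translated by dl, so over a full period both have the same integral. *)
  assert (Eac : CI Fc (s - l) (s + l) = CI Fa (s - l) (s + l)).
  { assert (Y1 := CI_periodic Fa (2 * l) (s - l + dl) (s - l) ltac:(lra) CFa).
    assert (Y2 := CI_shift Fa (s - l + dl) (s + l + dl) ltac:(lra) (fun t _ => CFa t) (- dl)).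
    replace (s - l + dl + - dl) with (s - l) in Y2 by ring. replace (s + l + dl + - dl) with (s + l) in Y2 by ring.
    replace (s - l + dl + 2 * l) with (s + l + dl) in Y1 by ring. replace (s - l + 2 * l) with (s + l) in Y1 by ring.
    rewrite <- Y1 by (intros t; unfold Fa; now rewrite Hper). rewrite <- Y2. apply CI_ext; [lra|].
    intros t _. unfold Fa, Fc. now replace (t - - dl) with (t + dl) by ring. }
  assert (EX : (Ik rho s (s + dl) - Ik rho s s)%C = CI X (s - l) (s + l)).
  { unfold X. rewrite (CI_comb Fa Fb Fc psi (psi s)) by (auto; lra). rewrite Eac.
    change (Ik rho s (s + dl)) with (CI (fun t => Fa t * psi t)%C (s - l) (s + l)).
    change (Ik rho s s) with (CI (fun t => Fb t * psi t)%C (s - l) (s + l)). ring. }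
  rewrite EX, (CI_split3 X s (2 * a)) by (try lra; intros t _; apply CX). unfold PVk.
  destruct (cont_on_outer (Yk s rho) s (2 * a)) as [Yo1 Yo2]; [lra|intros t Ht; apply Yk_ccont; lra|].
  assert (Hne : dl <> 0) by (intros E; unfold a in Hdl; rewrite E, Rabs_R0 in Hdl; lra).
  (* The outer remainder is of order a^2 / u^2; division by dl brings it to the form a / u^2
     required by [outer_small2]. *)
  set (f := fun t => (RtoC (/ dl) * (X t - RtoC dl * Yk s rho t))%C).
  assert (Hinv : (RtoC dl * RtoC (/ dl))%C = RtoC 1) by (rewrite <- RtoC_mult; f_equal; field; auto).
  assert (Ef : forall u v, u <= v -> cont_on (Yk s rho) u v -> (CI X u v - RtoC dl * CI (Yk s rho) u v)%C = (RtoC dl * CI f u v)%C).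
  { intros u v Huv Cy. unfold f. rewrite CI_scal; auto.
    - rewrite CI_minus, CI_scal; auto; [|intros t _; apply CX|].
      + rewrite Cmult_assoc, Hinv. ring.
      + intros t Ht. apply ccont_mult; [apply ccont_const|now apply Cy].
    - intros t Ht. apply ccont_minus; [apply CX|]. apply ccont_mult; [apply ccont_const|now apply Cy]. }
  match goal with |- Cmod ?E <= _ => replace E with
   (CI X (s - 2 * a) (s + 2 * a) + ((CI X (s - l) (s - 2 * a) - RtoC dl * CI (Yk s rho) (s - l) (s - 2 * a))
     + (CI X (s + 2 * a) (s + l) - RtoC dl * CI (Yk s rho) (s + 2 * a) (s + l))))%C by ring end.
  rewrite !Ef by (auto; lra).
  replace (eps * a) with (eps / 2 * a + a * (eps / 2)) by field. apply Cmod_plus_le.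
  - set (A' := J * om + ps * (K * a)). set (B' := J * om * (sqrt a / sqrt c)).
    assert (SA : 0 <= sqrt a) by apply sqrt_pos.
    assert (HJom : 0 < J * om) by (apply Rmult_lt_0_compat; lra).
    assert (HA' : 0 <= A'). { unfold A'. assert (0 <= ps * (K * a)); [|lra]. apply Rmult_le_pos; [lra|]. apply Rmult_le_pos; lra. }
    assert (HB' : 0 <= B'). { apply Rmult_le_pos; [lra|]. apply Rdiv_le_0_compat; lra. }
    assert (Bdl : -a <= dl <= a) by (apply Rabs_le_between; unfold a; lra).
    apply Rle_trans with (A' * (s + 2 * a - (s - 2 * a)) + 8 * B' * sqrt (s + 2 * a - (s - 2 * a))).
    + apply CI_bound_sqrt2 with (p := s + dl) (q := s) (h := rho); auto; try lra; [intros t _; apply CX|].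
      intros t Ht. assert (Hu : Rabs (t - s) <= 2 * a) by (apply Rabs_le; lra). assert (U0 := Rabs_pos (t - s)).
      assert (Za := Hch dl t ltac:(fold a; lra) ltac:(lra)). assert (Zb := Hch 0 t ltac:(rewrite Rabs_R0; lra) ltac:(lra)).
      rewrite Rplus_0_r in Zb. rewrite Rabs_minus_sym in Za, Zb.
      assert (Ua : Cmod (gam (s + dl) - gam t) <= 3 * a).
      { eapply Rle_trans; [apply lip|]. replace (s + dl - t) with (dl - (t - s)) by ring. unfold Rminus at 1.
        eapply Rle_trans; [apply Rabs_triang|]. rewrite Rabs_Ropp. fold a. lra. }
      assert (Ub : Cmod (gam s - gam t) <= 3 * a) by (eapply Rle_trans; [apply lip|]; rewrite Rabs_minus_sym; lra).
      assert (LD := HJB rho a _ _ Hrho ltac:(lra) Ua Ub). fold (Fa t) (Fb t) in LD.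
      assert (V : forall z x, c * Rabs x <= z -> sqrt (a / (z + rho)) <= sqrt a / sqrt c / sqrt (Rabs x + rho)).
      { intros z x Hx. assert (X0 := Rabs_pos x). assert (CX0 : 0 <= c * Rabs x) by (apply Rmult_le_pos; lra).
        replace (sqrt a / sqrt c / sqrt (Rabs x + rho)) with (sqrt a / (sqrt c * sqrt (Rabs x + rho))).
        2:{ assert (0 < sqrt (Rabs x + rho)) by (apply sqrt_lt_R0; lra). field. lra. }
        rewrite <- sqrt_mult by lra.
        assert (P0 : 0 < c * (Rabs x + rho)) by (apply Rmult_lt_0_compat; lra).
        rewrite <- sqrt_div_alt by auto. apply sqrt_le_1_alt. apply Rdiv_le_weaken; try lra.
        split; auto. rewrite Rmult_plus_distr_l. assert (c * rho <= 1 * rho) by (apply Rmult_le_compat_r; lra). lra. }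
      assert (Va := V _ _ Za). assert (Vb := V _ _ Zb).
      assert (Osc : Cmod (psi t - psi s) <= om).
      { eapply Rle_trans; [apply oscillation_psi|]. apply Hos. lra. }
      apply Rle_trans with (J * (1 + sqrt a / sqrt c / sqrt (Rabs (t - (s + dl)) + rho) + sqrt a / sqrt c / sqrt (Rabs (t - s) + rho)) * om + ps * (K * a)).
      * apply Cmod_plus_le; apply Cmod_mult_le; auto; [|unfold ps; lra|].
        -- eapply Rle_trans; [exact LD|]. apply Rmult_le_compat_l; lra.
        -- exact (HA3 rho dl t ltac:(lra) ltac:(fold a; lra) ltac:(lra)).
      * right. unfold A', B', Rdiv. ring.
    + replace (s + 2 * a - (s - 2 * a)) with (4 * a) by ring.
      assert (S4 : sqrt (4 * a) = 2 * sqrt a).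
      { rewrite sqrt_mult by lra. f_equal. replace 4 with (2 * 2) by ring. apply sqrt_square; lra. }
      rewrite S4.
      assert (SS := sqrt_sqrt a ltac:(lra)).
      replace (A' * (4 * a) + 8 * B' * (2 * sqrt a)) with (a * (Q * om) + 4 * a * (ps * K * a)).
      2:{ replace (8 * B' * (2 * sqrt a)) with (J * om * 16 / sqrt c * (sqrt a * sqrt a)) by (unfold B'; field; lra).
          rewrite SS. unfold A', Q. field. lra. }
      assert (Qo : Q * om = eps / 4) by (unfold om; field; lra).
      rewrite Qo.
      assert (T3 : ps * K * a <= eps / 16).
      { apply Rle_trans with ((ps * K + 1) * d3); [apply Rmult_le_compat; lra|]. right. unfold d3. field. lra. }
      assert (4 * a * (ps * K * a) <= 4 * a * (eps / 16)) by (apply Rmult_le_compat_l; lra). lra.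
  - rewrite <- Cmult_plus_distr_l, Cmod_mult, Cmod_R. fold a. apply Rmult_le_compat_l; [lra|].
    assert (Cf : forall u v, cont_on (Yk s rho) u v -> cont_on f u v).
    { intros u v Cy t Ht. apply ccont_mult; [apply ccont_const|]. apply ccont_minus; [apply CX|].
      apply ccont_mult; [apply ccont_const|now apply Cy]. }
    apply Hout; auto; [lra|].
    intros t Ht. set (u := Rabs (t - s)) in *.
    assert (Hu2 : (t - s) ^ 2 = u ^ 2) by (unfold u; now rewrite pow2_abs). rewrite Hu2.
    assert (U2 : 0 < u ^ 2) by (apply pow_lt; lra).
    assert (B1 := HA1 rho dl t ltac:(lra) ltac:(fold a; lra) ltac:(fold a u; lra) ltac:(fold u; lra)).
    assert (B2 := HA2 rho dl t ltac:(lra) ltac:(fold a; lra) ltac:(fold u; lra)).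
    fold u in B1, B2. assert (A2 : dl ^ 2 = a ^ 2) by (unfold a; now rewrite pow2_abs). rewrite A2 in B1, B2.
    unfold f. rewrite Cmod_mult, Cmod_R, Rabs_inv. fold a.
    replace (X t - RtoC dl * Yk s rho t)%C with
      ((Fa t - Fb t - RtoC dl * g1 rho (gam s - gam t) (tau s)) * (psi t - psi s)
       + psi s * (Fc t - Fb t - RtoC dl * g1 rho (gam s - gam t) (tau s - tau t)))%C by (unfold X, Yk; ring).
    assert (O1 := oscillation_psi s t). assert (O2 := oscillation_ge s u). fold u w in O1, O2.
    apply Rle_trans with (/ a * (K * a ^ 2 / u ^ 2 * w u + ps * (K * a ^ 2 / u ^ 2 * w u))).
    + apply Rmult_le_compat_l; [apply Rlt_le, Rinv_0_lt_compat; lra|].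
      apply Cmod_plus_le; apply Cmod_mult_le; auto; [unfold ps; lra|].
      eapply Rle_trans; [exact B2|]. replace (K * a ^ 2 / u) with (K * a ^ 2 / u ^ 2 * u) by (field; lra).
      apply Rmult_le_compat_l; auto. apply Rdiv_le_0_compat; auto. apply Rmult_le_pos; [lra|apply pow2_ge_0].
    + right. field. lra.
Qed.

(** At a fixed cutoff the chords are bounded below, so the regularization acts at rate rho^2; the
    constant may blow up as [h] shrinks, which is harmless since [h] is fixed before rho. *)
Lemma PVk_rho (s h : R) : 0 < h <= l -> exists K, 0 < K /\ forall rho, 0 <= rho <= 1 ->
  Cmod (PVk s rho h - PVk s 0 h) <= K * rho ^ 2.
Proof.
  intros Hh. destruct (G1_rho_bound k0 e1 e2 h1 h2 MM) as [B [HB BB]].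
  destruct (chord_arc' s) as [c [d0 [Hc [Hd0 Hch]]]].
  destruct (tau_diff_weight s) as [M [HM TW]].
  destruct (oscillation_bounded s) as [W [HW BW]].
  assert (NP := Cmod_ge_0 (psi s)). set (ps := Cmod (psi s)) in *.
  assert (CH : 0 < c * h) by (apply Rmult_lt_0_compat; lra). assert (CH3 : 0 < (c * h) ^ 3) by now apply pow_lt.
  set (K := B / (c * h) ^ 3 * W * (1 + ps * M)).
  assert (HK : 0 < K).
  { repeat apply Rmult_lt_0_compat; auto; [now apply Rinv_0_lt_compat|]. assert (0 <= ps * M) by (apply Rmult_le_pos; lra). lra. }
  exists (2 * l * K). split; [nra|]. intros rho Hr.
  destruct (cont_on_outer (Yk s rho) s h) as [Yo1 Yo2]; [lra|intros t Ht; apply Yk_ccont; lra|].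
  destruct (cont_on_outer (Yk s 0) s h) as [Zo1 Zo2]; [lra|intros t Ht; apply Yk_ccont; lra|].
  unfold PVk. match goal with |- Cmod ?E <= _ => replace E with
    ((CI (Yk s rho) (s - l) (s - h) - CI (Yk s 0) (s - l) (s - h)) + (CI (Yk s rho) (s + h) (s + l) - CI (Yk s 0) (s + h) (s + l)))%C by ring end.
  rewrite <- !CI_minus by (auto; lra).
  assert (R0 := pow2_ge_0 rho).
  assert (Bd : forall t, h <= Rabs (t - s) <= l -> Cmod (Yk s rho t - Yk s 0 t) <= K * rho ^ 2).
  { intros t Ht. set (u := Rabs (t - s)) in *.
    assert (Z := Hch 0 t ltac:(rewrite Rabs_R0; lra) ltac:(fold u; lra)). rewrite Rplus_0_r, Rabs_minus_sym in Z. fold u in Z.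
    assert (Z1 : c * h <= Cmod (gam s - gam t)) by (eapply Rle_trans; [|exact Z]; apply Rmult_le_compat_l; lra).
    assert (D : forall v, Cmod (g1 rho (gam s - gam t) v - g1 0 (gam s - gam t) v) <= B / (c * h) ^ 3 * rho ^ 2 * Cmod v).
    { intros v. eapply Rle_trans; [apply BB; auto; [apply Cmod_gt_0; lra|eapply Rle_trans; [apply lip|]; rewrite Rabs_minus_sym; fold u; lra]|].
      replace (B / (c * h) ^ 3 * rho ^ 2 * Cmod v) with (B * rho ^ 2 * Cmod v / (c * h) ^ 3) by (field; lra).
      assert (0 <= B * rho ^ 2 * Cmod v) by (apply Rmult_le_pos; [nra|apply Cmod_ge_0]).
      apply Rdiv_le_weaken; try lra. split; auto. apply pow_incr; lra. }
    unfold Yk. match goal with |- Cmod ?E <= _ => replace E with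
      ((g1 rho (gam s - gam t) (tau s) - g1 0 (gam s - gam t) (tau s)) * (psi t - psi s)
       + psi s * (g1 rho (gam s - gam t) (tau s - tau t) - g1 0 (gam s - gam t) (tau s - tau t)))%C by ring end.
    assert (O1 := oscillation_psi s t). assert (O2 := TW t ltac:(fold u; lra)). fold u in O1, O2. assert (O3 := BW u ltac:(lra)).
    assert (X0 : 0 <= B / (c * h) ^ 3 * rho ^ 2) by (apply Rmult_le_pos; [apply Rdiv_le_0_compat; lra|lra]).
    apply Rle_trans with (B / (c * h) ^ 3 * rho ^ 2 * 1 * W + ps * (B / (c * h) ^ 3 * rho ^ 2 * (M * W))).
    - apply Cmod_plus_le; apply Cmod_mult_le; try (unfold ps; lra).
      + eapply Rle_trans; [apply D|]. rewrite Hunit. lra.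
      + eapply Rle_trans; [apply D|]. apply Rmult_le_compat_l; auto. eapply Rle_trans; [exact O2|]. apply Rmult_le_compat_l; lra.
    - right. unfold K. ring. }
  replace (2 * l * K * rho ^ 2) with (K * rho ^ 2 * l + K * rho ^ 2 * l) by ring.
  assert (KR : 0 <= K * rho ^ 2) by (apply Rmult_le_pos; lra).
  apply Cmod_plus_le.
  - apply Rle_trans with (K * rho ^ 2 * (s - h - (s - l))); [|apply Rmult_le_compat_l; lra].
    apply CI_bound; [lra|intros t Ht; apply ccont_minus; [now apply Yo1|now apply Zo1]|].
    intros t Ht. apply Bd. rewrite Rabs_left1; lra.
  - apply Rle_trans with (K * rho ^ 2 * (s + l - (s + h))); [|apply Rmult_le_compat_l; lra].
    apply CI_bound; [lra|intros t Ht; apply ccont_minus; [now apply Yo2|now apply Zo2]|].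
    intros t Ht. apply Bd. rewrite Rabs_pos_eq; lra.
Qed.

(** * Convergence of the principal value under a Hoelder condition *)

Lemma vanishing_Rpower (K1 K2 al : R) : 0 <= K1 -> 0 <= K2 -> 0 < al -> vanishing (fun u => K1 * Rpower u al + K2 * u).
Proof.
  intros HK1 HK2 Hal eps He.
  set (x := eps / (2 * (K1 + 1))). assert (Hx : 0 < x) by (apply Rdiv_lt_0_compat; lra).
  set (y := eps / (2 * (K2 + 1))). assert (Hy : 0 < y) by (apply Rdiv_lt_0_compat; lra).
  set (p := Rpower x (/ al)). assert (Hp : 0 < p) by apply exp_pos.
  exists (Rmin p y). split; [now apply Rmin_pos|]. intros u Hu.
  assert (A1 := Rmin_l p y). assert (A2 := Rmin_r p y).
  assert (B1 : Rpower u al <= x).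
  { replace x with (Rpower p al).
    - apply Rle_Rpower_l; lra.
    - unfold p. rewrite Rpower_mult. replace (/ al * al) with 1 by (field; lra). now apply Rpower_1. }
  assert (B2 : K1 * Rpower u al <= (K1 + 1) * x) by (apply Rmult_le_compat; try lra; apply Rlt_le, exp_pos).
  assert (B3 : K2 * u <= (K2 + 1) * y) by (apply Rmult_le_compat; lra).
  replace ((K1 + 1) * x) with (eps / 2) in B2 by (unfold x; field; lra).
  replace ((K2 + 1) * y) with (eps / 2) in B3 by (unfold y; field; lra). lra.
Qed.

(** The majorant is the derivative of K1 u^al + K2 u, written with u^al / u so that the exponent
    stays al. *)
Lemma CI_bound_Rpower (f : R -> C) (s a b K1 K2 al : R) : 0 < a <= b -> 0 <= K1 -> 0 <= K2 -> 0 < al ->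
  cont_on f (s + a) (s + b) ->
  (forall t, s + a <= t <= s + b -> Cmod (f t) <= K1 * (al * Rpower (t - s) al / (t - s)) + K2) ->
  Cmod (CI f (s + a) (s + b)) <= K1 * Rpower b al + K2 * b.
Proof.
  intros Hab HK1 HK2 Hal Hc H.
  eapply Rle_trans.
  - apply (CI_bound_prim f (s + a) (s + b) ltac:(lra) Hc (fun t => K1 * Rpower (t - s) al + K2 * (t - s))
      (fun t => K1 * (al * Rpower (t - s) al / (t - s)) + K2)).
    intros t Ht. unfold Rpower. split; [|split].
    + auto_derive; [lra|]. change (t + - s) with (t - s). field. lra.
    + apply (ex_derive_continuous (V := R_NormedModule)). auto_derive. change (t + - s) with (t - s). repeat split; lra.
    + apply H; lra.
  - replace (s + b - s) with b by ring. replace (s + a - s) with a by ring.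
    assert (0 <= K1 * Rpower a al) by (apply Rmult_le_pos; [auto|apply Rlt_le, exp_pos]).
    assert (0 <= K2 * a) by (apply Rmult_le_pos; lra). lra.
Qed.

(** The first term of [Yk] is then of size u^(al - 1), which is integrable, and the second is
    bounded because tau s - tau t = O(u); shrinking the cutoff therefore gives a Cauchy family. *)
Lemma holder_limit (s M al : R) : 0 < al -> (forall t, Cmod (psi t - psi s) <= M * Rpower (Rabs (t - s)) al) ->
  exists J, forall eps, 0 < eps -> exists d, 0 < d /\ forall h, 0 < h < d -> Cmod (PVk s 0 h - J) <= eps.
Proof.
  intros Hal HM.
  destruct (chord_arc' s) as [c [d0 [Hc [Hd0 Hch]]]].
  destruct (G1_bound k0 e1 e2 h1 h2 MM) as [A [HA BA]].
  destruct (ctaylor s) as [N [HN T]]. assert (NP := Cmod_ge_0 (psi s)).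
  set (K1 := A * Rabs M / (c * al)). set (K2 := Cmod (psi s) * (A * N / c)).
  assert (HK1 : 0 <= K1).
  { assert (X := Rabs_pos M). apply Rdiv_le_0_compat; [nra|apply Rmult_lt_0_compat; lra]. }
  assert (HK2 : 0 <= K2). { apply Rmult_le_pos; auto. apply Rdiv_le_0_compat; nra. }
  assert (Bd : forall t, 0 < Rabs (t - s) <= l -> Cmod (Yk s 0 t) <= K1 * (al * Rpower (Rabs (t - s)) al / Rabs (t - s)) + K2).
  { intros t Ht. set (u := Rabs (t - s)) in *.
    assert (Z := Hch 0 t ltac:(rewrite Rabs_R0; lra) ltac:(fold u; lra)). rewrite Rplus_0_r, Rabs_minus_sym in Z. fold u in Z.
    assert (CU : 0 < c * u) by (apply Rmult_lt_0_compat; lra).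
    assert (D : forall v, Cmod (g1 0 (gam s - gam t) v) <= A / (c * u) * Cmod v).
    { intros v. eapply Rle_trans; [apply BA; [lra|apply Cmod_gt_0; lra|eapply Rle_trans; [apply lip|]; rewrite Rabs_minus_sym; fold u; lra]|].
      replace (A / (c * u) * Cmod v) with (A * Cmod v / (c * u)) by (field; lra).
      assert (0 <= A * Cmod v) by (apply Rmult_le_pos; [lra|apply Cmod_ge_0]). apply Rdiv_le_weaken; lra. }
    assert (AC : 0 <= A / (c * u)) by (apply Rdiv_le_0_compat; lra).
    unfold Yk.
    replace (K1 * (al * Rpower u al / u) + K2) with (A / (c * u) * 1 * (Rabs M * Rpower u al) + Cmod (psi s) * (A / (c * u) * (N * u)))
      by (unfold K1, K2; field; lra).
    apply Cmod_plus_le; apply Cmod_mult_le; try lra.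
    - eapply Rle_trans; [apply D|]. rewrite Hunit. lra.
    - eapply Rle_trans; [apply HM|]. fold u. apply Rmult_le_compat_r; [apply Rlt_le, exp_pos|apply Rle_abs].
    - eapply Rle_trans; [apply D|]. apply Rmult_le_compat_l; auto.
      destruct (T s t) as [X _]; [rewrite Rminus_diag, Rabs_R0; lra|fold u; lra|]. now rewrite Rabs_minus_sym in X. }
  assert (V := vanishing_Rpower (2 * K1) (2 * K2) al ltac:(lra) ltac:(lra) Hal).
  destruct (cauchy_modulus (PVk s 0) (fun u => 2 * K1 * Rpower u al + 2 * K2 * u) l Hl V) as [J HJ].
  - intros x y Hx Hy.
    destruct (cont_on_outer (Yk s 0) s x) as [Yo1 Yo2]; [lra|intros t Ht; apply Yk_ccont; lra|].
    unfold PVk. rewrite (CI_chasles (Yk s 0) (s - l) (s - x) Yo1 (s - y)) by lra.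
    rewrite (CI_chasles (Yk s 0) (s + x) (s + l) Yo2 (s + y)) by lra.
    match goal with |- Cmod ?E <= _ => replace E with (- (CI (Yk s 0) (s - y) (s - x) + CI (Yk s 0) (s + x) (s + y)))%C by ring end.
    rewrite Cmod_opp.
    replace (2 * K1 * Rpower y al + 2 * K2 * y) with ((K1 * Rpower y al + K2 * y) + (K1 * Rpower y al + K2 * y)) by ring.
    apply Cmod_plus_le.
    + rewrite <- (CI_refl (Yk s 0) (s - y) (s - x)) with (c := 2 * s); [|lra|intros t Ht; apply Yo1; lra].
      replace (2 * s - (s - x)) with (s + x) by ring. replace (2 * s - (s - y)) with (s + y) by ring.
      apply CI_bound_Rpower; auto.
      * intros t Ht. apply ccont_refl, Yo1; lra.
      * intros t Ht. assert (E : Rabs (2 * s - t - s) = t - s) by (rewrite Rabs_left1; lra).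
        rewrite <- E. apply Bd. lra.
    + apply CI_bound_Rpower; auto.
      * intros t Ht. apply Yo2; lra.
      * intros t Ht. assert (E : Rabs (t - s) = t - s) by (rewrite Rabs_pos_eq; lra).
        rewrite <- E. apply Bd. lra.
  - exists J. intros eps He. destruct (V eps He) as [d [Hd Hv]].
    exists (Rmin d l). split; [now apply Rmin_pos|]. intros h Hh.
    assert (A1 := Rmin_l d l). assert (A2 := Rmin_r d l).
    eapply Rle_trans; [apply HJ; lra|]. apply Hv; lra.
Qed.

(** * The single layer on the curve as a limit of proper integrals *)

Lemma quadratic_small (K eps : R) : 0 <= K -> 0 < eps -> exists d, 0 < d <= 1 /\ forall rho, 0 <= rho <= d -> K * rho ^ 2 <= eps.
Proof.
  intros HK He. exists (Rmin 1 (eps / (K + 1))). assert (A1 := Rmin_l 1 (eps / (K + 1))). assert (A2 := Rmin_r 1 (eps / (K + 1))).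
  assert (P : 0 < eps / (K + 1)) by (apply Rdiv_lt_0_compat; lra).
  split; [split; [apply Rmin_pos; lra|lra]|]. intros rho Hr.
  apply Rle_trans with ((K + 1) * (eps / (K + 1))); [|right; field; lra].
  apply Rmult_le_compat; try lra; [apply pow2_ge_0|].
  assert (rho * rho <= 1 * rho) by (apply Rmult_le_compat_r; lra). simpl. lra.
Qed.

Definition SL (m : R -> C) (s : R) : C := sing_int (2 * l) s (fun t => g0 0 (gam s - gam t) * m t)%C.

Lemma sl_exists (s : R) (m : R -> C) : (forall t, ccont m t) ->
  ex_sing_int (2 * l) s (fun t => g0 0 (gam s - gam t) * m t)%C.
Proof. intros Hm. apply (sl_limit s m Hm 1). lra. Qed.

(** [sl_limit] with h = rho: the end length [a] is chosen first, then rho small enough for the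
    kernels to agree on the chords longer than c a. *)
Lemma sl_rho (s : R) (m : R -> C) : (forall t, ccont m t) -> forall eps, 0 < eps -> exists d, 0 < d /\
  forall rho, 0 < rho < d -> Cmod (CI (fun t => g0 rho (gam s - gam t) * m t)%C s (s + 2 * l) - SL m s) <= eps.
Proof.
  intros Hm eps He.
  destruct (chord_arc' s) as [c [d0 [Hc [Hd0 Hch]]]].
  destruct (sl_limit s m Hm c Hc) as [_ [K [HK HL']]].
  destruct (G0_rho_bound k0 e1 e2 h1 h2 MM) as [A [HA BA]].
  destruct (small_sqrt K (eps / 2)) as [a0 [Ha0 Hs]]; [lra|lra|].
  set (a := Rmin a0 l). assert (A1 : a <= a0) by apply Rmin_l. assert (A2 : a <= l) by apply Rmin_r.
  assert (A3 : 0 < a) by now apply Rmin_pos.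
  assert (CA : 0 < (c * a) ^ 2) by (apply pow_lt, Rmult_lt_0_compat; lra).
  assert (AC : 0 <= K * A / (c * a) ^ 2) by (apply Rdiv_le_0_compat; nra).
  destruct (quadratic_small (K * A / (c * a) ^ 2) (eps / 2) AC) as [d [Hd Hq]]; [lra|].
  exists d. split; [lra|]. intros rho Hrho.
  assert (F1 : forall t, s <= t <= s + l -> c * (t - s) <= Cmod (gam s - gam t)).
  { intros t Ht. assert (X := Hch 0 t ltac:(rewrite Rabs_R0; lra) ltac:(rewrite Rabs_pos_eq; lra)).
    rewrite Rplus_0_r in X. rewrite Rabs_minus_sym, Rabs_pos_eq in X by lra. exact X. }
  assert (F2 : forall t, s + l <= t <= s + 2 * l -> c * (s + 2 * l - t) <= Cmod (gam s - gam t)).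
  { intros t Ht. assert (X := Hch 0 (t - 2 * l) ltac:(rewrite Rabs_R0; lra) ltac:(rewrite Rabs_left1; lra)).
    rewrite <- (Hper (t - 2 * l)) in X. replace (t - 2 * l + 2 * l) with t in X by ring.
    rewrite Rplus_0_r in X. rewrite Rabs_pos_eq in X by lra. now replace (s + 2 * l - t) with (s - (t - 2 * l)) by ring. }
  (* This is where c <= 1 is used: |z| + rho >= c (t - s + rho). *)
  assert (CR : c * rho <= 1 * rho) by (apply Rmult_le_compat_r; lra).
  eapply Rle_trans.
  - apply (HL' (fun t => gam s - gam t)%C rho rho a (A * rho ^ 2 / (c * a) ^ 2)); try lra.
    + intros t. exists (- tau t)%C. apply isd_sub_gam.
    + intros t Ht. eapply Rle_trans; [apply lip|]. rewrite Rabs_left1; lra.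
    + intros t Ht. rewrite Rmult_plus_distr_l. specialize (F1 t Ht). lra.
    + intros t Ht. rewrite Rmult_plus_distr_l. specialize (F2 t Ht). lra.
    + intros t Ht.
      assert (Z : c * a <= Cmod (gam s - gam t)).
      { destruct (Rle_dec t (s + l)).
        - eapply Rle_trans; [|apply F1; lra]. apply Rmult_le_compat_l; lra.
        - eapply Rle_trans; [|apply F2; lra]. apply Rmult_le_compat_l; lra. }
      assert (Z0 : 0 < c * a) by (apply Rmult_lt_0_compat; lra).
      eapply Rle_trans; [apply BA; [lra|apply Cmod_gt_0; lra|eapply Rle_trans; [apply lip|]; rewrite Rabs_left1; lra]|].
      assert (0 <= A * rho ^ 2) by (apply Rmult_le_pos; [lra|apply pow2_ge_0]).
      apply Rdiv_le_weaken; try lra. split; auto. apply pow_incr; lra.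
  - specialize (Hs a ltac:(lra)). specialize (Hq rho ltac:(lra)).
    replace (K * (A * rho ^ 2 / (c * a) ^ 2)) with (K * A / (c * a) ^ 2 * rho ^ 2) by (field; lra). lra.
Qed.

(** [sl_limit] with rho = 0 and the distance to the curve as offset. The logarithmic kernel is
    integrable, so the value is the same from both sides. *)
Lemma sl_normal (s : R) (nus : C) (m : R -> C) : tau s = (Ci * nus)%C -> (forall t, ccont m t) ->
  forall eps, 0 < eps -> exists d, 0 < d /\ forall h, 0 < Rabs h < d ->
    Cmod (CI (fun t => g0 0 (gam s + RtoC h * nus - gam t) * m t)%C s (s + 2 * l) - SL m s) <= eps.
Proof.
  intros Hnu Hm eps He.
  assert (Unu : Cmod nus = 1).
  { rewrite <- (Hunit s), Hnu, Cmod_mult, Cmod_Ci. ring. }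
  destruct (chord_normal (2 * l) gam tau dtau HL Hper Hsimple Hgam Htau Hdtau Hunit s nus Hnu) as [c0 [d0 [Hc0 [Hd0 Hch0]]]].
  replace (2 * l / 2) with l in Hch0 by field.
  set (c := Rmin c0 1). assert (C1 : c <= c0) by apply Rmin_l. assert (C2 : c <= 1) by apply Rmin_r.
  assert (C3 : 0 < c) by (apply Rmin_pos; lra).
  destruct (sl_limit s m Hm c ltac:(lra)) as [_ [K [HK HL']]].
  destruct (G1_bound k0 e1 e2 h1 h2 MM) as [A [HA BA]].
  destruct (small_sqrt K (eps / 2)) as [a0 [Ha0 Hs]]; [lra|lra|].
  set (a := Rmin a0 l). assert (A1 : a <= a0) by apply Rmin_l. assert (A2 : a <= l) by apply Rmin_r.
  assert (A3 : 0 < a) by now apply Rmin_pos.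
  assert (CA : 0 < c * a) by (apply Rmult_lt_0_compat; lra).
  set (q := eps / (2 * (K * A / (c * a) + 1))).
  assert (AC : 0 <= K * A / (c * a)) by (apply Rdiv_le_0_compat; nra).
  assert (Hq : 0 < q) by (apply Rdiv_lt_0_compat; lra).
  exists (Rmin d0 q). split; [apply Rmin_pos; lra|]. intros h Hh.
  assert (R1 := Rmin_l d0 q). assert (R2 := Rmin_r d0 q).
  set (Z := fun r t => (gam s + RtoC r * nus - gam t)%C).
  assert (Zper : forall r t, Z r (t - 2 * l) = Z r t).
  { intros r t. unfold Z. rewrite <- (Hper (t - 2 * l)). now replace (t - 2 * l + 2 * l) with t by ring. }
  assert (F0 : forall r t, Rabs r <= d0 -> Rabs (t - s) <= l -> c * (Rabs (t - s) + Rabs r) <= Cmod (Z r t)).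
  { intros r t Hr Ht. eapply Rle_trans; [|apply Hch0; auto]. apply Rmult_le_compat_r; [|lra].
    assert (X1 := Rabs_pos (t - s)). assert (X2 := Rabs_pos r). lra. }
  assert (F1 : forall r t, Rabs r <= d0 -> s <= t <= s + l -> c * (t - s + Rabs r) <= Cmod (Z r t)).
  { intros r t Hr Ht. assert (X := F0 r t Hr ltac:(rewrite Rabs_pos_eq; lra)). rewrite (Rabs_pos_eq (t - s)) in X by lra. exact X. }
  assert (F2 : forall r t, Rabs r <= d0 -> s + l <= t <= s + 2 * l -> c * (s + 2 * l - t + Rabs r) <= Cmod (Z r t)).
  { intros r t Hr Ht. assert (X := F0 r (t - 2 * l) Hr ltac:(rewrite Rabs_left1; lra)). rewrite Zper in X.
    rewrite (Rabs_left1 (t - 2 * l - s)) in X by lra. replace (s + 2 * l - t) with (- (t - 2 * l - s)) by ring. exact X. }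
  assert (FM : forall r t, Rabs r <= d0 -> s <= t <= s + 2 * l -> Cmod (Z r t) <= MM).
  { intros r t Hr Ht. unfold Z. replace (gam s + RtoC r * nus - gam t)%C with ((gam s - gam t) + RtoC r * nus)%C by ring.
    eapply Rle_trans; [apply Cmod_plus_le; [apply lip|apply Cmod_mult_le; apply Rle_refl]|].
    rewrite Cmod_R, Unu, (Rabs_left1 (s - t)) by lra. lra. }
  eapply Rle_trans.
  - apply (HL' (Z h) 0 (Rabs h) a (A / (c * a) * Rabs h)); try lra.
    + intros t. exists (- tau t)%C. apply isd_sub_gam.
    + intros t Ht. apply FM; lra.
    + intros t Ht. rewrite Rplus_0_r. apply F1; lra.
    + intros t Ht. rewrite Rplus_0_r. apply F2; lra.
    + intros t Ht.
      assert (ZL : forall r, Rabs r <= d0 -> c * a <= Cmod (Z r t)).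
      { intros r Hr. assert (X := Rabs_pos r). destruct (Rle_dec t (s + l)).
        - eapply Rle_trans; [|apply F1; lra]. apply Rmult_le_compat_l; lra.
        - eapply Rle_trans; [|apply F2; lra]. apply Rmult_le_compat_l; lra. }
      replace (gam s - gam t)%C with (gam s - gam t + RtoC 0 * nus)%C by ring.
      replace (Z h t) with (gam s - gam t + RtoC h * nus)%C by (unfold Z; ring).
      replace (Rabs h) with (Rabs (h - 0)) by (now rewrite Rminus_0_r).
      apply (mvt_C_abs (fun r => g0 0 (gam s - gam t + RtoC r * nus)) (fun r => g1 0 (gam s - gam t + RtoC r * nus) nus)).
      intros r Hr. assert (Hra : Rabs r <= d0).
      { apply Rle_trans with (Rabs h); [|lra]. revert Hr. unfold Rmin, Rmax, Rabs. repeat destruct Rle_dec; repeat destruct Rcase_abs; lra. }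
      assert (Er : (gam s - gam t + RtoC r * nus)%C = Z r t) by (unfold Z; ring).
      assert (Zr := ZL r Hra). split.
      * apply (isd_G0 k0 e1 e2 0 (fun r => gam s - gam t + RtoC r * nus)%C); [apply isd_path|].
        rewrite Er. apply Im_qr_pos; lra.
      * rewrite Er. eapply Rle_trans; [apply BA; [lra|apply Cmod_gt_0; lra|apply FM; lra]|].
        rewrite Unu. apply Rdiv_le_weaken; lra.
  - specialize (Hs a ltac:(lra)).
    assert (K * (A / (c * a) * Rabs h) <= eps / 2); [|lra].
    apply Rle_trans with ((K * A / (c * a) + 1) * q); [|right; unfold q; set (X := K * A / (c * a)) in *; clearbody X; field; lra].
    replace (K * (A / (c * a) * Rabs h)) with (K * A / (c * a) * Rabs h) by (field; lra).
    apply Rmult_le_compat; lra.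
Qed.

(** * Differentiability of the single layer along the curve *)

Hypothesis (Hpsiper : forall t, psi (t + 2 * l) = psi t).

(** For rho > 0 the integrand is continuous and periodic, so the window around [s] may be exchanged
    for the period starting at [s'], on which [SL] at [s'] is defined. *)
Lemma Ik_base (rho s s' : R) : 0 < rho -> Ik rho s s' = CI (fun t => g0 rho (gam s' - gam t) * psi t)%C s' (s' + 2 * l).
Proof.
  intros Hr. unfold Ik. replace (s + l) with (s - l + 2 * l) by ring. apply CI_periodic; [lra| |].
  - intros t. apply ccont_mult; [|apply Hpsi]. eapply g0_ccont; [apply isd_sub_gam|lra|].
    assert (Y := Cmod_ge_0 (gam s' - gam t)). lra.
  - intros t. now rewrite Hper, Hpsiper.
Qed.

(** The limit of [tangential_estimate] as rho tends to 0. The step dl is fixed first and rho is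
    chosen after it, so the constants of the three approximations may depend on dl. *)
Lemma SL_increment (s : R) : forall eps, 0 < eps -> exists d, 0 < d /\ forall dl, 0 < Rabs dl < d ->
  Cmod (SL psi (s + dl) - SL psi s - RtoC dl * PVk s 0 (2 * Rabs dl)) <= eps * Rabs dl.
Proof.
  intros eps He. destruct (tangential_estimate s (eps / 2) ltac:(lra)) as [d [Hd H]].
  exists (Rmin d (l / 2)). split; [apply Rmin_pos; lra|]. intros dl Hdl.
  assert (A1 := Rmin_l d (l / 2)). assert (A2 := Rmin_r d (l / 2)). set (a := Rabs dl) in *.
  (* A share eps a / 8 for each of the three passages to rho = 0: the two single layers and dl times
     the principal value. *)
  assert (He' : 0 < eps * a / 8) by (apply Rdiv_lt_0_compat; [nra|lra]).
  destruct (sl_rho s psi Hpsi _ He') as [r1 [Hr1 B1]]. destruct (sl_rho (s + dl) psi Hpsi _ He') as [r2 [Hr2 B2]].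
  destruct (PVk_rho s (2 * a)) as [K [HK B3]]; [lra|].
  destruct (quadratic_small (a * K) (eps * a / 8)) as [r3 [Hr3 B4]]; [nra|lra|].
  set (rho := Rmin (Rmin r1 r2 / 2) (Rmin r3 a)).
  assert (M0 : 0 < Rmin r1 r2) by now apply Rmin_pos.
  assert (M1 := Rmin_l r1 r2). assert (M2 := Rmin_r r1 r2). assert (M3 := Rmin_l r3 a). assert (M4 := Rmin_r r3 a).
  assert (M5 : rho <= Rmin r1 r2 / 2) by apply Rmin_l. assert (M6 : rho <= Rmin r3 a) by apply Rmin_r.
  assert (Hrho : 0 < rho) by (repeat apply Rmin_pos; lra).
  specialize (B1 rho ltac:(lra)). specialize (B2 rho ltac:(lra)). specialize (B3 rho ltac:(lra)). specialize (B4 rho ltac:(lra)).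
  specialize (H dl rho ltac:(fold a; lra) ltac:(fold a; lra)). fold a in H.
  rewrite !Ik_base in H by auto.
  set (I1 := CI (fun t => g0 rho (gam s - gam t) * psi t)%C s (s + 2 * l)) in *.
  set (I2 := CI (fun t => g0 rho (gam (s + dl) - gam t) * psi t)%C (s + dl) (s + dl + 2 * l)) in *.
  match goal with |- Cmod ?E <= _ => replace E with
    ((I2 - I1 - RtoC dl * PVk s rho (2 * a)) + (I1 - SL psi s) - (I2 - SL psi (s + dl)) + RtoC dl * (PVk s rho (2 * a) - PVk s 0 (2 * a)))%C by ring end.
  apply Rle_trans with (eps / 2 * a + eps * a / 8 + eps * a / 8 + eps * a / 8).
  - apply Cmod_plus_le; [apply Cmod_minus_le; [apply Cmod_plus_le|]|]; auto.
    eapply Rle_trans; [apply Cmod_mult_le; [apply Rle_refl|exact B3]|]. rewrite Cmod_R. fold a. lra.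
  - nra.
Qed.

Definition PV_lim (s : R) (D : C) : Prop :=
  forall eps, 0 < eps -> exists d, 0 < d /\ forall h, 0 < h < d -> Cmod (PVk s 0 h - D) <= eps.

(** [SL_increment] divided by dl: difference quotient and truncated principal value differ by o(1),
    so they converge together and to the same limit. *)
Lemma SL_derive_iff (s : R) (D : C) : isd (SL psi) s D <-> PV_lim s D.
Proof.
  split.
  - intros H eps He. destruct (proj1 (isd_eps _ _ _) H (eps / 2) ltac:(lra)) as [d1 [Hd1 B1]].
    destruct (SL_increment s (eps / 2) ltac:(lra)) as [d2 [Hd2 B2]].
    exists (Rmin d1 d2). split; [now apply Rmin_pos|]. intros h Hh.
    assert (A1 := Rmin_l d1 d2). assert (A2 := Rmin_r d1 d2).
    (* The step h / 2 corresponds to the cutoff h. *)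
    assert (Ph : Rabs (h / 2) = h / 2) by (apply Rabs_pos_eq; lra).
    specialize (B1 (s + h / 2)). replace (s + h / 2 - s) with (h / 2) in B1 by ring.
    specialize (B2 (h / 2)). rewrite Ph in B1, B2. replace (2 * (h / 2)) with h in B2 by field.
    specialize (B1 ltac:(lra)). specialize (B2 ltac:(lra)).
    assert (X : Cmod (RtoC (h / 2) * (PVk s 0 h - D)) <= eps / 2 * (h / 2) + eps / 2 * (h / 2)).
    { replace (RtoC (h / 2) * (PVk s 0 h - D))%C with
        ((SL psi (s + h / 2) - SL psi s - RtoC (h / 2) * D) - (SL psi (s + h / 2) - SL psi s - RtoC (h / 2) * PVk s 0 h))%C by ring.
      now apply Cmod_minus_le. }
    rewrite Cmod_mult, Cmod_R, Ph in X. apply Rmult_le_reg_l with (h / 2); lra.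
  - intros H. apply isd_eps. intros eps He.
    destruct (H (eps / 2) ltac:(lra)) as [d1 [Hd1 B1]].
    destruct (SL_increment s (eps / 2) ltac:(lra)) as [d2 [Hd2 B2]].
    exists (Rmin (d1 / 2) d2). split; [apply Rmin_pos; lra|]. intros u Hu.
    assert (A1 := Rmin_l (d1 / 2) d2). assert (A2 := Rmin_r (d1 / 2) d2).
    destruct (Req_dec u s) as [->|N].
    { rewrite Rminus_diag, Rabs_R0, Rmult_0_r. right.
      replace (SL psi s - SL psi s - 0 * D)%C with (RtoC 0) by ring. apply Cmod_0. }
    assert (Pu : 0 < Rabs (u - s)) by (apply Rabs_pos_lt; lra).
    specialize (B2 (u - s) ltac:(lra)). replace (s + (u - s)) with u in B2 by ring.
    specialize (B1 (2 * Rabs (u - s)) ltac:(lra)). set (a := Rabs (u - s)) in *.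
    replace (SL psi u - SL psi s - RtoC (u - s) * D)%C with
      ((SL psi u - SL psi s - RtoC (u - s) * PVk s 0 (2 * a)) + RtoC (u - s) * (PVk s 0 (2 * a) - D))%C by ring.
    replace (eps * a) with (eps / 2 * a + a * (eps / 2)) by field.
    apply Cmod_plus_le; auto. apply Cmod_mult_le; auto. rewrite Cmod_R. fold a. lra.
Qed.

Lemma Tk_lim_iff (s : R) (nus D : C) (sg : R) : tau s = (Ci * nus)%C -> sg = 1 \/ sg = -1 ->
  (forall eps, 0 < eps -> exists d, 0 < d /\ forall h, 0 < h < d -> Cmod (Tk s nus (sg * h) - D) <= eps) <-> PV_lim s D.
Proof.
  intros Hnu Hsg.
  assert (As : forall h, 0 < h -> Rabs (sg * h) = h).
  { intros h Hh. rewrite Rabs_mult, (Rabs_pos_eq h) by lra. destruct Hsg as [-> | ->]; [rewrite Rabs_R1|rewrite Rabs_m1]; ring. }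
  split.
  - intros H eps He. destruct (H (eps / 2) ltac:(lra)) as [d1 [Hd1 B1]].
    destruct (normal_limit s nus Hnu (eps / 2) ltac:(lra)) as [d2 [Hd2 B2]].
    exists (Rmin d1 d2). split; [now apply Rmin_pos|]. intros h Hh.
    assert (A1 := Rmin_l d1 d2). assert (A2 := Rmin_r d1 d2).
    specialize (B1 (h / 2) ltac:(lra)). specialize (B2 (sg * (h / 2))). rewrite As in B2 by lra.
    specialize (B2 ltac:(lra)). replace (2 * (h / 2)) with h in B2 by field.
    replace (PVk s 0 h - D)%C with ((Tk s nus (sg * (h / 2)) - D) - (Tk s nus (sg * (h / 2)) - PVk s 0 h))%C by ring.
    replace eps with (eps / 2 + eps / 2) by field. now apply Cmod_minus_le.
  - intros H eps He. destruct (H (eps / 2) ltac:(lra)) as [d1 [Hd1 B1]].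
    destruct (normal_limit s nus Hnu (eps / 2) ltac:(lra)) as [d2 [Hd2 B2]].
    exists (Rmin (d1 / 2) d2). split; [apply Rmin_pos; lra|]. intros h Hh.
    assert (A1 := Rmin_l (d1 / 2) d2). assert (A2 := Rmin_r (d1 / 2) d2).
    specialize (B1 (2 * h) ltac:(lra)). specialize (B2 (sg * h)). rewrite As in B2 by lra. specialize (B2 ltac:(lra)).
    replace (Tk s nus (sg * h) - D)%C with ((Tk s nus (sg * h) - PVk s 0 (2 * h)) + (PVk s 0 (2 * h) - D))%C by ring.
    replace eps with (eps / 2 + eps / 2) by field. now apply Cmod_plus_le.
Qed.
End Main.

(** * Maue's identity off the boundary *)

Lemma ccont_fst (f : R -> C) (t : R) : ccont f t -> ccont (fun u => RtoC (fst (f u))) t.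
Proof.
  intros H. apply ccont_eps. intros eps He. destruct (proj1 (ccont_eps _ _) H eps He) as [d [Hd K]].
  exists d; split; auto. intros u Hu. rewrite <- RtoC_minus, Cmod_R.
  eapply Rle_lt_trans; [apply (fst_le_Cmod (f u - f t))|auto].
Qed.

Lemma ccont_snd (f : R -> C) (t : R) : ccont f t -> ccont (fun u => RtoC (snd (f u))) t.
Proof.
  intros H. apply ccont_eps. intros eps He. destruct (proj1 (ccont_eps _ _) H eps He) as [d [Hd K]].
  exists d; split; auto. intros u Hu. rewrite <- RtoC_minus, Cmod_R.
  eapply Rle_lt_trans; [apply (snd_le_Cmod (f u - f t))|auto].
Qed.

Definition sp (z v : C) : C := (RtoC (fst z) * RtoC (fst v) + RtoC (snd z) * RtoC (snd v))%C.

Lemma Cmod_sp_le (z v : C) : Cmod (sp z v) <= 2 * (Cmod z * Cmod v).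
Proof.
  unfold sp. replace (2 * (Cmod z * Cmod v)) with (Cmod z * Cmod v + Cmod z * Cmod v) by ring.
  apply Cmod_plus_le; apply Cmod_mult_le; rewrite Cmod_R; try apply fst_le_Cmod; apply snd_le_Cmod.
Qed.

Lemma isd_sp (z : R -> C) (t : R) (v n : C) : isd z t v -> isd (fun u => sp (z u) n) t (sp v n).
Proof.
  intros H. eapply isd_eq.
  - apply (isd_plus (fun u => RtoC (fst (z u)) * RtoC (fst n))%C (fun u => RtoC (snd (z u)) * RtoC (snd n))%C).
    + apply (isd_mult (fun u => RtoC (fst (z u))) (fun _ => RtoC (fst n))); [apply isd_fst, H|apply isd_const].
    + apply (isd_mult (fun u => RtoC (snd (z u))) (fun _ => RtoC (snd n))); [apply isd_snd, H|apply isd_const].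
  - cbv beta. unfold sp. ring.
Qed.

Section OffBoundary.
Variables (k0 : R) (e1 e2 kap : C) (l : R) (gam n phi dphi : R -> C).
Hypotheses (h1 : 0 < Im e1) (h2 : 0 < Im e2)
  (Hl : 0 < l) (Hper : forall t, gam (t + 2 * l) = gam t)
  (Hgam : forall t : R, isd gam t (Ci * n t)%C)
  (Hn : forall t : R, ccont n t) (Hunit : forall t, Cmod (n t) = 1)
  (Hphi : forall t : R, isd phi t (dphi t)) (Hdphi : forall t : R, ccont dphi t)
  (Hphiper : forall t, phi (t + 2 * l) = phi t).

Local Notation g0 := (G0 k0 e1 e2).
Local Notation g1 := (G1 k0 e1 e2).
Local Notation q := (Qf e1 e2).
Local Notation b := (Bf e1 e2).

(** The conormal derivative in the source, up to a constant: the gradient of Q involves A^-1, which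
    the A of the conormal cancels, leaving the Euclidean product of z with the normal. [dlk1] and
    [dlk2] are its first and second derivatives when z moves in the fixed direction [e]. *)
Definition dlk (z v : C) : C := (K1 k0 (q z) * sp z v)%C.
Definition dlk1 (z e v : C) : C := (2 * K2 k0 (q z) * b z e * sp z v + K1 k0 (q z) * sp e v)%C.
Definition dlk2 (z e v : C) : C :=
  (4 * K3 k0 (q z) * (b z e * b z e) * sp z v + 2 * K2 k0 (q z) * (b e e * sp z v + 2 * b z e * sp e v))%C.

Lemma Qf_pos (z : C) : z <> RtoC 0 -> 0 < Im (q z).
Proof.
  intros H. rewrite <- qr_0. apply Im_qr_pos; auto; [|lra]. assert (A := proj1 (Cmod_gt_0 z) H). lra.
Qed.

Lemma isd_K1q (z : R -> C) (t : R) (v : C) : isd z t v -> z t <> RtoC 0 ->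
  isd (fun u => K1 k0 (q (z u))) t (2 * K2 k0 (q (z t)) * b (z t) v)%C.
Proof.
  intros Hz Hq. rewrite <- qr_0. apply is_derive_ext with (fun u => K1 k0 (qr e1 e2 0 (z u))).
  - intros u. now rewrite qr_0.
  - apply isd_K1qr; auto. rewrite qr_0. now apply Qf_pos.
Qed.

Lemma isd_K2q (z : R -> C) (t : R) (v : C) : isd z t v -> z t <> RtoC 0 ->
  isd (fun u => K2 k0 (q (z u))) t (2 * K3 k0 (q (z t)) * b (z t) v)%C.
Proof.
  intros Hz Hq. rewrite <- qr_0. apply is_derive_ext with (fun u => K2 k0 (qr e1 e2 0 (z u))).
  - intros u. now rewrite qr_0.
  - apply isd_K2qr; auto. rewrite qr_0. now apply Qf_pos.
Qed.

Lemma isd_dlk (z : R -> C) (t : R) (e v : C) : isd z t e -> z t <> RtoC 0 ->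
  isd (fun u => dlk (z u) v) t (dlk1 (z t) e v).
Proof.
  intros Hz Hq. unfold dlk. eapply isd_eq.
  - apply (isd_mult (fun u => K1 k0 (q (z u))) (fun u => sp (z u) v)); [apply isd_K1q; eassumption|apply isd_sp, Hz].
  - unfold dlk1. ring.
Qed.

Lemma isd_dlk1 (z : R -> C) (t : R) (e v : C) : isd z t e -> z t <> RtoC 0 ->
  isd (fun u => dlk1 (z u) e v) t (dlk2 (z t) e v).
Proof.
  intros Hz Hq. unfold dlk1. eapply isd_eq.
  - apply (isd_plus (fun u => 2 * K2 k0 (q (z u)) * b (z u) e * sp (z u) v)%C (fun u => K1 k0 (q (z u)) * sp e v)%C).
    + apply (isd_mult (fun u => 2 * K2 k0 (q (z u)) * b (z u) e)%C (fun u => sp (z u) v)); [|apply isd_sp, Hz].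
      apply (isd_mult (fun u => 2 * K2 k0 (q (z u)))%C (fun u => b (z u) e)).
      * apply isd_scal, isd_K2q; eassumption.
      * apply (isd_Bf e1 e2 z (fun _ => e)); [exact Hz|apply isd_const].
    + apply (isd_mult (fun u => K1 k0 (q (z u))) (fun _ => sp e v)); [apply isd_K1q; eassumption|apply isd_const].
  - cbv beta. unfold dlk2, Bf. simpl fst. simpl snd. rewrite !Rmult_0_r. ring.
Qed.

Lemma dlk2_bound (d M : R) : 0 < d -> exists K, forall z e v, d <= Cmod z <= M -> Cmod e <= 1 -> Cmod v <= 1 ->
  Cmod (dlk2 z e v) <= K.
Proof.
  intros Hd.
  destruct (K2_qr_bound k0 e1 e2 h1 h2 M) as [A2 [P2 B2]]. destruct (K3_qr_bound k0 e1 e2 h1 h2 M) as [A3 [P3 B3]].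
  assert (HE := EQ_pos e1 e2 h1 h2).
  eexists. intros z e v Hz He Hv.
  assert (Z0 : z <> RtoC 0) by (apply Cmod_gt_0; lra).
  assert (C2 : Cmod (K2 k0 (q z)) <= A2 / d ^ 4).
  { rewrite <- qr_0. eapply Rle_trans; [apply B2; auto; lra|]. apply Rdiv_le_weaken; try lra.
    split; [apply pow_lt; lra|apply pow_incr; lra]. }
  assert (C3 : Cmod (K3 k0 (q z)) <= A3 / d ^ 6).
  { rewrite <- qr_0. eapply Rle_trans; [apply B3; auto; lra|]. apply Rdiv_le_weaken; try lra.
    split; [apply pow_lt; lra|apply pow_incr; lra]. }
  assert (S : forall x y X, Cmod x <= X -> Cmod y <= 1 -> Cmod (sp x y) <= 2 * (X * 1)).
  { intros x y X Hx Hy. eapply Rle_trans; [apply Cmod_sp_le|]. apply Rmult_le_compat_l; [lra|].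
    apply Rmult_le_compat; auto; apply Cmod_ge_0. }
  assert (T : forall x y X, Cmod x <= X -> Cmod y <= 1 -> Cmod (b x y) <= EQ e1 e2 * (X * 1)).
  { intros x y X Hx Hy. eapply Rle_trans; [apply Cmod_Bf_le|]. apply Rmult_le_compat_l; [lra|].
    apply Rmult_le_compat; auto; apply Cmod_ge_0. }
  assert (S1 := S z v M ltac:(lra) Hv). assert (S2 := S e v 1 He Hv).
  assert (T1 := T z e M ltac:(lra) He). assert (T2 := T e e 1 He He).
  unfold dlk2. cbound.
Qed.

Variable x : C.
Hypothesis (Hx : forall t, gam t <> x).

Lemma off_dist : exists d M, 0 < d /\ forall t, d <= Cmod (x - gam t) <= M.
Proof.
  assert (Hc : forall a c, cont_on (fun t => x - gam t)%C a c).
  { intros a c t _. apply (ccont_minus (fun _ => x) gam); [apply ccont_const|eapply isd_ccont, Hgam]. }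
  destruct (ccont_min_pos (fun t => x - gam t)%C 0 (2 * l)) as [d [Hd Bd]]; [lra|apply Hc| |].
  { intros t _ E. apply (Hx t). symmetry. rewrite <- (Cplus_0_l (gam t)), <- E. ring. }
  destruct (ccont_bounded (fun t => x - gam t)%C 0 (2 * l)) as [M [HM BM]]; [lra|apply Hc|].
  exists d, M. split; auto. intros t. destruct (reduce_period (2 * l) ltac:(lra) t) as [k Hk].
  assert (E := periodic_IZR (2 * l) C gam Hper k t).
  rewrite <- E. split; [apply (Bd (t + IZR k * (2 * l)))|apply (BM (t + IZR k * (2 * l)))]; lra.
Qed.

Lemma off_neq (t : R) : (x - gam t)%C <> RtoC 0.
Proof. intros E. apply (Hx t). symmetry. rewrite <- (Cplus_0_l (gam t)), <- E. ring. Qed.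

Lemma isd_off (t : R) : isd (fun t => x - gam t)%C t (- (Ci * n t))%C.
Proof. eapply isd_eq; [apply (isd_minus (fun _ => x) gam); [apply isd_const|apply Hgam]|]. ring. Qed.

Lemma ccont_sp (z v : R -> C) (t : R) : ccont z t -> ccont v t -> ccont (fun t => sp (z t) (v t)) t.
Proof.
  intros Hz Hv. unfold sp.
  apply (ccont_plus (fun t => RtoC (fst (z t)) * RtoC (fst (v t)))%C (fun t => RtoC (snd (z t)) * RtoC (snd (v t)))%C).
  - apply (ccont_mult (fun t => RtoC (fst (z t))) (fun t => RtoC (fst (v t)))); apply ccont_fst; auto.
  - apply (ccont_mult (fun t => RtoC (snd (z t))) (fun t => RtoC (snd (v t)))); apply ccont_snd; auto.
Qed.

Lemma ccont_Bf (z v : R -> C) (t : R) : ccont z t -> ccont v t -> ccont (fun t => b (z t) (v t)) t.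
Proof.
  intros Hz Hv.
  apply ccont_ext_loc with (fun t => e1 * (RtoC (fst (z t)) * RtoC (fst (v t))) + e2 * (RtoC (snd (z t)) * RtoC (snd (v t))))%C 1; [lra| |].
  - intros u _. unfold Bf. now rewrite !RtoC_mult.
  - ccont_tac; first [apply ccont_fst|apply ccont_snd]; auto.
Qed.
Lemma off_ccont (t : R) : ccont (fun t => x - gam t)%C t.
Proof. eapply isd_ccont, isd_off. Qed.

Lemma K1_off_ccont (t : R) : ccont (fun t => K1 k0 (q (x - gam t))) t.
Proof. eapply isd_ccont, isd_K1q; [apply isd_off|apply off_neq]. Qed.

Lemma K2_off_ccont (t : R) : ccont (fun t => K2 k0 (q (x - gam t))) t.
Proof. eapply isd_ccont, isd_K2q; [apply isd_off|apply off_neq]. Qed.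

Lemma phi_ccont (t : R) : ccont phi t.
Proof. eapply isd_ccont, Hphi. Qed.

Lemma dlk_ccont (t : R) : ccont (fun t => dlk (x - gam t) (n t) * phi t)%C t.
Proof.
  apply (ccont_mult (fun t => dlk (x - gam t) (n t)) phi); [|apply phi_ccont].
  apply (ccont_mult (fun t => K1 k0 (q (x - gam t))) (fun t => sp (x - gam t) (n t))); [apply K1_off_ccont|].
  apply ccont_sp; [apply off_ccont|apply Hn].
Qed.

Lemma dlk1_ccont (e : C) (t : R) : ccont (fun t => dlk1 (x - gam t) e (n t) * phi t)%C t.
Proof.
  apply (ccont_mult (fun t => dlk1 (x - gam t) e (n t)) phi); [|apply phi_ccont]. unfold dlk1.
  apply (ccont_plus (fun t => 2 * K2 k0 (q (x - gam t)) * b (x - gam t) e * sp (x - gam t) (n t))%C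
    (fun t => K1 k0 (q (x - gam t)) * sp e (n t))%C).
  - apply (ccont_mult (fun t => 2 * K2 k0 (q (x - gam t)) * b (x - gam t) e)%C (fun t => sp (x - gam t) (n t))).
    + apply (ccont_mult (fun t => 2 * K2 k0 (q (x - gam t)))%C (fun t => b (x - gam t) e)).
      * apply (ccont_mult (fun _ => RtoC 2)); [apply ccont_const|apply K2_off_ccont].
      * apply (ccont_Bf (fun t => x - gam t)%C (fun _ => e)); [apply off_ccont|apply ccont_const].
    + apply ccont_sp; [apply off_ccont|apply Hn].
  - apply (ccont_mult (fun t => K1 k0 (q (x - gam t))) (fun t => sp e (n t))); [apply K1_off_ccont|].
    apply (ccont_sp (fun _ => e) n); [apply ccont_const|apply Hn].
Qed.

(** Differentiation under the integral sign: for |r| <= d / 2 the displaced point keeps distance d /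
    2 from the curve, where [dlk2] is bounded, and [taylor_C] yields the uniform remainder. *)
Lemma isd_double_layer (e : C) : Cmod e <= 1 ->
  isd (fun r => CI (fun t => dlk (x + RtoC r * e - gam t) (n t) * phi t)%C 0 (2 * l)) 0
    (CI (fun t => dlk1 (x - gam t) e (n t) * phi t)%C 0 (2 * l)).
Proof.
  intros He. destruct off_dist as [d [M [Hd HdM]]].
  destruct (dlk2_bound (d / 2) (M + d) ltac:(lra)) as [K HK].
  destruct (ccont_bounded phi 0 (2 * l)) as [P [HP BP]]; [lra|intros t _; apply phi_ccont|].
  assert (Hr : forall r t, Rabs r <= d / 2 -> d / 2 <= Cmod (x + RtoC r * e - gam t) <= M + d).
  { intros r t Hr. assert (A := HdM t).
    replace (x + RtoC r * e - gam t)%C with ((x - gam t) + RtoC r * e)%C by ring.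
    assert (B : Cmod (RtoC r * e) <= d / 2 * 1) by (apply Cmod_mult_le; auto; now rewrite Cmod_R).
    assert (X1 := Cmod_sub_ge (x - gam t) (RtoC r * e)). assert (X2 := Cmod_triangle (x - gam t) (RtoC r * e)). lra. }
  assert (Hne : forall r t, Rabs r <= d / 2 -> (x + RtoC r * e - gam t)%C <> RtoC 0).
  { intros r t Hr'. apply Cmod_gt_0. assert (A := Hr r t Hr'). lra. }
  assert (Hpath : forall r t, isd (fun r => x + RtoC r * e - gam t)%C r e).
  { intros r t. eapply isd_eq; [apply (isd_minus (fun r => x + RtoC r * e)%C (fun _ => gam t)); [apply isd_path|apply isd_const]|]. ring. }
  apply (isd_CI_param (fun r t => dlk (x + RtoC r * e - gam t) (n t) * phi t)%C
    (fun t => dlk1 (x - gam t) e (n t) * phi t)%C 0 (2 * l) 0 (d / 2) (K * P)); try lra.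
  - intros u Hu t _. rewrite Rminus_0_r in Hu.
    apply (ccont_mult (fun t => dlk (x + RtoC u * e - gam t) (n t)) phi); [|apply phi_ccont].
    assert (Z : isd (fun t => x + RtoC u * e - gam t)%C t (- (Ci * n t))%C).
    { eapply isd_eq; [apply (isd_minus (fun _ => x + RtoC u * e)%C gam); [apply isd_const|apply Hgam]|]. ring. }
    apply (ccont_mult (fun t => K1 k0 (q (x + RtoC u * e - gam t))) (fun t => sp (x + RtoC u * e - gam t) (n t))).
    + eapply isd_ccont, (isd_K1q (fun t => x + RtoC u * e - gam t)%C); [exact Z|apply Hne; lra].
    + apply (ccont_sp (fun t => x + RtoC u * e - gam t)%C n); [eapply isd_ccont, Z|apply Hn].
  - intros t _. apply dlk1_ccont.
  - intros u t Hu Ht. rewrite Rminus_0_r in Hu.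
    match goal with |- Cmod ?X <= _ => replace X with
      ((dlk (x + RtoC u * e - gam t) (n t) - dlk (x + RtoC 0 * e - gam t) (n t) - RtoC (u - 0) * dlk1 (x + RtoC 0 * e - gam t) e (n t)) * phi t)%C end.
    2:{ replace (x + RtoC 0 * e - gam t)%C with (x - gam t)%C by ring. ring. }
    replace (K * P * (u - 0) ^ 2) with (K * (u - 0) ^ 2 * P) by ring.
    apply Cmod_mult_le; [|now apply BP].
    apply (taylor_C (fun r => dlk (x + RtoC r * e - gam t) (n t)) (fun r => dlk1 (x + RtoC r * e - gam t) e (n t))
      (fun r => dlk2 (x + RtoC r * e - gam t) e (n t))).
    intros r Hr'. assert (Hra : Rabs r <= d / 2).
    { apply Rle_trans with (Rabs u); [|lra]. revert Hr'. unfold Rmin, Rmax, Rabs. repeat destruct Rle_dec; repeat destruct Rcase_abs; lra. }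
    split; [|split].
    + apply (isd_dlk (fun r => x + RtoC r * e - gam t)%C); [apply Hpath|now apply Hne].
    + apply (isd_dlk1 (fun r => x + RtoC r * e - gam t)%C); [apply Hpath|now apply Hne].
    + apply HK; auto. rewrite Hunit. lra.
Qed.

Definition conormal_product (nus v : C) : C := dot (cplx nus) (mulA e1 e2 (cplx v)).

(* Maue's identity at the level of the kernel; the Bessel equation [K_ode] removes the pure second derivatives. *)
Lemma maue_pointwise (z v nus : C) : z <> RtoC 0 ->
  (-2 * (RtoC (fst nus) / e1 * dlk1 z 1 v + RtoC (snd nus) / e2 * dlk1 z Ci v))%C
  = (1 / (e1 * e2) * (-1 * G2 k0 e1 e2 0 z (- (Ci * v)) (Ci * nus) 0) + RtoC (k0 ^ 2) * (g0 0 z * conormal_product nus v))%C.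
Proof.
  intros Hz. assert (Q0 := neq0_of_Im _ (Qf_pos z Hz)). assert (O := K_ode k0 (q z) Q0).
  assert (E1 := neq0_of_Im _ h1). assert (E2 := neq0_of_Im _ h2).
  unfold G2, G0, dlk1. rewrite qr_0.
  (* The Bessel equation trades k0^2 K0 for K1 and K2. These two values are then treated as
     independent unknowns, and the identity becomes rational in the coordinates. *)
  assert (O' : (RtoC (k0 ^ 2) * (K0 k0 (q z) * conormal_product nus v))%C
     = (- (4 * (q z * K2 k0 (q z) + K1 k0 (q z))) * conormal_product nus v)%C) by (rewrite O; ring).
  rewrite O'. generalize (K1 k0 (q z)) (K2 k0 (q z)) . intros k1 k2.
  unfold conormal_product, dot, mulA, cplx, sp, Bf, Qf.
  destruct z as [z1 z2], v as [v1 v2], nus as [u1 u2]. simpl.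
  repeat rewrite ?RtoC_mult, ?RtoC_plus, ?RtoC_minus, ?RtoC_opp.
  field. auto.
Qed.

(** The pointwise identity integrated over a period; the derivative along the curve moves from the
    kernel to the density, which is why [dphi] appears. *)
Lemma maue_off_boundary (nus : C) :
  (-2 * (RtoC (fst nus) / e1 * CI (fun t => dlk1 (x - gam t) 1 (n t) * phi t) 0 (2 * l)
     + RtoC (snd nus) / e2 * CI (fun t => dlk1 (x - gam t) Ci (n t) * phi t) 0 (2 * l)))%C
  = (1 / (e1 * e2) * CI (fun t => g1 0 (x - gam t) (Ci * nus) * dphi t) 0 (2 * l)
     + RtoC (k0 ^ 2) * CI (fun t => g0 0 (x - gam t) * (phi t * conormal_product nus (n t))) 0 (2 * l))%C.
Proof.
  assert (Hq : forall t, 0 < Im (qr e1 e2 0 (x - gam t))) by (intros; rewrite qr_0; apply Qf_pos, off_neq).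
  set (A := fun t => (G2 k0 e1 e2 0 (x - gam t) (- (Ci * n t)) (Ci * nus) 0 * phi t)%C).
  set (B := fun t => (g1 0 (x - gam t) (Ci * nus) * dphi t)%C).
  set (P := fun t => (g0 0 (x - gam t) * (phi t * conormal_product nus (n t)))%C).
  assert (G1i : forall t, isd (fun t => g1 0 (x - gam t) (Ci * nus)) t (G2 k0 e1 e2 0 (x - gam t) (- (Ci * n t)) (Ci * nus) 0)).
  { intros t. apply (isd_G1 k0 e1 e2 0 (fun t => x - gam t)%C (fun _ => Ci * nus)%C); [apply isd_off|apply isd_const|apply Hq]. }
  assert (CB : forall t, ccont B t).
  { intros t. apply (ccont_mult (fun t => g1 0 (x - gam t) (Ci * nus)) dphi); [eapply isd_ccont, G1i|apply Hdphi]. }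
  assert (CP : forall t, ccont P t).
  { intros t. apply (ccont_mult (fun t => g0 0 (x - gam t)) (fun t => phi t * conormal_product nus (n t)))%C.
    - eapply isd_ccont, isd_G0; [apply isd_off|apply Hq].
    - apply (ccont_mult phi (fun t => conormal_product nus (n t))); [apply phi_ccont|].
      unfold conormal_product, dot, mulA, cplx, Cdiv. simpl fst. simpl snd.
      ccont_tac; first [apply ccont_fst|apply ccont_snd]; apply Hn. }
  assert (CA : forall t, ccont A t).
  { intros t. apply (ccont_mult (fun t => G2 k0 e1 e2 0 (x - gam t) (- (Ci * n t)) (Ci * nus) 0) phi); [|apply phi_ccont].
    apply ccont_ext_loc with (fun t => 4 * K2 k0 (q (x - gam t)) * b (x - gam t) (RtoC (-1) * (Ci * n t)) * b (x - gam t) (Ci * nus)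
       + 2 * K1 k0 (q (x - gam t)) * (b (RtoC (-1) * (Ci * n t)) (Ci * nus) + b (x - gam t) 0))%C 1; [lra| |].
    { intros u _. unfold G2. rewrite qr_0. now replace (RtoC (-1) * (Ci * n u))%C with (- (Ci * n u))%C by ring. }
    assert (Cn : ccont (fun t => RtoC (-1) * (Ci * n t))%C t) by (ccont_tac; apply Hn).
    ccont_tac.
    - apply K2_off_ccont.
    - apply (ccont_Bf (fun t => x - gam t)%C (fun t => RtoC (-1) * (Ci * n t))%C); [apply off_ccont|exact Cn].
    - apply (ccont_Bf (fun t => x - gam t)%C (fun _ => Ci * nus)%C); [apply off_ccont|apply ccont_const].
    - apply K1_off_ccont.
    - apply (ccont_Bf (fun t => RtoC (-1) * (Ci * n t))%C (fun _ => Ci * nus)%C); [exact Cn|apply ccont_const].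
    - apply (ccont_Bf (fun t => x - gam t)%C (fun _ => RtoC 0)); [apply off_ccont|apply ccont_const]. }
  assert (IA := CI_correct A 0 (2 * l) ltac:(lra) (fun t _ => CA t)).
  assert (IB := CI_correct B 0 (2 * l) ltac:(lra) (fun t _ => CB t)).
  assert (IP := CI_correct P 0 (2 * l) ltac:(lra) (fun t _ => CP t)).
  assert (I1 := CI_correct _ 0 (2 * l) ltac:(lra) (fun t _ => dlk1_ccont 1 t)).
  assert (I2 := CI_correct _ 0 (2 * l) ltac:(lra) (fun t _ => dlk1_ccont Ci t)).
  (* A + B is the derivative of the periodic function [g1 * phi], so there is no boundary term. *)
  assert (AB : CI A 0 (2 * l) = (- CI B 0 (2 * l))%C).
  { assert (Z : (CI A 0 (2 * l) + CI B 0 (2 * l))%C = RtoC 0).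
    { rewrite <- CI_plus; [|lra|intros t _; apply CA|intros t _; apply CB].
      rewrite (CI_derive (fun t => g1 0 (x - gam t) (Ci * nus) * phi t)%C).
      - rewrite <- (Rplus_0_l (2 * l)), Hper, Hphiper. ring.
      - lra.
      - intros t _. apply (isd_mult (fun t => g1 0 (x - gam t) (Ci * nus)) phi); [apply G1i|apply Hphi].
      - intros t _. apply (ccont_plus A B); auto. }
    rewrite <- (Cplus_0_l (- CI B 0 (2 * l))), <- Z. ring. }
  assert (U1 := isI_scal (-2) _ _ _ _ (isI_plus _ _ _ _ _ _ (isI_scal (RtoC (fst nus) / e1) _ _ _ _ I1) (isI_scal (RtoC (snd nus) / e2) _ _ _ _ I2))).
  assert (U2 := isI_plus _ _ _ _ _ _ (isI_scal (1 / (e1 * e2)) _ _ _ _ (isI_scal (-1) _ _ _ _ IA)) (isI_scal (RtoC (k0 ^ 2)) _ _ _ _ IP)).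
  cbv beta in U1, U2.
  apply CI_unique in U1. apply CI_unique in U2. etransitivity; [symmetry; exact U1|].
  transitivity (1 / (e1 * e2) * (-1 * CI A 0 (2 * l)) + RtoC (k0 ^ 2) * CI P 0 (2 * l))%C; [|rewrite AB; fold B P; ring].
  etransitivity; [|exact U2]. apply CI_ext; [lra|]. intros t _. unfold A, P.
  assert (W := maue_pointwise (x - gam t)%C (n t) nus (off_neq t)).
  transitivity (-2 * (RtoC (fst nus) / e1 * dlk1 (x - gam t) 1 (n t) + RtoC (snd nus) / e2 * dlk1 (x - gam t) Ci (n t)) * phi t)%C; [ring|].
  rewrite W. ring.
Qed.
End OffBoundary.

(** * The double layer potential *)

Definition kappa (e1 e2 : C) : C := (Ci / 4 * Csqrt (e1 * e2))%C.

Lemma Phi_G0 (k0 : R) (e1 e2 : C) (x y : C) : 0 < k0 -> 0 < Im e1 -> 0 < Im e2 -> (x - y)%C <> RtoC 0 ->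
  Phi k0 e1 e2 x y = (kappa e1 e2 * G0 k0 e1 e2 0 (x - y))%C.
Proof.
  intros Hk h1 h2 H. unfold Phi, kappa, G0. rewrite qr_0. rewrite <- (hankel_K0 k0) by (auto; now apply Qf_pos). reflexivity.
Qed.

Lemma isd_affine (f : R -> C) (x e : C) (t : R) : (forall u, f u = (x + RtoC (u - t) * e)%C) -> isd f t e.
Proof.
  intros H. apply is_derive_ext with (fun u => x + RtoC (u - t) * e)%C; [intros; now rewrite H|].
  eapply isd_eq; [apply (isd_plus (fun _ => x) (fun u => RtoC (u - t) * e)%C);
    [apply isd_const|apply (isd_mult (fun u => RtoC (u - t)) (fun _ => e)); [apply isd_id_minus|apply isd_const]]|].
  cbv beta. ring.
Qed.

(** Stated for an arbitrary straight path so that e = 1 and e = i give the two partial derivatives.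
    The minus sign comes from differentiating in the source. *)
Lemma CDerive_Phi (k0 : R) (e1 e2 : C) (x y e : C) (p : R -> C) (t : R) : 0 < k0 -> 0 < Im e1 -> 0 < Im e2 ->
  (x - y)%C <> RtoC 0 -> (forall u, p u = (y + RtoC (u - t) * e)%C) ->
  CDerive (fun u => Phi k0 e1 e2 x (p u)) t = (- (kappa e1 e2 * G1 k0 e1 e2 0 (x - y) e))%C.
Proof.
  intros Hk h1 h2 H Hp. apply CDerive_unique.
  assert (Pt : p t = y) by (rewrite Hp, Rminus_diag; ring).
  assert (Z : isd (fun u => x - p u)%C t (- e)%C).
  { eapply isd_eq; [apply (isd_minus (fun _ => x) p); [apply isd_const|now apply isd_affine with y]|]. ring. }
  assert (IP : 0 < Im (qr e1 e2 0 (x - p t))) by (rewrite qr_0, Pt; now apply Qf_pos).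
  assert (L := isd_Im_locally _ _ _ (isd_qr e1 e2 0 _ _ _ Z) IP).
  (* The representation by [G0] holds only for distinct points, and nearby points of the path still
     differ from x. *)
  apply is_derive_ext_loc with (fun u => kappa e1 e2 * G0 k0 e1 e2 0 (x - p u))%C.
  - revert L. apply filter_imp. intros u Hu. symmetry. apply Phi_G0; auto.
    intros E. rewrite E in Hu. rewrite Im_qr in Hu. simpl in Hu. lra.
  - eapply isd_eq.
    + apply isd_scal. apply (isd_G0 k0 e1 e2 0 (fun u => x - p u)%C); [exact Z|exact IP].
    + rewrite Pt. unfold G1, Bf. simpl. rewrite <- !Ropp_mult_distr_r, !RtoC_opp. ring.
Qed.

Lemma grad_Phi (k0 : R) (e1 e2 : C) (x y : C) : 0 < k0 -> 0 < Im e1 -> 0 < Im e2 -> (x - y)%C <> RtoC 0 ->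
  grad (Phi k0 e1 e2 x) y = ((- (kappa e1 e2 * G1 k0 e1 e2 0 (x - y) 1))%C, (- (kappa e1 e2 * G1 k0 e1 e2 0 (x - y) Ci))%C).
Proof.
  intros Hk h1 h2 H. unfold grad. f_equal.
  - apply (CDerive_Phi k0 e1 e2 x y 1 (fun u => (u, snd y))); auto.
    intros u. apply injective_projections; simpl; ring.
  - apply (CDerive_Phi k0 e1 e2 x y Ci (fun u => (fst y, u))); auto.
    intros u. apply injective_projections; simpl; ring.
Qed.

Lemma dot_grad_Phi (k0 : R) (e1 e2 : C) (x y v : C) : 0 < k0 -> 0 < Im e1 -> 0 < Im e2 -> (x - y)%C <> RtoC 0 ->
  dot (grad (Phi k0 e1 e2 x) y) (mulA e1 e2 (cplx v)) = (-2 * kappa e1 e2 * dlk k0 e1 e2 (x - y) v)%C.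
Proof.
  intros Hk h1 h2 H. rewrite grad_Phi by auto. unfold dot, mulA, cplx, G1, dlk, sp, Bf. rewrite qr_0.
  assert (E1 := neq0_of_Im _ h1). assert (E2 := neq0_of_Im _ h2).
  generalize (K1 k0 (Qf e1 e2 (x - y))) (kappa e1 e2). intros k kp. destruct v as [v1 v2].
  generalize (x - y)%C. intros [z1 z2]. simpl. rewrite !RtoC_mult. field. auto.
Qed.

(** Equality is asked only inside the open interval, since [Phi] is identified with [kappa * G0]
    only off the diagonal and the improper integral never evaluates at the endpoints. *)
Lemma sing_int_ext (f g : R -> C) (L s : R) : 0 < L -> (forall t, s < t < s + L -> f t = g t) -> ex_sing_int L s f ->
  ex_sing_int L s g /\ sing_int L s g = sing_int L s f.
Proof.
  intros HL E [J HJ].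
  assert (HJ' : is_RInt_gen (V := C_R_NormedModule) g (at_right s) (at_left (s + L)) J).
  { apply (is_RInt_gen_ext (V := C_R_NormedModule) f g J); auto.
    assert (HL2 : 0 < L / 2) by lra.
    apply Filter_prod with (Q := fun x => s < x < s + L / 2) (R := fun x => s + L / 2 < x < s + L).
    - exists (mkposreal _ HL2). intros y Hy Hy'. unfold ball in Hy; simpl in Hy;
      unfold AbsRing_ball, abs, minus, plus, opp in Hy; simpl in Hy. apply Rabs_def2 in Hy. lra.
    - exists (mkposreal _ HL2). intros y Hy Hy'. unfold ball in Hy; simpl in Hy;
      unfold AbsRing_ball, abs, minus, plus, opp in Hy; simpl in Hy. apply Rabs_def2 in Hy. lra.
    - intros x y Hx Hy t Ht. simpl in Ht. apply E. revert Ht. unfold Rmin, Rmax. destruct Rle_dec; lra. }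
  split; [now exists J|]. unfold sing_int.
  rewrite (is_RInt_gen_unique (V := C_R_CompleteNormedModule) f J HJ).
  apply (is_RInt_gen_unique (V := C_R_CompleteNormedModule) g J HJ').
Qed.

Lemma filterlim_at_right0_C (f : R -> C) (z : C) :
  filterlim f (at_right 0) (locally (T := C_UniformSpace) z) <->
  forall eps, 0 < eps -> exists d, 0 < d /\ forall h, 0 < h < d -> Cmod (f h - z) <= eps.
Proof.
  split.
  - intros H eps He.
    assert (HP : locally (T := C_UniformSpace) z (fun y => Cmod (y - z) <= eps)).
    { refine (proj2 (locally_Cmod_iff z _) (ex_intro _ eps (conj He _))). intros; lra. }
    exact (at_right0_elim _ (H _ HP)).
  - intros H P HP. apply locally_Cmod_iff in HP. destruct HP as [eps [He HP]].
    destruct (H (eps / 2) ltac:(lra)) as [d [Hd K]]. apply at_right0_intro with d; auto.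
    intros h Hh. apply HP. specialize (K h Hh). lra.
Qed.

Lemma shift_C (x : C) (h : R) (v : C) : Defs.shift x h v = (x + RtoC h * v)%C.
Proof. unfold Defs.shift. apply injective_projections; simpl; ring. Qed.

Lemma ccont_pair (a b : R -> R) (t : R) : continuous a t -> continuous b t -> ccont (fun u => (a u, b u)) t.
Proof.
  intros Ha Hb. apply ccont_ext_loc with (fun u => RtoC (a u) + Ci * RtoC (b u))%C 1; [lra| |].
  - intros u _. apply injective_projections; simpl; ring.
  - ccont_tac; now apply ccont_RtoC.
Qed.

Section DoubleLayer.
Variables (k0 : R) (e1 e2 : C) (l : R) (gamma nu : R -> C) (phi dphi : R -> C) (nup : point -> point) (phip : point -> C).
Hypotheses (hk0 : 0 < k0) (h1 : 0 < Im e1) (h2 : 0 < Im e2)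
  (Hl : 0 < l) (Hper : forall t, gamma (t + 2 * l) = gamma t)
  (Hgam : forall t : R, isd gamma t (Ci * nu t)%C)
  (Hn : forall t : R, ccont nu t) (Hunit : forall t, Cmod (nu t) = 1)
  (Hphi : forall t : R, isd phi t (dphi t)) (Hdphi : forall t : R, ccont dphi t)
  (Hphiper : forall t, phi (t + 2 * l) = phi t)
  (Enu : forall t, nup (gamma t) = nu t) (Ephi : forall t, phip (gamma t) = phi t).

Local Notation w := (double_layer k0 e1 e2 nup (2 * l) gamma phip).
Local Notation kp := (kappa e1 e2).

Lemma integrand_off (x : C) (t : R) : gamma t <> x ->
  double_layer_integrand k0 e1 e2 nup gamma phip x t = (-2 * kp * (dlk k0 e1 e2 (x - gamma t) (nu t) * phi t))%C.
Proof.
  intros H. unfold double_layer_integrand. rewrite Enu, Ephi, dot_grad_Phi; auto; [ring|].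
  intros E. apply H. rewrite <- (Cplus_0_l (gamma t)), <- E. ring.
Qed.

Lemma double_layer_isI (x : C) : (forall t, gamma t <> x) ->
  isI (double_layer_integrand k0 e1 e2 nup gamma phip x) 0 (2 * l)
    (-2 * kp * CI (fun t => dlk k0 e1 e2 (x - gamma t) (nu t) * phi t) 0 (2 * l))%C.
Proof.
  intros Hx. apply (is_RInt_ext (V := C_R_NormedModule) (fun t => (-2 * kp * (dlk k0 e1 e2 (x - gamma t) (nu t) * phi t))%C)).
  - intros t _. symmetry. apply integrand_off, Hx.
  - apply isI_scal, CI_correct; [lra|]. intros t _.
    apply (dlk_ccont k0 e1 e2 gamma nu phi dphi h1 h2 Hgam Hn Hphi x Hx).
Qed.

Lemma double_layer_off (x : C) : (forall t, gamma t <> x) ->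
  w x = (-2 * kp * CI (fun t => dlk k0 e1 e2 (x - gamma t) (nu t) * phi t) 0 (2 * l))%C.
Proof. intros Hx. apply (CI_unique _ 0 (2 * l)), double_layer_isI, Hx. Qed.

Lemma isd_double_layer_off (x e : C) (p : R -> C) (t : R) : (forall t, gamma t <> x) -> Cmod e <= 1 ->
  (forall u, p u = (x + RtoC (u - t) * e)%C) ->
  isd (fun u => w (p u)) t (-2 * kp * CI (fun t => dlk1 k0 e1 e2 (x - gamma t) e (nu t) * phi t) 0 (2 * l))%C.
Proof.
  intros Hx He Hp.
  destruct (off_dist l gamma nu Hl Hper Hgam x Hx) as [d [M [Hd HM]]].
  apply is_derive_ext_loc with (fun u => -2 * kp * CI (fun t => dlk k0 e1 e2 (p u - gamma t) (nu t) * phi t) 0 (2 * l))%C.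
  (* The closed form of the potential is available only off the curve, where points within distance
     d of x remain. *)
  - exists (mkposreal d Hd). intros u Hu. symmetry. apply double_layer_off.
    intros v E. destruct (HM v) as [A _]. rewrite E, Hp in A.
    replace (x - (x + RtoC (u - t) * e))%C with (- (RtoC (u - t) * e))%C in A by ring.
    rewrite Cmod_opp, Cmod_mult, Cmod_R in A. assert (B : Rabs (u - t) < d) by exact Hu.
    assert (C0 := Rabs_pos (u - t)). assert (C1 := Cmod_ge_0 e). nra.
  - apply isd_scal.
    apply is_derive_ext with (fun u => CI (fun v => dlk k0 e1 e2 (x + RtoC (u + - t) * e - gamma v) (nu v) * phi v)%C 0 (2 * l)).
    + intros u. rewrite Hp. reflexivity.
    + apply (isd_shift (fun r => CI (fun v => dlk k0 e1 e2 (x + RtoC r * e - gamma v) (nu v) * phi v)%C 0 (2 * l))).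
      replace (t + - t) with 0 by ring.
      apply (isd_double_layer k0 e1 e2 l gamma nu phi dphi h1 h2 Hl Hper Hgam Hn Hunit Hphi x Hx e He).
Qed.

Lemma double_layer_partials (x : C) : (forall t, gamma t <> x) ->
  isd (fun u => w (u, snd x)) (fst x) (-2 * kp * CI (fun t => dlk1 k0 e1 e2 (x - gamma t) 1 (nu t) * phi t) 0 (2 * l))%C /\
  isd (fun u => w (fst x, u)) (snd x) (-2 * kp * CI (fun t => dlk1 k0 e1 e2 (x - gamma t) Ci (nu t) * phi t) 0 (2 * l))%C.
Proof.
  intros Hx. split.
  - apply (isd_double_layer_off x 1 (fun u => (u, snd x))); auto.
    + rewrite Cmod_1. lra.
    + intros u. apply injective_projections; simpl; ring.
  - apply (isd_double_layer_off x Ci (fun u => (fst x, u))); auto.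
    + rewrite Cmod_Ci. lra.
    + intros u. apply injective_projections; simpl; ring.
Qed.

Lemma conormal_off (x nus : C) : (forall t, gamma t <> x) ->
  dot (grad w x) (mulA e1 e2 (cplx nus)) =
  (1 / (e1 * e2) * CI (fun t => G1 k0 e1 e2 0 (x - gamma t) (Ci * nus) * (kp * dphi t)) 0 (2 * l)
   + RtoC (k0 ^ 2) * CI (fun t => G0 k0 e1 e2 0 (x - gamma t) * (kp * (phi t * conormal_product e1 e2 nus (nu t)))) 0 (2 * l))%C.
Proof.
  intros Hx. destruct (double_layer_partials x Hx) as [D1 D2].
  assert (M := maue_off_boundary k0 e1 e2 l gamma nu phi dphi h1 h2 Hl Hper Hgam Hn Hphi Hdphi Hphiper x Hx nus).
  assert (E1 := neq0_of_Im _ h1). assert (E2 := neq0_of_Im _ h2).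
  apply CDerive_unique in D1. apply CDerive_unique in D2.
  match type of D1 with _ = ?a => match type of D2 with _ = ?c =>
    assert (EG : grad w x = (a, c)) by exact (f_equal2 pair D1 D2) end end.
  rewrite EG.
  unfold dot, mulA, cplx. simpl fst. simpl snd.
  set (J1 := CI (fun t => dlk1 k0 e1 e2 (x - gamma t) 1 (nu t) * phi t)%C 0 (2 * l)) in *.
  set (J2 := CI (fun t => dlk1 k0 e1 e2 (x - gamma t) Ci (nu t) * phi t)%C 0 (2 * l)) in *.
  transitivity (kp * (-2 * (RtoC (fst nus) / e1 * J1 + RtoC (snd nus) / e2 * J2)))%C; [field; auto|].
  rewrite M.
  assert (Hq : forall t, 0 < Im (qr e1 e2 0 (x - gamma t))).
  { intros t. rewrite qr_0. apply Qf_pos; auto. exact (off_neq gamma x Hx t). }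
  assert (Ho := isd_off gamma nu Hgam x).
  assert (CB : forall t, ccont (fun t => G1 k0 e1 e2 0 (x - gamma t) (Ci * nus) * dphi t)%C t).
  { intros t. apply (ccont_mult (fun t => G1 k0 e1 e2 0 (x - gamma t) (Ci * nus)) dphi); [|apply Hdphi].
    eapply isd_ccont, (isd_G1 k0 e1 e2 0 (fun t => x - gamma t)%C (fun _ => Ci * nus)%C); [apply Ho|apply isd_const|apply Hq]. }
  assert (CP : forall t, ccont (fun t => G0 k0 e1 e2 0 (x - gamma t) * (phi t * conormal_product e1 e2 nus (nu t)))%C t).
  { intros t. apply (ccont_mult (fun t => G0 k0 e1 e2 0 (x - gamma t)) (fun t => phi t * conormal_product e1 e2 nus (nu t)))%C.
    - eapply isd_ccont, isd_G0; [apply Ho|apply Hq].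
    - apply (ccont_mult phi (fun t => conormal_product e1 e2 nus (nu t))); [eapply isd_ccont, Hphi|].
      unfold conormal_product, dot, mulA, cplx, Cdiv. simpl fst. simpl snd.
      ccont_tac; first [apply ccont_fst|apply ccont_snd]; apply Hn. }
  rewrite (CI_ext (fun t => G1 k0 e1 e2 0 (x - gamma t) (Ci * nus) * (kp * dphi t))%C (fun t => kp * (G1 k0 e1 e2 0 (x - gamma t) (Ci * nus) * dphi t))%C);
    [|lra|intros; ring].
  rewrite (CI_ext (fun t => G0 k0 e1 e2 0 (x - gamma t) * (kp * (phi t * conormal_product e1 e2 nus (nu t))))%C
    (fun t => kp * (G0 k0 e1 e2 0 (x - gamma t) * (phi t * conormal_product e1 e2 nus (nu t))))%C); [|lra|intros; ring].
  rewrite !CI_scal; [ring|lra|intros t _; apply CP|lra|intros t _; apply CB].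
Qed.
End DoubleLayer.

(** * The jump relation *)

Section Jump.
Variables (k0 : R) (e1 e2 : C) (l : R) (gamma nu dtau phi dphi : R -> C) (nup : point -> point) (phip : point -> C).
Hypotheses (hk0 : 0 < k0) (h1 : 0 < Im e1) (h2 : 0 < Im e2)
  (Hl : 0 < l) (Hper : forall t, gamma (t + 2 * l) = gamma t)
  (Hsimple : forall s t, 0 <= s < 2 * l -> 0 <= t < 2 * l -> gamma s = gamma t -> s = t)
  (Hgam : forall t : R, isd gamma t (Ci * nu t)%C) (Htau : forall t : R, isd (fun t => Ci * nu t)%C t (dtau t))
  (Hdtau : forall t : R, ccont dtau t)
  (Hn : forall t : R, ccont nu t) (Hunit : forall t, Cmod (nu t) = 1)
  (Hphi : forall t : R, isd phi t (dphi t)) (Hdphi : forall t : R, ccont dphi t)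
  (Hphiper : forall t, phi (t + 2 * l) = phi t) (Hdphiper : forall t, dphi (t + 2 * l) = dphi t)
  (Enu : forall t, nup (gamma t) = nu t) (Ephi : forall t, phip (gamma t) = phi t).

Local Notation w := (double_layer k0 e1 e2 nup (2 * l) gamma phip).
Local Notation kp := (kappa e1 e2).
Local Notation tau := (fun t : R => Ci * nu t)%C.

Let Hutau : forall t, Cmod (tau t) = 1.
Proof. intros t. cbv beta. rewrite Cmod_mult, Cmod_Ci, Hunit. ring. Qed.

Definition dens1 (t : R) : C := (kp * dphi t)%C.
Definition dens2 (s t : R) : C := (kp * (phi t * conormal_product e1 e2 (nu s) (nu t)))%C.

Lemma dens1_ccont (t : R) : ccont dens1 t.
Proof. apply (ccont_mult (fun _ => kp) dphi); [apply ccont_const|apply Hdphi]. Qed.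

Lemma dens2_ccont (s t : R) : ccont (dens2 s) t.
Proof.
  apply (ccont_mult (fun _ => kp) (fun t => phi t * conormal_product e1 e2 (nu s) (nu t)))%C; [apply ccont_const|].
  apply (ccont_mult phi (fun t => conormal_product e1 e2 (nu s) (nu t))); [eapply isd_ccont, Hphi|].
  unfold conormal_product, dot, mulA, cplx, Cdiv. simpl fst. simpl snd.
  ccont_tac; first [apply ccont_fst|apply ccont_snd]; apply Hn.
Qed.

Lemma nu_periodic (t : R) : nu (t + 2 * l) = nu t.
Proof.
  assert (A : isd gamma t (Ci * nu (t + 2 * l))%C).
  { apply is_derive_ext with (fun u => gamma (u + 2 * l)); [apply Hper|]. apply isd_shift, Hgam. }
  assert (B := isd_unique _ _ _ _ A (Hgam t)).
  replace (nu t) with (- Ci * (Ci * nu t))%C by (destruct (nu t); apply injective_projections; simpl; ring).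
  rewrite <- B. destruct (nu (t + 2 * l)); apply injective_projections; simpl; ring.
Qed.

(** [chord_normal] covers only parameters within half a period of [s]; any other parameter is first
    translated by periods. *)
Lemma off_normal (s : R) : exists d, 0 < d /\ forall h t, 0 < Rabs h < d -> gamma t <> (gamma s + RtoC h * nu s)%C.
Proof.
  destruct (chord_normal (2 * l) gamma tau dtau ltac:(lra) Hper Hsimple Hgam Htau Hdtau Hutau s (nu s) eq_refl) as [c [d [Hc [Hd H]]]].
  exists d. split; [lra|]. intros h t Hh E.
  (* Reducing t - s + l to [0, 2 l) puts the translated parameter in [s - l, s + l). *)
  destruct (reduce_period (2 * l) ltac:(lra) (t - s + l)) as [k Hk].
  assert (P := periodic_IZR (2 * l) C gamma Hper k t). rewrite <- P in E.
  specialize (H h (t + IZR k * (2 * l)) ltac:(lra) ltac:(apply Rabs_le; lra)).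
  rewrite <- E in H. replace (gamma (t + IZR k * (2 * l)) - gamma (t + IZR k * (2 * l)))%C with (RtoC 0) in H by ring.
  rewrite Cmod_0 in H. assert (A := Rabs_pos (t + IZR k * (2 * l) - s)).
  assert (0 < c * (Rabs (t + IZR k * (2 * l) - s) + Rabs h)) by (apply Rmult_lt_0_compat; lra). lra.
Qed.

Lemma conormal_normal (s h : R) : (forall t, gamma t <> (gamma s + RtoC h * nu s)%C) ->
  dot (grad w (gamma s + RtoC h * nu s)%C) (mulA e1 e2 (cplx (nu s))) =
  (1 / (e1 * e2) * Tk k0 e1 e2 l gamma tau dens1 s (nu s) h
   + RtoC (k0 ^ 2) * CI (fun t => G0 k0 e1 e2 0 (gamma s + RtoC h * nu s - gamma t) * dens2 s t)%C s (s + 2 * l))%C.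
Proof.
  intros Hx. set (x := (gamma s + RtoC h * nu s)%C) in *.
  assert (E := conormal_off k0 e1 e2 l gamma nu phi dphi nup phip hk0 h1 h2 Hl Hper Hgam Hn Hunit Hphi Hdphi Hphiper Enu Ephi x (nu s) Hx).
  etransitivity; [exact E|].
  assert (Hq : forall t, 0 < Im (qr e1 e2 0 (x - gamma t))).
  { intros t. rewrite qr_0. apply Qf_pos; auto. exact (off_neq gamma x Hx t). }
  assert (Ho := isd_off gamma nu Hgam x).
  f_equal; f_equal.
  - unfold Tk. fold x. replace (s + l) with (s - l + 2 * l) by ring.
    rewrite <- (Rplus_0_l (2 * l)) at 1. apply (CI_periodic (fun t => G1 k0 e1 e2 0 (x - gamma t) (Ci * nu s) * dens1 t)%C); [lra| |].
    + intros t. apply (ccont_mult (fun t => G1 k0 e1 e2 0 (x - gamma t) (Ci * nu s)) dens1); [|apply dens1_ccont].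
      eapply isd_ccont, (isd_G1 k0 e1 e2 0 (fun t => x - gamma t)%C (fun _ => Ci * nu s)%C); [apply Ho|apply isd_const|apply Hq].
    + intros t. unfold dens1. now rewrite Hper, Hdphiper.
  - rewrite <- (Rplus_0_l (2 * l)) at 1. apply (CI_periodic (fun t => G0 k0 e1 e2 0 (x - gamma t) * dens2 s t)%C); [lra| |].
    + intros t. apply (ccont_mult (fun t => G0 k0 e1 e2 0 (x - gamma t)) (dens2 s)); [|apply dens2_ccont].
      eapply isd_ccont, isd_G0; [apply Ho|apply Hq].
    + intros t. unfold dens2. now rewrite Hper, Hphiper, nu_periodic.
Qed.

(** The k0^2 term converges by [sl_normal] and 1/(e1 e2) is a nonzero constant, so the limit exists
    exactly when that of [Tk] does, hence exactly when the single layer is differentiable at [s].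
    The sign [sg] disappears in |sg h| = h, so both sides of the curve give the same value. *)
Lemma conormal_limit_iff (s sg : R) (z : C) : sg = 1 \/ sg = -1 ->
  filterlim (fun h => dot (grad w (gamma s + RtoC (sg * h) * nu s)%C) (mulA e1 e2 (cplx (nu s)))) (at_right 0)
    (locally (T := C_UniformSpace) z) <->
  exists d, isd (SL k0 e1 e2 l gamma dens1) s d /\
    z = (1 / (e1 * e2) * d + RtoC (k0 ^ 2) * SL k0 e1 e2 l gamma (dens2 s) s)%C.
Proof.
  intros Hsg.
  assert (E1 := neq0_of_Im _ h1). assert (E2 := neq0_of_Im _ h2). assert (E12 := Cmult_neq_0 _ _ E1 E2).
  assert (As : forall h, 0 < h -> Rabs (sg * h) = h).
  { intros h Hh. rewrite Rabs_mult, (Rabs_pos_eq h) by lra. destruct Hsg as [-> | ->]; [rewrite Rabs_R1|rewrite Rabs_m1]; ring. }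
  destruct (off_normal s) as [d0 [Hd0 Off]].
  set (T := fun h => Tk k0 e1 e2 l gamma tau dens1 s (nu s) (sg * h)).
  set (V := fun h => CI (fun t => G0 k0 e1 e2 0 (gamma s + RtoC (sg * h) * nu s - gamma t) * dens2 s t)%C s (s + 2 * l)).
  set (f := fun h => dot (grad w (gamma s + RtoC (sg * h) * nu s)%C) (mulA e1 e2 (cplx (nu s)))).
  set (V0 := SL k0 e1 e2 l gamma (dens2 s) s).
  assert (Ef : forall h, 0 < h < d0 -> f h = (1 / (e1 * e2) * T h + RtoC (k0 ^ 2) * V h)%C).
  { intros h Hh. exact (conormal_normal s (sg * h) (fun t => Off (sg * h) t ltac:(rewrite As; lra))). }
  assert (LV : forall eps, 0 < eps -> exists d, 0 < d /\ forall h, 0 < h < d -> Cmod (V h - V0) <= eps).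
  { intros eps He.
    destruct (sl_normal k0 e1 e2 l gamma tau dtau h1 h2 Hl Hper Hsimple Hgam Htau Hdtau Hutau s (nu s) (dens2 s) eq_refl (dens2_ccont s) eps He) as [d [Hd H]].
    exists d. split; auto. intros h Hh. exact (H (sg * h) ltac:(rewrite As; lra)). }
  assert (TD : forall D, (forall eps, 0 < eps -> exists d, 0 < d /\ forall h, 0 < h < d -> Cmod (T h - D) <= eps) <->
     isd (SL k0 e1 e2 l gamma dens1) s D).
  { intros D.
    assert (I1 := Tk_lim_iff k0 e1 e2 l gamma tau dtau dens1 h1 h2 Hl Hper Hsimple Hgam Htau Hdtau Hutau dens1_ccont s (nu s) D sg eq_refl Hsg).
    assert (Hp : forall t, dens1 (t + 2 * l) = dens1 t) by (intros t; unfold dens1; now rewrite Hdphiper).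
    assert (I2 := SL_derive_iff k0 e1 e2 l gamma tau dtau dens1 h1 h2 Hl Hper Hsimple Hgam Htau Hdtau Hutau dens1_ccont Hp s D).
    etransitivity; [exact I1|]. symmetry. exact I2. }
  assert (comb : forall (c1 c2 : C) (A B : R -> C) (a b : C),
     (forall eps, 0 < eps -> exists d, 0 < d /\ forall h, 0 < h < d -> Cmod (A h - a) <= eps) ->
     (forall eps, 0 < eps -> exists d, 0 < d /\ forall h, 0 < h < d -> Cmod (B h - b) <= eps) ->
     forall eps, 0 < eps -> exists d, 0 < d /\ forall h, 0 < h < d -> Cmod (c1 * A h + c2 * B h - (c1 * a + c2 * b)) <= eps).
  { intros c1 c2 A B a b HA HB eps He.
    assert (N1 := Cmod_ge_0 c1). assert (N2 := Cmod_ge_0 c2).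
    destruct (HA (eps / (2 * (Cmod c1 + 1)))) as [d1 [P1 Q1]]; [apply Rdiv_lt_0_compat; lra|].
    destruct (HB (eps / (2 * (Cmod c2 + 1)))) as [d2 [P2 Q2]]; [apply Rdiv_lt_0_compat; lra|].
    exists (Rmin d1 d2). split; [now apply Rmin_pos|]. intros h Hh.
    assert (M1 := Rmin_l d1 d2). assert (M2 := Rmin_r d1 d2). specialize (Q1 h ltac:(lra)). specialize (Q2 h ltac:(lra)).
    replace (c1 * A h + c2 * B h - (c1 * a + c2 * b))%C with (c1 * (A h - a) + c2 * (B h - b))%C by ring.
    apply Rle_trans with ((Cmod c1 + 1) * (eps / (2 * (Cmod c1 + 1))) + (Cmod c2 + 1) * (eps / (2 * (Cmod c2 + 1)))).
    - apply Cmod_plus_le; rewrite Cmod_mult; apply Rmult_le_compat; try lra; apply Cmod_ge_0.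
    - right. field. lra. }
  assert (Heq : forall (A B : R -> C) (a : C), (forall h, 0 < h < d0 -> A h = B h) ->
     (forall eps, 0 < eps -> exists d, 0 < d /\ forall h, 0 < h < d -> Cmod (A h - a) <= eps) ->
     (forall eps, 0 < eps -> exists d, 0 < d /\ forall h, 0 < h < d -> Cmod (B h - a) <= eps)).
  { intros A B a EAB HA eps He. destruct (HA eps He) as [d [Hd H]].
    exists (Rmin d d0). split; [now apply Rmin_pos|]. intros h Hh.
    assert (M1 := Rmin_l d d0). assert (M2 := Rmin_r d d0). rewrite <- EAB by lra. apply H; lra. }
  etransitivity; [apply (filterlim_at_right0_C f z)|]. split.
  (* The witness is the formula for z solved for d. *)
  - intros Hf. exists ((e1 * e2) * z + (- (e1 * e2) * RtoC (k0 ^ 2)) * V0)%C. split; [|field; auto].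
    apply TD. apply (Heq (fun h => (e1 * e2) * f h + (- (e1 * e2) * RtoC (k0 ^ 2)) * V h)%C).
    + intros h Hh. rewrite Ef by auto. field. auto.
    + apply comb; auto.
  - intros [d [Hd ->]]. assert (HdT := proj2 (TD d) Hd).
    apply (Heq (fun h => 1 / (e1 * e2) * T h + RtoC (k0 ^ 2) * V h)%C).
    + intros h Hh. now rewrite Ef.
    + apply comb; auto.
Qed.

Lemma single_layer_integrals (s : R) :
  let V1 := fun t => (Phi k0 e1 e2 (gamma s) (gamma t) * dphi t)%C in
  let V2 := fun t => (Phi k0 e1 e2 (gamma s) (gamma t) * phi t * conormal_product e1 e2 (nu s) (nu t))%C in
  (ex_sing_int (2 * l) s V1 /\ sing_int (2 * l) s V1 = SL k0 e1 e2 l gamma dens1 s) /\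
  (ex_sing_int (2 * l) s V2 /\ sing_int (2 * l) s V2 = SL k0 e1 e2 l gamma (dens2 s) s).
Proof.
  intros V1 V2.
  assert (Hne : forall t, s < t < s + 2 * l -> (gamma s - gamma t)%C <> RtoC 0).
  { intros t Ht E. assert (E' : gamma s = gamma t) by (rewrite <- (Cplus_0_l (gamma t)), <- E; ring).
    apply (gam_injective (2 * l) gamma ltac:(lra) Hper Hsimple) in E'; [lra|]. rewrite Rabs_left; lra. }
  split.
  - apply sing_int_ext; [lra| |].
    + intros t Ht. unfold V1, dens1. rewrite Phi_G0; auto. ring.
    + apply (sl_exists k0 e1 e2 l gamma tau dtau h1 h2 Hl Hper Hsimple Hgam Htau Hdtau Hutau s dens1 dens1_ccont).
  - apply sing_int_ext; [lra| |].
    + intros t Ht. unfold V2, dens2. rewrite Phi_G0; auto. ring.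
    + apply (sl_exists k0 e1 e2 l gamma tau dtau h1 h2 Hl Hper Hsimple Hgam Htau Hdtau Hutau s (dens2 s) (dens2_ccont s)).
Qed.

Lemma holder_derivative (s : R) : holder_at dphi s -> exists d, isd (SL k0 e1 e2 l gamma dens1) s d.
Proof.
  intros [M [al [Hal H]]].
  destruct (holder_limit k0 e1 e2 l gamma tau dtau dens1 h1 h2 Hl Hper Hsimple Hgam Htau Hdtau Hutau dens1_ccont s (Cmod kp * M) al Hal) as [J HJ].
  - intros t. unfold dens1. replace (kp * dphi t - kp * dphi s)%C with (kp * (dphi t - dphi s))%C by ring.
    rewrite Cmod_mult, Rmult_assoc. apply Rmult_le_compat_l; [apply Cmod_ge_0|apply H].
  - exists J. assert (Hp : forall t, dens1 (t + 2 * l) = dens1 t) by (intros t; unfold dens1; now rewrite Hdphiper).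
    apply (SL_derive_iff k0 e1 e2 l gamma tau dtau dens1 h1 h2 Hl Hper Hsimple Hgam Htau Hdtau Hutau dens1_ccont Hp s J). exact HJ.
Qed.
End Jump.

Theorem lemma2p4 (k0 : R) (eps1 eps2 : C)
  (Omega : point -> Prop) (nu : point -> point)
  (L : R) (gamma : R -> point) (phi : point -> C)
  (hk0 : 0 < k0)
  (hRe : Re eps1 * Re eps2 < 0) (hIm1 : 0 < Im eps1) (hIm2 : 0 < Im eps2)
  (hOmega : bounded_simply_connected_domain Omega)
  (hGamma : C2_boundary Omega nu L gamma)
  (hphi : C1_on_curve gamma phi) :
  let w := double_layer k0 eps1 eps2 nu L gamma phi in
  let V1 := fun s t : R =>
    (Phi k0 eps1 eps2 (gamma s) (gamma t) * arc_derive gamma phi t)%C in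
  let V2 := fun s t : R =>
    (Phi k0 eps1 eps2 (gamma s) (gamma t) * phi (gamma t)
     * dot (cplx (nu (gamma s))) (mulA eps1 eps2 (cplx (nu (gamma t)))))%C in
  (* the potential and the integrals in the formula are well defined *)
  (forall x, ~ boundary Omega x ->
     ex_RInt (V := C_R_NormedModule)
       (double_layer_integrand k0 eps1 eps2 nu gamma phi x) 0 L /\
     ex_grad w x) /\
  (forall s, ex_sing_int L s (V1 s) /\ ex_sing_int L s (V2 s)) /\
  (* equality of the one-sided limits with the right-hand side, as partially
     defined quantities: one exists if and only if the other does *)
  (forall s sg, sg = 1 \/ sg = -1 -> forall l : C,
     is_conormal_lim eps1 eps2 nu w sg (gamma s) l <->
     exists d : C,
       is_derive (V := C_R_NormedModule) (fun u => sing_int L u (V1 u)) s d /\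
       l = (1 / (eps1 * eps2) * d + RtoC (k0 ^ 2) * sing_int L s (V2 s))%C) /\
  (* both sides exist wherever dphi/ds satisfies a Hoelder condition *)
  (forall s, holder_at (arc_derive gamma phi) s ->
     exists d : C,
       is_derive (V := C_R_NormedModule) (fun u => sing_int L u (V1 u)) s d).
Proof.
  intros w V1 V2. destruct hGamma as [HL Hper Hsimple Honto [C21 C22] Hunit _ Htan].
  clear hRe hOmega.
  (* The half-length makes the period around s symmetric, [s - l, s + l]. *)
  set (l := L / 2). assert (EL : L = 2 * l) by (unfold l; field). clearbody l. subst L.
  assert (Hl : 0 < l) by lra.
  set (n := fun t : R => nu (gamma t) : C).
  set (ph := fun t : R => phi (gamma t)). set (dph := arc_derive gamma phi).
  (* Multiplication by i turns the normal into the tangent [-nu_2, nu_1]. *)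
  assert (Hgam : forall t : R, isd (gamma : R -> C) t (Ci * n t)%C).
  { intros t. apply isd_pair. destruct (Htan t) as [T1 T2]. split.
    - evar_last; [exact T1|]. unfold n. simpl. ring.
    - evar_last; [exact T2|]. unfold n. simpl. ring. }
  set (dtau := fun t : R => (Derive_n (fun s => fst (gamma s)) 2 t, Derive_n (fun s => snd (gamma s)) 2 t) : C).
  assert (Htau : forall t : R, isd (fun t => Ci * n t)%C t (dtau t)).
  { intros t. apply isd_pair. split.
    - apply is_derive_ext with (Derive (fun s => fst (gamma s))).
      + intros u. transitivity (- snd (nu (gamma u))); [apply is_derive_unique, Htan|]. unfold n. simpl. ring.
      + apply (Derive_correct (Derive_n (fun s => fst (gamma s)) 1)). apply (C21 t).
    - apply is_derive_ext with (Derive (fun s => snd (gamma s))).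
      + intros u. transitivity (fst (nu (gamma u))); [apply is_derive_unique, Htan|]. unfold n. simpl. ring.
      + apply (Derive_correct (Derive_n (fun s => snd (gamma s)) 1)). apply (C22 t). }
  assert (Hdtau : forall t : R, ccont dtau t) by (intros t; apply ccont_pair; [apply C21|apply C22]).
  (* No regularity of [nu] is assumed directly; along the curve it is -i times the tangent, which is
     differentiable because the curve is of class C^2. *)
  assert (Hn : forall t : R, ccont n t).
  { intros t. apply ccont_ext_loc with (fun t => - Ci * (Ci * n t))%C 1; [lra| |].
    - intros u _. destruct (n u). apply injective_projections; simpl; ring.
    - apply (ccont_mult (fun _ => - Ci)%C (fun t => Ci * n t)%C); [apply ccont_const|eapply isd_ccont, Htau]. }
  assert (Hu : forall t, Cmod (n t) = 1).
  { intros t. unfold Cmod, n. rewrite Hunit; [apply sqrt_1|]. apply Honto. now exists t. }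
  assert (Hphi : forall t : R, isd ph t (dph t)).
  { intros t. destruct (hphi t) as [[y Hy] _]. eapply isd_eq; [exact Hy|]. symmetry. apply CDerive_unique, Hy. }
  assert (Hdphi : forall t : R, ccont dph t) by (intros t; apply hphi).
  assert (Hphiper : forall t, ph (t + 2 * l) = ph t) by (intros t; unfold ph; now rewrite Hper).
  assert (Hdphiper : forall t, dph (t + 2 * l) = dph t).
  { intros t. apply (isd_unique ph t); [|apply Hphi].
    apply is_derive_ext with (fun u => ph (u + 2 * l)); [apply Hphiper|]. apply isd_shift, Hphi. }
  assert (SI := single_layer_integrals k0 eps1 eps2 l gamma n dtau ph dph hk0 hIm1 hIm2 Hl Hper Hsimple Hgam Htau Hdtau Hn Hu Hphi Hdphi).
  cbv zeta in SI.
  split; [|split; [|split]].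
  - intros x Hx. assert (Hoff : forall t, gamma t <> x) by (intros t E; apply Hx, Honto; now exists t).
    split.
    + eexists. apply (double_layer_isI k0 eps1 eps2 l gamma n ph dph nu phi hk0 hIm1 hIm2 Hl Hgam Hn Hphi (fun _ => eq_refl) (fun _ => eq_refl) x Hoff).
    + destruct (double_layer_partials k0 eps1 eps2 l gamma n ph dph nu phi hk0 hIm1 hIm2 Hl Hper Hgam Hn Hu Hphi (fun _ => eq_refl) (fun _ => eq_refl) x Hoff) as [D1 D2].
      split; eexists; [exact D1|exact D2].
  - intros s. destruct (SI s) as [[A _] [B _]]. split; [exact A|exact B].
  - intros s sg Hsg z. destruct (SI s) as [_ [_ EV2]].
    assert (J := conormal_limit_iff k0 eps1 eps2 l gamma n dtau ph dph nu phi hk0 hIm1 hIm2 Hl Hper Hsimple Hgam Htau Hdtau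
      Hn Hu Hphi Hdphi Hphiper Hdphiper (fun _ => eq_refl) (fun _ => eq_refl) s sg z Hsg).
    unfold is_conormal_lim.
    assert (E : forall h, dot (grad w (Defs.shift (gamma s) (sg * h) (nu (gamma s)))) (mulA eps1 eps2 (cplx (nu (gamma s))))
       = dot (grad w (gamma s + RtoC (sg * h) * n s)%C) (mulA eps1 eps2 (cplx (n s)))).
    { intros h. now rewrite shift_C. }
    etransitivity; [|etransitivity; [exact J|]].
    + split; apply filterlim_ext; intros h; [|symmetry]; apply E.
    + change (sing_int (2 * l) s (V2 s)) with (sing_int (2 * l) s (fun t => (Phi k0 eps1 eps2 (gamma s) (gamma t) * ph t * conormal_product eps1 eps2 (n s) (n t))%C)).
      rewrite EV2. split; intros [d [Hd Ed]]; exists d; (split; [|exact Ed]).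
      * apply is_derive_ext with (2 := Hd). intros u. symmetry. apply (SI u).
      * apply is_derive_ext with (2 := Hd). intros u. apply (SI u).
  - intros s Hs.
    destruct (holder_derivative k0 eps1 eps2 l gamma n dtau dph hIm1 hIm2 Hl Hper Hsimple Hgam Htau Hdtau Hu Hdphi Hdphiper s Hs) as [d Hd].
    exists d. apply is_derive_ext with (2 := Hd). intros u. symmetry. apply (SI u).
Qed.
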